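(* Let $1\le p\le\infty$, let $\alpha \in L^{1}(\mathbb{R})$ and let $w\in C^{2}(\mathbb{R})$ with $w(0)=0$. Consider the Cauchy problem $$u_{tt}(x,t)=\int_{\mathbb{R}} \alpha(y-x)\, w\big(u(y,t)-u(x,t)\big)\,dy,\quad x\in\mathbb{R},\ t>0,\qquad u(x,0)=\varphi(x),\ u_t(x,0)=\psi(x).$$ Then for initial data $\varphi,\psi\in W^{1,p}(\mathbb{R})$ there is some $T>0$ such that this Cauchy problem is well posed with solution in $C^{2}([0,T],W^{1,p}(\mathbb{R}))$.
   Context: $W^{1,p}(\mathbb{R})$ is the Sobolev space of $L^p$ functions whose distributional derivative is in $L^p$, with norm $\|u\|_p+\|u'\|_p$. ''Well posed with solution in $C^2([0,T],X)$'' means: there exists a unique solution $u\in C^2([0,T],X)$ of the Cauchy problem, and the solution depends continuously on the initial data $(\varphi,\psi)\in X\times X$ (in the norm of $C([0,T],X)$). *)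

(* Defs.v *)
From HB Require Import structures.
From mathcomp Require Import all_boot all_order all_algebra.
From mathcomp Require Import all_classical all_reals all_analysis.
Set Implicit Arguments. Unset Strict Implicit. Unset Printing Implicit Defensive.
Import Order.TTheory GRing.Theory Num.Theory.
Import numFieldNormedType.Exports.
Local Open Scope classical_set_scope.
Local Open Scope ring_scope.

Section defs.
Context {R : realType}.
Local Notation mu := (@lebesgue_measure R).

Definition Lp_norm (p : \bar R) (f : R -> R) : \bar R := Lnorm mu p (EFin \o f).

Definition test_function (phi : R -> R) : Prop :=
  (forall (n : nat) (x : R), derivable (derive1n n phi) x 1) /\
  (exists M : R, forall x : R, M < `|x| -> phi x = 0).

Definition weak_derivative (u g : R -> R) : Prop :=
  measurable_fun setT u /\ measurable_fun setT g /\
  forall phi, test_function phi ->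
    Rintegral mu setT (fun x => u x * derive1 phi x)
    = - Rintegral mu setT (fun x => g x * phi x).

(* W^{1,p} norm ||u||_p + ||u'||_p  (+oo if u has no weak derivative) *)
Definition W1p_norm (p : \bar R) (u : R -> R) : \bar R :=
  ereal_inf [set (Lp_norm p u + Lp_norm p g)%E | g in weak_derivative u].

Definition in_W1p (p : \bar R) (u : R -> R) : Prop := (W1p_norm p u < +oo)%E.

Definition aeq (f g : R -> R) : Prop := ae_eq mu setT f g.

Definition nl_op (alpha w : R -> R) (u : R -> R) (x : R) : R :=
  Rintegral mu setT (fun y => alpha (y - x) * w (u y - u x)).

Definition C2_real (w : R -> R) : Prop :=
  (forall x, derivable w x 1) /\ (forall x, derivable (derive1 w) x 1) /\
  continuous (derive1 (derive1 w)).

(* Curves [0,T] -> W^{1,p}, represented by u : R -> (R -> R), u t = u(.,t). *)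
Definition X_deriv (p : \bar R) (T : R) (u v : R -> R -> R) : Prop :=
  forall t, 0 <= t <= T -> forall e : R, 0 < e -> exists d : R, 0 < d /\
    forall s, 0 <= s <= T -> s != t -> `|s - t| < d ->
      (W1p_norm p (fun x => ((u s x - u t x) / (s - t) - v t x)%R) <= e%:E)%E.

Definition X_cont (p : \bar R) (T : R) (u : R -> R -> R) : Prop :=
  forall t, 0 <= t <= T -> forall e : R, 0 < e -> exists d : R, 0 < d /\
    forall s, 0 <= s <= T -> `|s - t| < d ->
      (W1p_norm p (fun x => (u s x - u t x)%R) <= e%:E)%E.

Definition is_solution (p : \bar R) (alpha w : R -> R) (phi psi : R -> R)
    (T : R) (u : R -> R -> R) : Prop :=
  exists u1 u2 : R -> R -> R,
    (forall t, 0 <= t <= T ->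
       in_W1p p (u t) /\ in_W1p p (u1 t) /\ in_W1p p (u2 t)) /\
    X_deriv p T u u1 /\ X_deriv p T u1 u2 /\ X_cont p T u2 /\
    (forall t, 0 < t <= T -> aeq (u2 t) (nl_op alpha w (u t))) /\
    aeq (u 0) phi /\ aeq (u1 0) psi.

Definition well_posed (p : \bar R) (alpha w : R -> R) (phi psi : R -> R)
    (T : R) : Prop :=
  (exists u, is_solution p alpha w phi psi T u) /\
  (forall u v, is_solution p alpha w phi psi T u ->
     is_solution p alpha w phi psi T v ->
     forall t, 0 <= t <= T -> aeq (u t) (v t)) /\
  (forall u, is_solution p alpha w phi psi T u ->
     forall e : R, 0 < e -> exists d : R, 0 < d /\
       forall phi' psi', in_W1p p phi' -> in_W1p p psi' ->
         (W1p_norm p (fun x => (phi' x - phi x)%R)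
          + W1p_norm p (fun x => (psi' x - psi x)%R) < d%:E)%E ->
         exists v, is_solution p alpha w phi' psi' T v /\
           forall t, 0 <= t <= T ->
             (W1p_norm p (fun x => (v t x - u t x)%R) <= e%:E)%E).
End defs.

(* Main.v *)
Require Import Defs.
From HB Require Import structures.
From mathcomp Require Import all_boot all_order all_algebra ring lra.
From mathcomp Require Import all_classical all_reals all_analysis.
From mathcomp Require Import measurable_realfun ess_sup_inf.
Set Implicit Arguments. Unset Strict Implicit. Unset Printing Implicit Defensive.
Import Order.TTheory GRing.Theory Num.Theory.
Import numFieldNormedType.Exports.
Local Open Scope classical_set_scope.
Local Open Scope ring_scope.

(**
On W^{1,p}(R), functions are bounded by their norm.  Substituting y = x + z, the
right-hand side K u = int al(z) w(u(. + z) - u) dz is a superposition of translates,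
and by the chain rule its weak derivative is
int al(z) w'(u(. + z) - u) (u'(. + z) - u') dz.  On norm-bounded sets w and w' are
Lipschitz along the increments, so Minkowski's integral inequality gives
||K u - K v|| <= C ||al||_1 ||u - v||: K is locally Lipschitz.  Hence the first-order
system (u, v)' = (v, K u) is a locally Lipschitz ODE in a complete seminormed space.
Euler polygons for it are Cauchy, with a time of existence depending only on a bound
for the data, and Gronwall's inequality yields uniqueness and continuous dependence.
Working with seminorms on actual functions avoids quotienting by a.e. equality.
*)

(** The norm is an infimum over weak derivatives. Rather than proving that these agree a.e., every
    estimate is made for a near-optimal derivative, with an error that is removed at the end. The
    sup bound holds only off a null set, whereas the operator reads its argument at every point, so
    functions are first truncated on a null set. Smooth functions are not dense for p = +oo; the
    chain rule therefore avoids density in W^{1,p}: a weak derivative is locally integrable, the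
    function is its primitive at Lebesgue points, and on a bounded interval the derivative is
    approximated in L^1. The test functions for this are built from exp(-1/x). Euler polygons are
    finite sums, so no vector-valued integral has to be set up, as Picard iteration would demand. In
    [is_solution] the equation is imposed for t > 0 only; continuity of the second derivative
    carries it to t = 0. Continuous dependence asks perturbed problems to be solvable on the same
    [0, T], which is why the existence time must be uniform over bounded data. *)

(** * A Gronwall inequality for forward increments, and elementary inequalities *)

(** Comparison with [G t = (E 0 + eps + eta) * expR ((L + 1) * t)]: from the supremum of the times
    with [E <= G] one more step forward is still possible. The rate [L + 1] instead of [L] lets the
    exponential absorb the inhomogeneous term, because [eps + eta <= G]. Apart from continuity, only
    forward increments of [E] are controlled, which is what a polygon provides. *)
Lemma gronwall (R : realType) (E : R -> R) (T L eps : R) :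
  0 <= L -> 0 <= eps -> 0 <= E 0 ->
  (forall t : R, 0 <= t <= T -> forall e : R, 0 < e -> exists2 d : R, 0 < d &
     forall s : R, 0 <= s <= T -> `|s - t| < d -> `|E s - E t| <= e) ->
  (forall t : R, 0 <= t < T -> forall e : R, 0 < e -> exists2 d : R, 0 < d &
     forall s : R, t <= s <= T -> s < t + d ->
       E s <= E t + (s - t) * (L * E t + eps + e)) ->
  forall t : R, 0 <= t <= T -> E t <= (E 0 + eps) * expR ((L + 1) * t).
Proof.
move=> L0 eps0 E0 Ec Eg t1 t1T.
apply/ler_addgt0Pr => e e0.
have ex0 := expR_gt0 ((L + 1) * t1).
(* With this [eta] the barrier exceeds the claimed bound at [t1] by exactly [e]. *)
pose eta := e / expR ((L + 1) * t1).
have eta0 : 0 < eta by rewrite divr_gt0.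
pose G t := (E 0 + eps + eta) * expR ((L + 1) * t).
suff : E t1 <= G t1 by rewrite /G mulrDl /eta divfK// gt_eqF.
rewrite leNgt; apply/negP => Gt1.
pose S := [set t | 0 <= t <= t1 /\ E t <= G t].
have Gmon s t : s <= t -> G s <= G t.
  move=> st; rewrite /G ler_wpM2l//; first by rewrite !addr_ge0// ltW.
  by rewrite ler_expR ler_wpM2l// addr_ge0.
have t1ge0 : 0 <= t1 by case/andP: t1T.
have S0 : S 0.
  by split; [rewrite lexx t1ge0|rewrite /G mulr0 expR0; lra].
have hS : has_sup S by split; [exists 0|exists t1 => t [/andP[_ ?] _]].
have ub : ubound S (sup S) by apply: sup_upper_bound.
have s0 : 0 <= sup S by exact: ub.
have st1 : sup S <= t1 by apply: ge_sup => [|t [/andP[]]//]; exists 0.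
have sT : 0 <= sup S <= T by rewrite s0 (le_trans st1)//; case/andP: t1T.
(* Continuity of [E] and monotonicity of [G] put the supremum itself into [S]. *)
have Es : E (sup S) <= G (sup S).
  rewrite leNgt; apply/negP => GE.
  have g0 : 0 < (E (sup S) - G (sup S)) / 2 by rewrite divr_gt0 ?subr_gt0.
  have [d d0 Hd] := Ec _ sT _ g0.
  have [t St lt_t] := sup_adherent d0 hS.
  have tle : t <= sup S by exact: ub.
  have [tt1 EtGt] := St.
  have tT : 0 <= t <= T by lra.
  have := Hd t tT; rewrite ltr_distlC => /(_ ltac:(lra)).
  rewrite ler_distlC => H.
  have := Gmon _ _ tle; lra.
have {}st1 : sup S < t1.
  by rewrite lt_neqAle st1 andbT; apply/eqP => H; rewrite H in Es; lra.
have sT' : 0 <= sup S < T by rewrite s0 (lt_le_trans st1)//; case/andP: t1T.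
have [d d0 Hd] := Eg (sup S) sT' _ eta0.
pose t := Num.min t1 (sup S + d / 2).
have tgt : sup S < t by rewrite lt_min st1/= ltrDl divr_gt0.
have tt1 : t <= t1 by rewrite ge_min lexx.
have tle : t < sup S + d.
  by apply: (@le_lt_trans _ _ (sup S + d / 2)); [rewrite ge_min lexx orbT|rewrite ltrD2l; lra].
have := Hd t ltac:(lra) tle => H.
suff : S t by move=> /ub; lra.
split; first lra.
apply: (le_trans H).
set s := sup S in s0 Es tgt tle H *.
have Gs : E 0 + eps + eta <= G s.
  rewrite /G ler_peMr//; first by lra.
  by rewrite -[X in X <= _]expR0 ler_expR mulr_ge0 ?addr_ge0.
have -> : G t = G s * expR ((L + 1) * (t - s)).
  by rewrite /G -mulrA -expRD; congr (_ * expR _); ring.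
have := expR_ge1Dx ((L + 1) * (t - s)).
set x := expR _ => Hx.
have Gs0 : 0 <= G s by lra.
have h1 : G s * (1 + (L + 1) * (t - s)) <= G s * x by rewrite ler_wpM2l.
have h2 : L * E s <= L * G s by rewrite ler_wpM2l.
have h3 : (t - s) * (L * E s + eps + eta) <= (t - s) * (L * G s + G s).
  by rewrite ler_wpM2l; lra.
lra.
Qed.

(** The projection onto [0, T] extends a curve controlled on [0, T] to the whole line without losing
    continuity. *)
Lemma clamp_lip (R : realType) (T s t : R) : 0 <= T ->
  `|Num.max 0 (Num.min s T) - Num.max 0 (Num.min t T)| <= `|s - t|.
Proof.
move=> T0.
case: (leP s T) => ?; case: (leP t T) => ?; rewrite ?(max_r T0).
- case: (leP 0 s) => ?; case: (leP 0 t) => ?; case: (ler0P (s - t)) => ?; rewrite ?ler_norml; lra.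
- case: (leP 0 s) => ?; case: (ler0P (s - t)) => ?; rewrite ?ler_norml; lra.
- case: (leP 0 t) => ?; case: (ler0P (s - t)) => ?; rewrite ?ler_norml; lra.
- rewrite subrr normr0//.
Qed.

Lemma min_increment_mono (R : realType) (a h s t : R) : 0 <= h -> s <= t ->
  Num.min s (a+h) - Num.min s a <= Num.min t (a+h) - Num.min t a.
Proof.
move=> h0 st.
case: (leP s a) => ?; case: (leP t a) => ?; case: (leP s (a+h)) => ?;case: (leP t (a+h)) => ?; lra.
Qed.

Lemma sub2_split (V : zmodType) (a b c a' b' c' : V) :
  a - b - c = a' - b' - c' + ((a - a') - (b - b') - (c - c')).
Proof.
by rewrite [RHS]addrACA [X in _ = X + _]addrACA -!opprD !subrKC.
Qed.

(** * Ordinary differential equations in complete seminormed spaces *)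

Section seminormed.
Context {R : realType} {V : lmodType R}.
Variables (D : V -> Prop) (N : V -> R).

(** The ambient module will be all functions on the line, so [D] singles out the subspace on which
    [N] has a meaning. Null elements may be nonzero: limits exist but are determined only up to [N]
    of the difference being 0. *)
Record complete_seminorm : Prop := CompleteSeminorm {
  csn_zero : D 0 ;
  csn_add : forall u v, D u -> D v -> D (u + v) ;
  csn_scale : forall a u, D u -> D (a *: u) ;
  csn_ge0 : forall u, D u -> 0 <= N u ;
  csn_ler : forall u v, D u -> D v -> N (u + v) <= N u + N v ;
  csn_norm : forall a u, D u -> N (a *: u) = `|a| * N u ;
  csn_complete : forall f : nat -> V, (forall n, D (f n)) ->
    (forall e : R, 0 < e -> exists n0, forall m n, (n0 <= m)%N -> (n0 <= n)%N ->
       N (f m - f n) <= e) ->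
    exists2 l, D l & forall e : R, 0 < e -> exists n0, forall n, (n0 <= n)%N ->
       N (f n - l) <= e }.

Hypothesis cs : complete_seminorm.
Let D0 := csn_zero cs.
Let DD := csn_add cs.
Let DZ := csn_scale cs.
Let Nge0 := csn_ge0 cs.
Let ND := csn_ler cs.
Let NZ := csn_norm cs.

Lemma csn_opp u : D u -> D (- u).
Proof. by move=> Du; rewrite -scaleN1r; exact: DZ. Qed.
Let DN := csn_opp.

Lemma csn_sub u v : D u -> D v -> D (u - v).
Proof. by move=> Du Dv; apply: DD => //; exact: DN. Qed.
Let DB := csn_sub.

Lemma csn_sum n (f : nat -> V) : (forall i, (i < n)%N -> D (f i)) ->
  D (\sum_(0 <= i < n) f i).
Proof.
elim: n => [|n IH] Df; first by rewrite big_nil.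
rewrite big_nat_recr//=; apply: DD; last exact: Df.
by apply: IH => i /ltnW; exact: Df.
Qed.

Lemma csn_norm0 : N 0 = 0.
Proof. by rewrite -(scale0r 0) NZ// normr0 mul0r. Qed.

Lemma csn_normN u : D u -> N (- u) = N u.
Proof. by move=> Du; rewrite -scaleN1r NZ// normrN1 mul1r. Qed.

Lemma csn_distC u v : D u -> D v -> N (u - v) = N (v - u).
Proof. by move=> Du Dv; rewrite -opprB csn_normN//; exact: DB. Qed.

Lemma csn_lerB u v : D u -> D v -> N (u - v) <= N u + N v.
Proof. by move=> Du Dv; rewrite -(csn_normN Dv); apply: ND => //; exact: DN. Qed.

Lemma csn_triangle v u w : D u -> D v -> D w -> N (u - w) <= N (u - v) + N (v - w).
Proof.
move=> Du Dv Dw; rewrite -[u - w](_ : (u - v) + (v - w) = _).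
  by apply: ND; exact: DB.
by rewrite addrA subrK.
Qed.

Lemma csn_leBD u v : D u -> D v -> N u <= N (u - v) + N v.
Proof. by move=> Du Dv; rewrite -{1}(subrK v u); apply: ND => //; exact: DB. Qed.

Lemma csn_dist_norm u v : D u -> D v -> `|N u - N v| <= N (u - v).
Proof.
move=> Du Dv; rewrite ler_distlC; have := csn_leBD Du Dv.
have := csn_leBD Dv Du; rewrite (csn_distC Dv Du); lra.
Qed.

Lemma csn_ler_sum n (f : nat -> V) (c : nat -> R) :
  (forall i, (i < n)%N -> D (f i)) -> (forall i, (i < n)%N -> N (f i) <= c i) ->
  N (\sum_(0 <= i < n) f i) <= \sum_(0 <= i < n) c i.
Proof.
elim: n => [|n IH] Df Nf; first by rewrite !big_nil csn_norm0.
rewrite !big_nat_recr//=; apply: (le_trans (ND _ _)).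
- by apply: csn_sum => i /ltnW; exact: Df.
- exact: Df.
- apply: lerD; last exact: Nf.
  by apply: IH => i /ltnW; [exact: Df|exact: Nf].
Qed.

Section flow.
Variable F : V -> V.
Hypothesis FD : forall u, D u -> D (F u).

(** Local here means on balls, with a constant depending on the radius alone; a constant depending
    on the point would not give a uniform existence time. *)
Definition locally_lipschitz := forall M : R, exists2 L : R, 0 <= L &
  forall u v, D u -> D v -> N u <= M -> N v <= M ->
    N (F u - F v) <= L * N (u - v).

(* [U' = F U] on [0, T[ up to a defect [eps]. *)
Definition approx_solution (T eps : R) (U : R -> V) :=
  [/\ forall t : R, 0 <= t <= T -> D (U t),
   forall t : R, 0 <= t <= T -> forall e : R, 0 < e -> exists2 d : R, 0 < d &
     forall s : R, 0 <= s <= T -> `|s - t| < d -> N (U s - U t) <= e &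
   forall t : R, 0 <= t < T -> forall e : R, 0 < e -> exists2 d : R, 0 < d &
     forall s : R, t <= s <= T -> s < t + d ->
       N (U s - U t - (s - t) *: F (U t)) <= (s - t) * (eps + e)].

(** Gronwall for [t => N (U t - W t)]: over a short step the difference changes by the two defects
    and by [(s - t) *: (F (U t) - F (W t))], which [FL] controls since both curves stay in the ball
    of radius [M]. With positive defects this makes the polygons Cauchy; with zero defects it gives
    uniqueness and continuous dependence. *)
Lemma approx_solution_dist (T L M eps1 eps2 : R) U W : 0 <= L -> 0 <= eps1 -> 0 <= eps2 ->
  (forall u v, D u -> D v -> N u <= M -> N v <= M ->
    N (F u - F v) <= L * N (u - v)) ->
  approx_solution T eps1 U -> approx_solution T eps2 W ->
  (forall t : R, 0 <= t <= T -> N (U t) <= M) ->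
  (forall t : R, 0 <= t <= T -> N (W t) <= M) ->
  forall t : R, 0 <= t <= T ->
    N (U t - W t) <= (N (U 0 - W 0) + (eps1 + eps2)) * expR ((L + 1) * t).
Proof.
move=> L0 e1 e2 FL [DU cU gU] [DW cW gW] UM WM t tT.
have T0 : (0 : R) <= 0 <= T by lra.
apply: (@gronwall R (fun t => N (U t - W t)) T L (eps1 + eps2)) tT => //.
- exact: addr_ge0.
- by apply/Nge0/DB; [exact: DU|exact: DW].
- move=> s sT e e0; have e20 : 0 < e / 2 by rewrite divr_gt0.
  have [d1 d10 H1] := cU _ sT _ e20; have [d2 d20 H2] := cW _ sT _ e20.
  exists (Num.min d1 d2); first by rewrite lt_min d10.
  move=> r rT; rewrite lt_min => /andP[r1 r2].
  apply: le_trans (csn_dist_norm _ _) _; try by apply: DB; auto.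
  have -> : U r - W r - (U s - W s) = (U r - U s) - (W r - W s).
    by rewrite !opprB [W s - U s]addrC addrACA [- W r + _]addrC.
  apply: (le_trans (csn_lerB _ _)); try by apply: DB; auto.
  by have := H1 _ rT r1; have := H2 _ rT r2; lra.
- move=> s sT e e0; have e20 : 0 < e / 2 by rewrite divr_gt0.
  have [d1 d10 H1] := gU _ sT _ e20; have [d2 d20 H2] := gW _ sT _ e20.
  exists (Num.min d1 d2); first by rewrite lt_min d10.
  move=> r rT; rewrite -ltrBlDl lt_min => /andP[r1 r2].
  have [rT' sT'] : 0 <= r <= T /\ 0 <= s <= T by lra.
  have H1' := H1 _ rT ltac:(lra); have H2' := H2 _ rT ltac:(lra).
  have Us := DU _ sT'; have Ws := DW _ sT'; have Ur := DU _ rT'; have Wr := DW _ rT'.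
  have DFU := FD Us; have DFW := FD Ws.
  pose A := U r - U s - (r - s) *: F (U s).
  pose B := W r - W s - (r - s) *: F (W s).
  have -> : U r - W r = (A - B) + (U s - W s + (r - s) *: (F (U s) - F (W s))).
    have AE : U r = A + (U s + (r - s) *: F (U s)) by rewrite /A -[U r - _ - _]addrA -opprD subrK.
    have BE : W r = B + (W s + (r - s) *: F (W s)) by rewrite /B -[W r - _ - _]addrA -opprD subrK.
    by rewrite {1}AE {1}BE scalerBr opprD addrACA; congr (_ + _); rewrite opprD addrACA.
  have DA : D A by do 2?[apply: DB => //]; exact: DZ.
  have DB' : D B by do 2?[apply: DB => //]; exact: DZ.
  apply: le_trans (ND _ _) _; [exact: DB|by apply: DD; [exact: DB|apply: DZ; exact: DB]|].
  have := csn_lerB DA DB'; rewrite -/A in H1'; rewrite -/B in H2'.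
  have h3 : N (U s - W s + (r - s) *: (F (U s) - F (W s))) <=
            N (U s - W s) + (r - s) * (L * N (U s - W s)).
    apply: le_trans (ND _ _) _; [exact: DB|by apply: DZ; exact: DB|].
    rewrite lerD2l NZ; last exact: DB.
    have rs : 0 <= r - s by lra.
    by rewrite ger0_norm// ler_wpM2l//; apply: FL; auto.
  rewrite !mulrDr in H1' H2' *; lra.
Qed.


(** Differentiability with derivative [F (U t)], written without dividing by [s - t] so that [s = t]
    is no exception. It becomes one-sided at 0 and [T] because [s] ranges over [0, T]. *)
Definition solution (T : R) (U : R -> V) :=
  (forall t : R, 0 <= t <= T -> D (U t)) /\
  forall t : R, 0 <= t <= T -> forall e : R, 0 < e -> exists2 d : R, 0 < d &
    forall s : R, 0 <= s <= T -> `|s - t| < d ->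
      N (U s - U t - (s - t) *: F (U t)) <= e * `|s - t|.

Lemma solution_approx T U : solution T U -> approx_solution T 0 U.
Proof.
move=> [DU gU]; split=> // t tT e e0.
- have [d d0 H] := gU _ tT 1 ltr01.
  have DFU : D (F (U t)) by apply: FD; exact: DU.
  have NF := Nge0 DFU.
  exists (Num.min d (e / (1 + N (F (U t))))).
    by rewrite lt_min d0 divr_gt0// ltr_pwDl.
  move=> s sT; rewrite lt_min => /andP[sd].
  rewrite ltr_pdivlMr; last by rewrite ltr_pwDl.
  move=> se; apply: le_trans (ltW se).
  have Ds := DU _ sT; have Dt := DU _ tT.
  rewrite -(subrK ((s - t) *: F (U t)) (U s - U t)).
  apply: le_trans (ND _ _) _; [by apply: DB; [exact: DB|exact: DZ]|exact: DZ|].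
  rewrite NZ//; have := H _ sT sd; rewrite mul1r mulrDr mulr1; lra.
- have tT' : 0 <= t <= T by lra.
  have [d d0 H] := gU _ tT' _ e0; exists d => // s ts sd.
  have st : 0 <= s - t by lra.
  by have := H s; rewrite ger0_norm// add0r mulrC; apply; lra.
Qed.

(** Extreme value theorem for the norm along the curve, composed with the projection onto [0, T]. *)
Lemma solution_bounded T U : 0 <= T -> solution T U ->
  exists M, forall t : R, 0 <= t <= T -> N (U t) <= M.
Proof.
move=> T0 /solution_approx[DU cU _].
pose cl (t : R) := Num.max 0 (Num.min t T).
have clT t : 0 <= cl t <= T by rewrite le_max lexx/= ge_max T0 ge_min lexx orbT.
have clid t : 0 <= t <= T -> cl t = t.
  by move=> /andP[t0 tT]; rewrite /cl min_l// max_r.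
have cl1 s t : `|cl s - cl t| <= `|s - t| by exact: clamp_lip.
pose g t := N (U (cl t)).
have cg : {within `[0, T], continuous g}.
  apply: continuous_subspaceT => t; apply/cvgrPdist_le => e e0.
  have [d d0 H] := cU _ (clT t) _ e0.
  near=> s; rewrite /g distrC.
  apply: le_trans (csn_dist_norm _ _) _; [exact: DU|exact: DU|].
  apply: H => //; apply: le_lt_trans (cl1 s t) _; rewrite distrC.
  by near: s; exact: cvgr_dist_lt.
have [c _ Hc] := EVT_max T0 cg.
exists (g c) => t tT; have := Hc t; rewrite in_itv/= tT => /(_ isT).
by rewrite {1}/g clid.
Unshelve. all: by end_near. Qed.

(** * Euler polygons and local existence *)

Section euler.
Variables (M B L : R) (U0 : V).
Hypotheses (B0 : 0 <= B) (L0 : 0 <= L) (DU0 : D U0) (NU0 : N U0 <= M).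
Hypothesis FB : forall u, D u -> N u <= M + 1 -> N (F u) <= B.
Hypothesis FL : forall u v, D u -> D v -> N u <= M + 1 -> N v <= M + 1 ->
  N (F u - F v) <= L * N (u - v).

Fixpoint euler_node (h : R) (k : nat) : V :=
  if k is k'.+1 then euler_node h k' + h *: F (euler_node h k') else U0.

(* Length of [0, t] inside the [k]-th cell. *)
Definition cell_length (h : R) (k : nat) (t : R) : R :=
  Num.min t (k.+1%:R * h) - Num.min t (k%:R * h).

(** One sum over all cells replaces the search for the cell containing [t]: earlier cells contribute
    their full length, later ones nothing. Increments of the polygon then become sums of increments
    of cell lengths, which are nonnegative and add up to the elapsed time. *)
Definition euler_polygon (h : R) (n : nat) (t : R) : V :=
  U0 + \sum_(0 <= k < n) cell_length h k t *: F (euler_node h k).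

Lemma euler_nodeD h k : D (euler_node h k).
Proof. by elim: k => //= k IH; apply: DD => //; apply: DZ; exact: FD. Qed.

Lemma cell_length_mono (h : R) k (s t : R) : 0 <= h -> s <= t ->
  cell_length h k s <= cell_length h k t.
Proof.
move=> h0 st; rewrite /cell_length -natr1 mulrDl mul1r.
exact: min_increment_mono.
Qed.

Lemma sum_cell_length (h : R) n (t : R) : 0 <= t <= n%:R * h ->
  \sum_(0 <= k < n) cell_length h k t = t.
Proof.
move=> /andP[t0 tn].
rewrite (telescope_sumr (fun k => Num.min t (k%:R * h)))// mul0r.
by rewrite (min_l tn) min_r// subr0.
Qed.

Lemma euler_polygonD (h : R) n (t : R) : D (euler_polygon h n t).
Proof.
apply: DD => //; apply: csn_sum => i _; apply: DZ; apply: FD; exact: euler_nodeD.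
Qed.

(** A step moves by at most [h * B] as long as the node lies in the ball of radius [M + 1], where
    [FB] applies; a total travel of at most 1 never leaves that ball. This is the constraint that
    fixes the existence time. *)
Lemma euler_node_le (h : R) n k : 0 <= h -> n%:R * h * B <= 1 -> (k <= n)%N ->
  N (euler_node h k) <= M + 1.
Proof.
move=> h0 hB kn.
suff : N (euler_node h k) <= M + k%:R * h * B.
  move=> /le_trans; apply; rewrite lerD2l; apply: le_trans hB.
  by rewrite -!mulrA ler_wpM2r ?mulr_ge0// ler_nat.
elim: k kn => [|k IH] kn /=; first by rewrite !mul0r addr0.
have Dk := euler_nodeD h k.
apply: le_trans (ND _ _) _ => //; first by apply: DZ; exact: FD.
have {}IH := IH (ltnW kn).
rewrite NZ; last exact: FD.
rewrite ger0_norm//.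
have Fk : N (F (euler_node h k)) <= B.
  apply: FB => //; apply: le_trans IH _; rewrite lerD2l; apply: le_trans hB.
  by rewrite -!mulrA ler_wpM2r ?mulr_ge0// ler_nat ltnW.
have hk : h * N (F (euler_node h k)) <= h * B by rewrite ler_wpM2l.
rewrite -natr1 !mulrDl mul1r; lra.
Qed.

Lemma euler_polygonB (h : R) n (s t : R) : euler_polygon h n t - euler_polygon h n s =
  \sum_(0 <= k < n) (cell_length h k t - cell_length h k s) *: F (euler_node h k).
Proof.
rewrite /euler_polygon opprD addrACA subrr add0r -sumrB.
by apply: eq_bigr => k _; exact/esym/scalerBl.
Qed.

Lemma euler_polygon0 h n : 0 <= h -> euler_polygon h n 0 = U0.
Proof.
move=> h0; rewrite /euler_polygon big1_seq ?addr0// => k _.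
by rewrite /cell_length !min_l ?mulr_ge0// subrr scale0r.
Qed.

Lemma euler_node_sum h k :
  euler_node h k = U0 + \sum_(0 <= i < k) h *: F (euler_node h i).
Proof.
elim: k => [|k IH] /=; first by rewrite big_nil addr0.
by rewrite big_nat_recr//= addrA -IH.
Qed.

Lemma euler_polygon_node (h : R) n k : 0 <= h -> (k <= n)%N ->
  euler_polygon h n (k%:R * h) = euler_node h k.
Proof.
move=> h0 kn; rewrite euler_node_sum /euler_polygon; congr (_ + _).
rewrite (big_cat_nat _ kn)//= [X in _ + X]big_nat [X in _ + X]big1 ?addr0.
  rewrite big_nat [RHS]big_nat; apply: eq_bigr => i ik; congr (_ *: _).
  rewrite /cell_length !min_r ?ler_wpM2r ?ler_nat// 1?ltnW//.
  by rewrite -natr1 mulrDl; ring.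
move=> i /andP[ki _]; rewrite /cell_length !min_l ?ler_wpM2r ?ler_nat// 1?leqW//.
by rewrite subrr scale0r.
Qed.

Lemma euler_polygon_lipschitz (h : R) n (s t : R) : 0 <= h -> n%:R * h * B <= 1 ->
  0 <= s -> s <= t -> t <= n%:R * h ->
  N (euler_polygon h n t - euler_polygon h n s) <= (t - s) * B.
Proof.
move=> h0 hB s0 st tn; rewrite euler_polygonB.
apply: (@le_trans _ _ (\sum_(0 <= k < n) (cell_length h k t - cell_length h k s) * B)).
  apply: csn_ler_sum => k kn; first by apply: DZ; apply: FD; exact: euler_nodeD.
  have Dk := euler_nodeD h k.
  rewrite NZ; last exact: FD.
  rewrite ger0_norm ?subr_ge0 ?cell_length_mono// ler_wpM2l//.
    by rewrite subr_ge0 cell_length_mono.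
  by apply: FB => //; apply: euler_node_le hB _ => //; exact: ltnW.
rewrite -mulr_suml sumrB !sum_cell_length//; lra.
Qed.

(** On each cell meeting the interval from [s] to [t], the slope is [F] at a node whose time differs
    from [s] by at most [h] or [t - s]. The polygon is [B]-Lipschitz and [F] is [L]-Lipschitz, so
    the slope differs from [F] at time [s] by at most [L * B * (h + (t - s))]. *)
Lemma euler_polygon_defect (h : R) n (s t : R) : 0 <= h -> n%:R * h * B <= 1 ->
  0 <= s -> s <= t -> t <= n%:R * h ->
  N (euler_polygon h n t - euler_polygon h n s - (t - s) *: F (euler_polygon h n s))
    <= (t - s) * (L * B * (h + (t - s))).
Proof.
move=> h0 hB s0 st tn.
have lip := euler_polygon_lipschitz h0 hB.
have N1 (r : R) : 0 <= r -> r <= n%:R * h -> N (euler_polygon h n r) <= M + 1.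
  move=> r0 rn; have := lip 0 r (lexx _) r0 rn; rewrite euler_polygon0// subr0.
  have := csn_leBD (euler_polygonD h n r) DU0.
  have : r * B <= 1 by apply: le_trans hB; rewrite ler_wpM2r.
  by move: NU0; lra.
have DP := euler_polygonD h n.
rewrite euler_polygonB.
have -> : (t - s) *: F (euler_polygon h n s) =
    \sum_(0 <= k < n) (cell_length h k t - cell_length h k s) *: F (euler_polygon h n s).
  by rewrite -scaler_suml sumrB !sum_cell_length//; lra.
rewrite -sumrB.
have -> : (t - s) * (L * B * (h + (t - s))) = \sum_(0 <= k < n)
    (cell_length h k t - cell_length h k s) * (L * B * (h + (t - s))).
  by rewrite -mulr_suml sumrB !sum_cell_length//; lra.
have c0 k : 0 <= cell_length h k t - cell_length h k s.
  by rewrite subr_ge0 cell_length_mono.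
apply: csn_ler_sum => k kn.
  by apply: DB; apply: DZ; apply: FD; [exact: euler_nodeD|exact: DP].
have Dk := euler_nodeD h k; have DFk := FD Dk; have DFs := FD (DP s).
rewrite -scalerBr NZ; last exact: DB.
rewrite ger0_norm//.
have kS : k.+1%:R * h = k%:R * h + h by rewrite -natr1 mulrDl mul1r.
have kh0 : 0 <= k%:R * h by rewrite mulr_ge0.
have knh : k%:R * h <= n%:R * h by rewrite ler_wpM2r// ler_nat ltnW.
(* A cell lying after [t] or before [s] has weight 0; the cells that remain satisfy [k h < t] and
   [s < (k + 1) h]. *)
have [tk|kt] := leP t (k%:R * h).
  have tk' : t <= k.+1%:R * h by rewrite kS; lra.
  by rewrite /cell_length !min_l//; [rewrite !subrr !mul0r|lra|lra].
have [sk|ks] := leP (k.+1%:R * h) s.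
  have sk' : k%:R * h <= s by rewrite kS in sk; lra.
  by rewrite /cell_length !min_r//; [rewrite subrr !mul0r|lra|lra].
rewrite kS in ks.
apply: ler_wpM2l => //; apply: (le_trans (FL _ _ _ _)) => //.
- by apply: euler_node_le hB _ => //; exact: ltnW.
- by apply: N1; lra.
rewrite -mulrA ler_wpM2l// -(@euler_polygon_node h n k)//; last exact: ltnW.
rewrite [B * _]mulrC; have [ks'|ks'] := leP s (k%:R * h).
  apply: (le_trans (lip _ _ _ _ _)) => //; rewrite ler_wpM2r//; lra.
rewrite csn_distC; [|exact: DP|exact: DP].
apply: (le_trans (lip _ _ _ _ _)) => //; [lra|lra|rewrite ler_wpM2r//; lra].
Qed.

(** The last two estimates are explicit and do not mention the step size, so they pass to the limit.
    The defect clause of [approx_solution] alone would not, since its [d] depends on the polygon. *)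
Lemma ex_euler (T e : R) : 0 < T -> T * B <= 1 -> 0 < e -> exists U : R -> V,
  [/\ U 0 = U0, approx_solution T e U,
   forall t : R, 0 <= t <= T -> N (U t) <= M + 1,
   forall s t : R, 0 <= s -> s <= t -> t <= T -> N (U t - U s) <= (t - s) * B &
   forall s t : R, 0 <= s -> s <= t -> t <= T ->
     N (U t - U s - (t - s) *: F (U s)) <= (t - s) * (e + L * B * (t - s))].
Proof.
move=> T0 TB e0.
(* This many cells make [L * B * h <= e], the part of the defect that does not vanish with
   [t - s]. *)
pose n := (Num.truncn (L * B * T / e)).+1.
pose h := T / n%:R.
have nh : n%:R * h = T by rewrite mulrC divfK// pnatr_eq0.
have h0 : 0 <= h by rewrite divr_ge0// ltW.
have LBh : L * B * h <= e.
  rewrite /h mulrA ler_pdivrMr// -ler_pdivrMl// mulrC.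
  by apply/ltW; rewrite truncnS_gt.
have LB0 : 0 <= L * B by rewrite mulr_ge0.
have hB : n%:R * h * B <= 1 by rewrite nh.
have DP := euler_polygonD h n.
have lip (s t : R) : 0 <= s -> s <= t -> t <= T ->
    N (euler_polygon h n t - euler_polygon h n s) <= (t - s) * B.
  by rewrite -nh; exact: euler_polygon_lipschitz.
have def (s t : R) : 0 <= s -> s <= t -> t <= T ->
     N (euler_polygon h n t - euler_polygon h n s
        - (t - s) *: F (euler_polygon h n s)) <= (t - s) * (e + L * B * (t - s)).
  move=> s0 st tT; have := @euler_polygon_defect h n s t h0 hB s0 st.
  rewrite nh => /(_ tT) /le_trans; apply.
  by rewrite ler_wpM2l ?subr_ge0// mulrDr lerD2r.
exists (euler_polygon h n); split => //.
- exact: euler_polygon0.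
- split=> [t _|t tT r r0|t tT r r0]; first exact: DP.
    exists (r / (B + 1)); first by rewrite divr_gt0// ltr_wpDl.
    move=> s sT; rewrite ltr_pdivlMr ?ltr_wpDl// mulrDr mulr1 => sr.
    have rs := normr_ge0 (s - t).
    have [st|ts] := leP t s.
      have := lip t s; rewrite ger0_norm ?subr_ge0// in sr rs *.
      by move=> H; apply: (le_trans (H _ _ _)); lra.
    rewrite csn_distC; [|exact: DP|exact: DP].
    have := lip s t; rewrite distrC ger0_norm ?subr_ge0 1?ltW// in sr rs *.
    by move=> H; apply: (le_trans (H _ _ _)); lra.
  exists (r / (L * B + 1)); first by rewrite divr_gt0// ltr_wpDl.
  move=> s sT; rewrite -ltrBlDl ltr_pdivlMr ?ltr_wpDl// mulrDr mulr1 => sr.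
  apply: (le_trans (def _ _ _ _ _)); [lra..|].
  by rewrite ler_wpM2l ?subr_ge0//; lra.
- move=> t /andP[t0 tT]; have := lip 0 t (lexx _) t0 tT.
  rewrite euler_polygon0// subr0.
  have := csn_leBD (DP t) DU0.
  have : t * B <= T * B by rewrite ler_wpM2r.
  by move: NU0; lra.
Qed.

End euler.

(** The solution is the pointwise limit of polygons with defect [m.+1%:R^-1]. [T] is chosen before
    the initial value and depends on [M] only. A limit in a seminorm is determined up to null
    elements, hence the form of the initial condition. *)
Lemma local_existence : locally_lipschitz -> forall M : R, exists2 T : R, 0 < T &
  forall U0, D U0 -> N U0 <= M -> exists U, [/\ solution T U, N (U 0 - U0) = 0 &
    forall t : R, 0 <= t <= T -> N (U t) <= M + 1].
Proof.
move=> lipF M; have [L L0 FL] := lipF (M + 1).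
have DF0 := FD D0; have NF0 := Nge0 DF0.
(* Bound of [F] on the ball of radius [M + 1] by comparison with [F 0]; the absolute value keeps [B]
   nonnegative when that ball is empty. *)
pose B := N (F 0) + L * `|M + 1|.
have B0 : 0 <= B by rewrite addr_ge0// mulr_ge0.
have FB u : D u -> N u <= M + 1 -> N (F u) <= B.
  move=> Du Nu; have Nu0 := Nge0 Du; have M0 : 0 <= M + 1 by exact: le_trans Nu.
  apply: le_trans (csn_leBD (FD Du) DF0) _; rewrite addrC lerD2l.
  apply: le_trans (FL _ _ Du D0 Nu _) _; first by rewrite csn_norm0.
  by rewrite subr0 ler_wpM2l// ger0_norm.
(* Chosen for [T * B <= 1]; the [+ 1] covers [B = 0]. *)
pose T := (B + 1)^-1.
have T0 : 0 < T by rewrite invr_gt0 ltr_wpDl.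
have TB : T * B <= 1 by rewrite mulrC ler_pdivrMr ?ltr_wpDl// mul1r lerDl.
exists T => // U0 DU0 NU0.
have eps0 m : 0 < m.+1%:R^-1 :> R by [].
have /choice[Um HUm] := fun m => ex_euler B0 L0 DU0 NU0 FB FL T0 TB (eps0 m).
have DUm m (t : R) : 0 <= t <= T -> D (Um m t) by have [_ [+ _ _] _ _ _] := HUm m; apply.
have NUm m (t : R) : 0 <= t <= T -> N (Um m t) <= M + 1.
  by have [_ _ + _ _] := HUm m; apply.
have eps_le (e : R) : 0 < e -> exists n0, forall m, (n0 <= m)%N -> m.+1%:R^-1 <= e.
  move=> e0; exists (Num.truncn e^-1) => m nm.
  rewrite -[e]invrK lef_pV2 ?posrE ?invr_gt0//.
  by apply: le_trans (ltW (truncnS_gt _)) _; rewrite ler_nat.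
(* The value 0 outside [0, T] makes the pointwise choice total. *)
have lim (t : R) : exists l, 0 <= t <= T -> D l /\ forall e : R, 0 < e ->
    exists n0, forall n, (n0 <= n)%N -> N (Um n t - l) <= e.
  have [tT|tT] := boolP (0 <= t <= T); last by exists 0.
  suff /(csn_complete cs (fun n => DUm n t tT))[l Dl Hl] : forall e : R, 0 < e ->
      exists n0, forall m n, (n0 <= m)%N -> (n0 <= n)%N -> N (Um m t - Um n t) <= e.
    by exists l.
  move=> e e0; pose c := expR ((L + 1) * t); have c0 : 0 < c by exact: expR_gt0.
  have [n0 Hn0] := eps_le (e / (2 * c)) ltac:(by rewrite divr_gt0// mulr_gt0).
  exists n0 => m n nm nn.
  have [Um0 am _ _ _] := HUm m; have [Un0 an _ _ _] := HUm n.
  have := approx_solution_dist L0 (ltW (eps0 m)) (ltW (eps0 n)) FL am an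
    (NUm m) (NUm n) tT.
  rewrite Um0 Un0 subrr csn_norm0 add0r => /le_trans; apply.
  rewrite -/c -ler_pdivlMr//; have := Hn0 _ nm; have := Hn0 _ nn.
  have -> : e / (2 * c) = e / c / 2 by field; rewrite gt_eqF.
  by move=> h1 h2; rewrite [leRHS]splitr lerD.
have /choice[U HU] := lim.
have DU (t : R) : 0 <= t <= T -> D (U t) by move=> /HU[].
have cvg2 (s t : R) (e : R) : 0 <= s <= T -> 0 <= t <= T -> 0 < e ->
    exists m, [/\ m.+1%:R^-1 <= e, N (Um m s - U s) <= e & N (Um m t - U t) <= e].
  move=> sT tT e0; have [n1 H1] := eps_le _ e0.
  have [_ /(_ _ e0)[n2 H2]] := HU s sT; have [_ /(_ _ e0)[n3 H3]] := HU t tT.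
  exists (n1 + n2 + n3)%N; split; [apply: H1|apply: H2|apply: H3];
  by rewrite ?leq_addl// -addnA ?leq_addr// addnCA leq_addr.
have NU (t : R) : 0 <= t <= T -> N (U t) <= M + 1.
  move=> tT; apply/ler_addgt0Pr => e e0; have [m [_ _ H]] := cvg2 t t e tT tT e0.
  have := csn_leBD (DU t tT) (DUm m t tT).
  rewrite csn_distC; [|exact: DU|exact: DUm].
  by have := NUm m t tT; lra.
have lipU (s t : R) : 0 <= s -> s <= t -> t <= T -> N (U t - U s) <= (t - s) * B.
  move=> s0 st tT; apply/ler_addgt0Pr => e e0; have e20 : 0 < e / 2 by lra.
  have [sT' tT'] : 0 <= s <= T /\ 0 <= t <= T by lra.
  have [m [_ Hs Ht]] := cvg2 s t _ sT' tT' e20.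
  have [_ _ _ /(_ s t s0 st tT) Hm _] := HUm m.
  have [Dus Dut Dms Dmt] : [/\ D (U s), D (U t), D (Um m s) & D (Um m t)].
    by split; auto.
  have := csn_triangle Dut Dmt Dus; have := csn_triangle Dmt Dms Dus.
  rewrite (csn_distC Dut Dmt); lra.
have defU (s t : R) : 0 <= s -> s <= t -> t <= T ->
    N (U t - U s - (t - s) *: F (U s)) <= (t - s) * (L * B * (t - s)).
  move=> s0 st tT; have ts0 : 0 <= t - s by lra.
  (* Coefficients of the errors made in passing to the limit: the residual defect, the distances of
     the polygon to [U] at the two times, and the Lipschitz change of [F]. *)
  pose c := (t - s) + 2 + (t - s) * L.
  have c0 : 0 < c by rewrite /c addrAC ltr_wpDl// addr_ge0// mulr_ge0.
  apply/ler_addgt0Pr => e e0; have [q q0 cq] : exists2 q, 0 < q & c * q = e.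
    by exists (e / c); [rewrite divr_gt0|rewrite mulrC divfK// gt_eqF].
  have [sT' tT'] : 0 <= s <= T /\ 0 <= t <= T by lra.
  have [m [Hm Hs Ht]] := cvg2 s t _ sT' tT' q0.
  have [_ _ _ _ /(_ s t s0 st tT) H] := HUm m.
  have [Dus Dut Dms Dmt] : [/\ D (U s), D (U t), D (Um m s) & D (Um m t)].
    by split; auto.
  set a := N _ in H; set b := N _.
  suff Hab : b <= a + (N (Um m t - U t) + N (Um m s - U s)
                      + (t - s) * (L * N (Um m s - U s))).
    apply: (le_trans Hab).
    have H1 : (t - s) * (L * N (Um m s - U s)) <= (t - s) * L * q.
      by rewrite -mulrA; do 2!apply: ler_wpM2l => //.
    have H2 : (t - s) * m.+1%:R^-1 <= (t - s) * q by rewrite ler_wpM2l.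
    rewrite /c in cq.
    rewrite mulrDr in H; move: (m.+1%:R^-1) H H2 => r; lra.
  rewrite /a /b.
  have DFs := FD Dus; have DFm := FD Dms.
  rewrite (sub2_split _ _ _ (Um m t) (Um m s) ((t - s) *: F (Um m s))) -scalerBr.
  apply: le_trans (ND _ _) _.
  - by apply: DB; [exact: DB|exact: DZ].
  - by apply: DB; [apply: DB; exact: DB|apply: DZ; exact: DB].
  rewrite lerD2l; apply: le_trans (csn_lerB _ _) _.
  - by apply: DB; exact: DB.
  - by apply: DZ; exact: DB.
  apply: lerD.
    rewrite (csn_distC Dmt Dut) (csn_distC Dms Dus).
    by apply: csn_lerB; exact: DB.
  rewrite NZ; last exact: DB.
  rewrite ger0_norm// ler_wpM2l// (csn_distC Dms Dus).
  by apply: FL => //; [exact: NU|exact: NUm].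
have LB0 : 0 <= L * B by rewrite mulr_ge0.
exists U; split=> //.
- split=> // t tT e e0.
  (* One [L * B] comes from the forward defect, a second one from moving the base point when
     [s < t]; the [+ 1] keeps the denominator positive. *)
  exists (e / (2 * (L * B) + 1)); first by rewrite divr_gt0// ltr_wpDl// mulr_ge0.
  move=> s sT; rewrite ltr_pdivlMr ?ltr_wpDl ?mulr_ge0// => std.
  have [ts|st] := leP t s.
    have st0 : 0 <= s - t by lra.
    rewrite ger0_norm// in std *.
    have := defU t s; rewrite [e * _]mulrC => /(_ _ _ _) H.
    apply: (le_trans (H _ _ _)); [lra..|].
    rewrite ler_wpM2l//.
    have : 0 <= L * B * (s - t) by rewrite mulr_ge0.
    lra.
  have st0 : 0 <= t - s by lra.
  rewrite distrC ger0_norm// in std *.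
  have [Ds Dt] : D (U s) /\ D (U t) by split; exact: DU.
  have [DFs DFt] := (FD Ds, FD Dt).
  (* For [s < t] the expansion at the right end is recovered from the forward one at [s], by
     exchanging [F (U s)] for [F (U t)]. *)
  have -> : U s - U t - (s - t) *: F (U t) = - (U t - U s - (t - s) *: F (U s))
     + (t - s) *: (F (U t) - F (U s)).
    rewrite scalerBr opprB opprB -[s - t]opprB scaleNr opprK.
    by rewrite [X in _ = X + _]addrC -[RHS]addrA subrKC.
  have D1 : D (U t - U s - (t - s) *: F (U s)).
    by apply: DB; [exact: DB|exact: DZ].
  have D2 : D ((t - s) *: (F (U t) - F (U s))) by apply: DZ; exact: DB.
  apply: le_trans (ND _ _) _ => //; first exact: DN.
  rewrite csn_normN// NZ; last exact: DB.
  rewrite ger0_norm//.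
  have H1 := defU s t ltac:(lra) ltac:(lra) ltac:(lra).
  have H2 := lipU s t ltac:(lra) ltac:(lra) ltac:(lra).
  have H3 : N (F (U t) - F (U s)) <= L * N (U t - U s) by apply: FL; auto.
  have H4 : L * N (U t - U s) <= L * ((t - s) * B) by rewrite ler_wpM2l.
  have H5 : (t - s) * N (F (U t) - F (U s)) <= (t - s) * (L * ((t - s) * B)).
    by rewrite ler_wpM2l//; exact: le_trans H4.
  have H6 : (t - s) * ((t - s) * (2 * (L * B) + 1)) <= (t - s) * e.
    by rewrite ler_wpM2l// ltW.
  have H7 : 0 <= (t - s) * (t - s) by rewrite mulr_ge0.
  have : (t - s) * (L * B * (t - s)) + (t - s) * (L * ((t - s) * B)) =
    (t - s) * ((t - s) * (2 * (L * B) + 1)) - (t - s) * (t - s) by ring.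
  rewrite [e * _]mulrC; lra.
- have T00 : (0 : R) <= 0 <= T by rewrite lexx ltW.
  apply/eqP; rewrite eq_le Nge0; last by apply: DB => //; exact: DU.
  rewrite andbT; apply/ler_addgt0Pr => e e0; rewrite add0r.
  have [m [_ H _]] := cvg2 0 0 e T00 T00 e0.
  rewrite csn_distC//; last exact: DU.
  by have [<- _ _ _ _] := HUm m.
Qed.

(** [C] is fixed before [W] and depends only on [U] and the bound [M]; continuous dependence rests
    on this uniformity. *)
Lemma solution_dist (T : R) U : locally_lipschitz -> 0 <= T -> solution T U ->
  forall M : R, exists2 C : R, 0 <= C & forall W, solution T W ->
    (forall t : R, 0 <= t <= T -> N (W t) <= M) ->
    forall t : R, 0 <= t <= T -> N (U t - W t) <= C * N (U 0 - W 0).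
Proof.
move=> lipF T0 sU M; have [M' UM'] := solution_bounded T0 sU.
have [L L0 FL] := lipF (Num.max M M').
exists (expR ((L + 1) * T)); first exact: expR_ge0.
move=> W sW WM t tT.
have aU := solution_approx sU; have aW := solution_approx sW.
have UM'' (s : R) : 0 <= s <= T -> N (U s) <= Num.max M M'.
  by move=> /UM' H; rewrite le_max H orbT.
have WM'' (s : R) : 0 <= s <= T -> N (W s) <= Num.max M M'.
  by move=> /WM H; rewrite le_max H.
have T00 : (0 : R) <= 0 <= T by rewrite lexx.
apply: le_trans (approx_solution_dist L0 (lexx 0) (lexx 0) FL aU aW UM'' WM'' tT) _.
rewrite !addr0 mulrC ler_wpM2r//.
  by apply/Nge0/DB; [case: sU => + _|case: sW => + _]; apply.
by rewrite ler_expR ler_wpM2l ?addr_ge0//; case/andP: tT.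
Qed.

End flow.
End seminormed.

(** * A weighted Jensen inequality and real powers *)

(** Hoelder for the factorisation of [a g] into [a^(1/q)] and [a^(1/r) g], with [q = r / (r - 1)]
    conjugate to [r]; the case [r = 1] is separate because it has no finite conjugate. *)
Lemma jensen_powR d (T : measurableType d) (R : realType)
    (m : {measure set T -> \bar R}) (a g : T -> R) (A r : R) :
  measurable_fun setT a -> measurable_fun setT g ->
  (forall x, 0 <= a x) -> (forall x, 0 <= g x) -> 1 <= r ->
  (\int[m]_x (a x)%:E <= A%:E)%E ->
  ((\int[m]_x (a x * g x)%:E) `^ r <=
    (A `^ (r - 1))%:E * \int[m]_x (a x * g x `^ r)%:E)%E.
Proof.
move=> ma mg a0 g0; rewrite le_eqVlt => /predU1P[<-|r1] aA.
  rewrite subrr powRr0 mul1e poweRe1; last first.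
    by apply: integral_ge0 => x _; rewrite lee_fin mulr_ge0.
  by under [leRHS]eq_integral do rewrite powRr1//.
have r0 : 0 < r by exact: lt_trans r1.
have A0 : 0 <= A.
  by rewrite -lee_fin; apply: le_trans aA; apply: integral_ge0 => x _; rewrite lee_fin.
have r10 : 0 < r - 1 by rewrite subr_gt0.
pose q := r / (r - 1).
have q0 : 0 < q by rewrite divr_gt0.
have qr : q^-1 + r^-1 = 1 by rewrite /q invf_div mulrBl divff ?gt_eqF// mul1r subrK.
pose u x := a x `^ q^-1; pose v x := a x `^ r^-1 * g x.
have mu_ : measurable_fun setT u by exact: measurableT_comp (measurable_powR _) ma.
have mv : measurable_fun setT v.
  by apply: measurable_funM => //; exact: measurableT_comp (measurable_powR _) ma.
have := hoelder m mu_ mv q0 r0 qr.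
rewrite Lnorm1 [X in (X <= _)%E -> _](_ : _ = \int[m]_x (a x * g x)%:E)%E; last first.
  apply: eq_integral => x _ /=.
  rewrite /u /v mulrA -powRD; last by rewrite qr oner_eq0.
  by rewrite qr powRr1// ger0_norm// mulr_ge0.
rewrite unlock /=.
rewrite [X in (X `^ q^-1)%E](_ : _ = \int[m]_x (a x)%:E)%E; last first.
  apply: eq_integral => x _ /=.
  by rewrite ger0_norm ?powR_ge0// -powRrM mulVf ?gt_eqF// powRr1.
rewrite [X in (X `^ r^-1)%E](_ : _ = \int[m]_x (a x * g x `^ r)%:E)%E; last first.
  apply: eq_integral => x _ /=.
  rewrite ger0_norm ?mulr_ge0 ?powR_ge0// powRM ?powR_ge0//.
  by rewrite -powRrM mulVf ?gt_eqF// powRr1.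
set I := (\int[m]_x (a x)%:E)%E; set J := (\int[m]_x (a x * g x `^ r)%:E)%E.
set K := (\int[m]_x (a x * g x)%:E)%E => KIJ.
have I0 : (0 <= I)%E by apply: integral_ge0 => x _; rewrite lee_fin.
have J0 : (0 <= J)%E.
  by apply: integral_ge0 => x _; rewrite lee_fin mulr_ge0// powR_ge0.
have K0 : (0 <= K)%E by apply: integral_ge0 => x _; rewrite lee_fin mulr_ge0.
have nny (x : \bar R) : (0 <= x)%E -> x \in `[0%E, +oo%E].
  by move=> x0; rewrite in_itv/= x0 leey.
apply: (@le_trans _ _ ((I `^ q^-1 * J `^ r^-1) `^ r)%E).
  by apply: gt0_ler_poweR => //; [exact: ltW|exact: nny|apply/nny/mule_ge0; exact: poweR_ge0].
rewrite poweRM ?poweR_ge0// -!poweRrM mulVf ?gt_eqF// poweRe1//.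
apply: lee_wpmul2r => //.
have -> : q^-1 * r = r - 1 by rewrite /q invf_div divfK// gt_eqF.
by rewrite -poweR_EFin; apply: gt0_ler_poweR; rewrite ?nny// ltW.
Qed.

(** For [l > 0] the power is [expR (r * ln _)], a composition of continuous maps; at [l = 0] the
    logarithm is useless and monotonicity of the power is used. *)
Lemma cvg_powR (R : realType) (u : nat -> R) (l r : R) : 0 < r -> 0 <= l ->
  u @ \oo --> l -> (forall n, 0 <= u n) -> (u n `^ r) @[n --> \oo] --> l `^ r.
Proof.
move=> r0; rewrite le_eqVlt => /predU1P[<-|l0] ul u0.
  rewrite powR0 ?gt_eqF//; apply/cvgrPdist_lt => e e0.
  have er0 : 0 < e `^ r^-1 by exact: powR_gt0.
  near=> n; rewrite sub0r normrN ger0_norm ?powR_ge0//.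
  have : u n < e `^ r^-1.
    by near: n; exact: (cvgr_lt 0).
  move=> /(gt0_ltr_powR r0) => /(_ (u0 n) (powR_ge0 _ _)).
  by rewrite -powRrM mulVf ?gt_eqF// powRr1// ltW.
have : expR (r * ln (u n)) @[n --> \oo] --> expR (r * ln l).
  apply: (@cvg_comp _ _ _ (fun n => r * ln (u n)) expR); last exact: continuous_expR.
  apply: cvgMr; apply: cvg_comp ul _; exact: continuous_ln.
rewrite {2}/powR gt_eqF//; apply: cvg_trans; apply: near_eq_cvg.
near=> n; rewrite /powR gt_eqF//; near: n.
exact: (cvgr_gt l).
Unshelve. all: by end_near. Qed.

(* The library's hint does not see through [lebesgue_measure]. *)
#[global] Instance ae_lebesgue_filter (R : realType) :
  Filter (nbhs (almost_everywhere (@lebesgue_measure R))).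
Proof.
exact: (@ae_filter_ringOfSetsType _ (measurableTypeR R) R lebesgue_measure).
Qed.

(** * Norms of L^p, finite and infinite exponents together *)

Section Lp.
Context {R : realType}.
Local Notation mu := (@lebesgue_measure R).
Implicit Types (f g : R -> R) (p : \bar R).

Lemma lebesgue_measure_setT_gt0 : (0 < mu setT)%E.
Proof.
apply: (@lt_le_trans _ _ (mu `[0, 1])).
  by rewrite lebesgue_measure_itv/= lte_fin ltr01 sube0 lte_fin ltr01.
by apply: le_measure; rewrite ?inE//.
Qed.

Lemma Lp_norm_ge0 p f : (0 <= Lp_norm p f)%E. Proof. exact: Lnorm_ge0. Qed.

Lemma Lp_normy_le f (C : \bar R) :
  (Lp_norm +oo f <= C)%E <-> {ae mu, forall x, (`|f x|%:E <= C)%E}.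
Proof.
rewrite /Lp_norm unlock lebesgue_measure_setT_gt0.
by split=> [/ess_supP//|H]; exact/ess_supP.
Qed.

(** Trades the root for a power, so that estimates for finite exponents are estimates of plain
    integrals. *)
Lemma Lp_norm_fin_le (r C : R) f : 0 < r -> 0 <= C ->
  (Lp_norm r%:E f <= C%:E)%E <-> (\int[mu]_x (`|f x| `^ r)%:E <= (C `^ r)%:E)%E.
Proof.
move=> r0 C0; rewrite /Lp_norm unlock /=.
set I := (\int[mu]_x _)%E.
have I0 : (0 <= I)%E by apply: integral_ge0 => x _; rewrite lee_fin powR_ge0.
have nny (x : \bar R) : (0 <= x)%E -> x \in `[0%E, +oo%E].
  by move=> x0; rewrite in_itv/= x0 leey.
split=> [H|H].
  rewrite -(poweRe1 I0) -(@mulVf _ r) ?gt_eqF// poweRrM -poweR_EFin.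
  apply: gt0_ler_poweR => //; [exact: ltW|apply: nny; exact: poweR_ge0|exact: nny].
rewrite -[C](_ : (C `^ r) `^ r^-1 = _); last first.
  by rewrite -powRrM mulfV ?gt_eqF// powRr1.
rewrite -poweR_EFin; apply: gt0_ler_poweR => //.
- by rewrite invr_ge0 ltW.
- exact: nny.
- by apply: nny; rewrite lee_fin powR_ge0.
Qed.

Lemma measurable_normr_powR f (r : R) : measurable_fun setT f ->
  measurable_fun setT (fun x => (`|f x| `^ r)%:E).
Proof.
move=> mf; apply/measurable_EFinP.
by apply: (measurableT_comp (measurable_powR r)); exact: measurableT_comp.
Qed.

Lemma Lp_norm_le p f g : (1 <= p)%E -> measurable_fun setT f ->
  measurable_fun setT g -> {ae mu, forall x, `|f x| <= `|g x|} ->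
  (Lp_norm p f <= Lp_norm p g)%E.
Proof.
move=> p1 mf mg fg; case: p p1 => [r r1|_|//]; last first.
  have /Lp_normy_le gg := lexx (Lp_norm +oo%E g).
  apply/Lp_normy_le. move: fg gg; apply: filterS2 => x fgx.
  by apply: le_trans; rewrite lee_fin.
have r0 : 0 < r by rewrite lee_fin in r1; exact: lt_le_trans r1.
have := Lp_norm_ge0 r%:E g; case E : (Lp_norm r%:E g) => [C||]// C0; last first.
  by rewrite leey.
rewrite lee_fin in C0; apply/Lp_norm_fin_le => //.
have : (Lp_norm r%:E g <= C%:E)%E by rewrite E.
move=> /Lp_norm_fin_le => /(_ r0 C0); apply: le_trans.
apply: ae_ge0_le_integral => //.
- exact: measurable_normr_powR.
- exact: measurable_normr_powR.
- by apply: filterS fg => x fg _; rewrite lee_fin ge0_ler_powR// ltW.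
Qed.

Lemma eq_Lp_norm p f g : (1 <= p)%E -> measurable_fun setT f ->
  measurable_fun setT g -> ae_eq mu setT f g -> Lp_norm p f = Lp_norm p g.
Proof.
move=> p1 mf mg fg; apply/eqP; rewrite eq_le; apply/andP; split;
by apply: Lp_norm_le => //; apply: filterS fg => x ->.
Qed.

Lemma Lp_normD p f g : (1 <= p)%E -> measurable_fun setT f ->
  measurable_fun setT g ->
  (Lp_norm p (fun x => f x + g x)%R <= Lp_norm p f + Lp_norm p g)%E.
Proof. by move=> p1 mf mg; exact: eminkowski. Qed.

Lemma Lp_normN p f : Lp_norm p (fun x => - f x)%R = Lp_norm p f.
Proof. by rewrite /Lp_norm -[in RHS]oppe_Lnorm; congr Lnorm. Qed.

Lemma Lp_norm0 p : (1 <= p)%E -> Lp_norm p (fun=> 0 : R) = 0%E.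
Proof. by move=> p1; apply: Lnorm0; rewrite gt_eqF// (lt_le_trans _ p1). Qed.

Lemma Lp_norm_eq0 p f : (1 <= p)%E -> measurable_fun setT f ->
  Lp_norm p f = 0%E -> ae_eq mu setT f (cst 0).
Proof.
move=> p1 mf f0.
have mEf : measurable_fun setT (EFin \o f) by exact/measurable_EFinP.
have := @Lnorm_eq0_eq0 _ _ _ mu _ p mEf (lt_le_trans lte01 p1) f0.
by apply: filterS => x /(_ I) [].
Qed.

Lemma Lp_normZ_le p f (a : R) : (1 <= p)%E -> measurable_fun setT f ->
  (Lp_norm p (fun x => a * f x)%R <= `|a|%:E * Lp_norm p f)%E.
Proof.
move=> p1 mf.
have [->|a0] := eqVneq a 0.
  by rewrite normr0 mul0e (_ : (fun x => _) = fun=> 0) ?Lp_norm0//; apply/funext => x; rewrite mul0r.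
have a0' : 0 < `|a| by rewrite normr_gt0.
have := Lp_norm_ge0 p f; case E : (Lp_norm p f) => [C||]// C0; last first.
  by rewrite gt0_muley ?leey// lte_fin.
rewrite lee_fin in C0; rewrite -EFinM.
have fC : (Lp_norm p f <= C%:E)%E by rewrite E.
case: p p1 fC E => [r r1 fC E|_ /Lp_normy_le fC E|//]; last first.
  apply/Lp_normy_le; apply: filterS fC => x.
  by rewrite !lee_fin normrM ler_pM2l.
have r0 : 0 < r by rewrite lee_fin in r1; exact: lt_le_trans r1.
apply/Lp_norm_fin_le => //; first by rewrite mulr_ge0.
under eq_integral do rewrite normrM powRM// EFinM.
rewrite ge0_integralZl//; last exact: measurable_normr_powR.
rewrite powRM// EFinM lee_pmul2l ?lte_fin ?powR_gt0//.
exact/Lp_norm_fin_le.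
Qed.

Lemma Lp_norm_sum p n (f : nat -> R -> R) (c : nat -> R) : (1 <= p)%E ->
  (forall k, measurable_fun setT (f k)) ->
  (forall k, (Lp_norm p (f k) <= (c k)%:E)%E) ->
  (Lp_norm p (fun x => \sum_(0 <= k < n) f k x)%R <= (\sum_(0 <= k < n) c k)%R%:E)%E.
Proof.
move=> p1 mf fc; elim: n => [|n IH].
  rewrite big_nil (_ : (fun x => _) = fun=> 0) ?Lp_norm0//.
  by apply/funext => x; rewrite big_nil.
rewrite big_nat_recr//= (_ : (fun x => _) =
  (fun x => (\sum_(0 <= k < n) f k x) + f n x)); last first.
  by apply/funext => x; rewrite big_nat_recr.
apply: le_trans (Lp_normD p1 _ _) _ => //.
  exact: measurable_sum.
by rewrite EFinD leeD.
Qed.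

(** Fatou applied to [|f n|^r] when the exponent is finite; for +oo, closedness of a half-line at
    almost every point, the countably many null sets being united. *)
Lemma Lp_norm_fatou p (f : nat -> R -> R) g (C : R) : (1 <= p)%E -> 0 <= C ->
  (forall n, measurable_fun setT (f n)) -> measurable_fun setT g ->
  {ae mu, forall x, f n x @[n --> \oo] --> g x} ->
  (forall n, (Lp_norm p (f n) <= C%:E)%E) -> (Lp_norm p g <= C%:E)%E.
Proof.
move=> p1 C0 mf mg fg fC; case: p p1 fC => [r r1 fC|_ fC|//]; last first.
  apply/Lp_normy_le.
  have : {ae mu, forall x, forall n, (`|f n x|%:E <= C%:E)%E}.
    by apply/ae_foralln => n; exact/Lp_normy_le.
  move=> fC'; apply: filterS2 fg fC' => x fgx fxC; rewrite lee_fin.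
  by apply: (cvgr_to_le (cvg_norm fgx)); apply: nearW => n; rewrite -lee_fin.
have r0 : 0 < r by rewrite lee_fin in r1; exact: lt_le_trans r1.
apply/Lp_norm_fin_le => //.
have fmC n : (\int[mu]_x (`|f n x| `^ r)%:E <= (C `^ r)%:E)%E.
  exact/Lp_norm_fin_le.
pose F n x := (`|f n x| `^ r)%:E.
have mF n : measurable_fun setT (F n) by exact: measurable_normr_powR.
have F0 n x : setT x -> (0 <= F n x)%E by rewrite lee_fin powR_ge0.
apply: (@le_trans _ _ (\int[mu]_x limn_einf (F ^~ x))%E).
  apply: ae_ge0_le_integral => //.
  - exact: measurable_normr_powR.
  - move=> x _; rewrite limn_einf_lim; apply: lime_ge.
      exact: is_cvg_einfs.
    by apply: nearW => n; apply: le_ereal_inf_tmp => _ [m _ <-]; exact: F0.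
  - apply: (emeasurable_fun_cvg (fun n x => einfs (F ^~ x) n)) => [m|x _].
      exact: measurable_fun_einfs.
    by rewrite limn_einf_lim; exact: is_cvg_einfs.
  - apply: filterS fg => x fgx _.
    rewrite (cvg_limn_einf_sup (_ : F n x @[n --> \oo] --> (`|g x| `^ r)%:E))//.
    apply/cvg_EFin; first by apply: nearW.
    by apply: cvg_powR => //; exact: cvg_norm.
apply: le_trans (fatou mu measurableT mF F0) _.
rewrite limn_einf_lim; apply: lime_le; first exact: is_cvg_einfs.
apply: nearW => n; apply: le_trans (fmC n).
by apply: ereal_inf_lbound; exists n => /=.
Qed.

(** A unit interval has mass 1, so Jensen gives constant 1 for every exponent. This is the device by
    which all p are treated alike: L^p functions are integrable on bounded intervals, with explicit
    control. *)
Lemma integral_norm_le_Lp_norm p f (a : R) : (1 <= p)%E -> measurable_fun setT f ->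
  (\int[mu]_(x in `[a, (a + 1)%R]) `|f x|%:E <= Lp_norm p f)%E.
Proof.
move=> p1 mf.
have muI : mu `[a, a + 1] = 1%E.
  by rewrite lebesgue_measure_itv/= lte_fin ltrDl ltr01 -EFinB [a + 1]addrC addrK.
have := Lp_norm_ge0 p f; case E : (Lp_norm p f) => [C||]// C0; last by rewrite leey.
rewrite lee_fin in C0.
have fC : (Lp_norm p f <= C%:E)%E by rewrite E.
have mnf : measurable_fun setT (fun x => `|f x|) by exact: measurableT_comp.
case: p p1 fC E => [r r1 fC _|_ /Lp_normy_le fC _|//]; last first.
  apply: (@le_trans _ _ (\int[mu]_(x in `[a, (a + 1)%R]) C%:E)%E).
    apply: ae_ge0_le_integral => //.
    - by apply/measurable_EFinP; apply: measurable_funTS.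
    - by apply: filterS fC => x xC _.
  by rewrite integral_cst//= muI mule1.
have r0 : 0 < r by rewrite lee_fin in r1; exact: lt_le_trans r1.
move/Lp_norm_fin_le : fC => /(_ r0 C0) fC.
(* The indicator of the interval serves as a probability weight on the whole line. *)
pose a1 x : R := \1_(`[a, a + 1]%classic) x.
have ma1 : measurable_fun setT a1 by exact: measurable_indic.
have a1A : (\int[mu]_x (a1 x)%:E <= 1%:E)%E.
  by rewrite integral_indic//= setIT muI.
have a10 x : 0 <= a1 x by rewrite /a1 indicE.
have := @jensen_powR _ _ _ lebesgue_measure _ _ 1 r ma1 mnf a10 _ r1 a1A.
move=> /(_ (fun x => normr_ge0 _)).
rewrite powR1 mul1e.
have -> : (\int[mu]_x (a1 x * `|f x|)%:E = \int[mu]_(x in `[a, (a + 1)%R]) `|f x|%:E)%E.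
  rewrite [RHS]integral_mkcond; apply: eq_integral => x _.
  by rewrite restrict_EFin patch_indic/= mulrC.
set J := (\int[mu]_(x in _) _)%E => H.
have J0 : (0 <= J)%E by apply: integral_ge0 => x _.
have {}H : (J `^ r <= (C `^ r)%:E)%E.
  apply: le_trans H _; apply: le_trans fC; apply: ge0_le_integral => //.
  - by move=> x _; rewrite lee_fin mulr_ge0 ?powR_ge0.
  - apply/measurable_EFinP; apply: measurable_funM => //.
    exact/(measurableT_comp (measurable_powR r)).
  - exact: measurable_normr_powR.
  - move=> x _; rewrite lee_fin ler_piMl ?powR_ge0// /a1 indicE.
    by case: (_ \in _).
have nny (x : \bar R) : (0 <= x)%E -> x \in `[0%E, +oo%E].
  by move=> x0; rewrite in_itv/= x0 leey.
rewrite -(poweRe1 J0) -(@mulfV _ r) ?gt_eqF// poweRrM.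
rewrite -[C](_ : (C `^ r) `^ r^-1 = _); last first.
  by rewrite -powRrM mulfV ?gt_eqF// powRr1.
rewrite -poweR_EFin; apply: gt0_ler_poweR => //.
- by rewrite invr_ge0 ltW.
- by apply: nny; exact: poweR_ge0.
- by apply: nny; rewrite lee_fin powR_ge0.
Qed.

End Lp.

(** * Translation invariance of Lebesgue measure *)

Section translation.
Context {R : realType}.
Local Notation mu := (@lebesgue_measure R).

Definition translate (z : R) : measurableTypeR R -> measurableTypeR R :=
  fun x => x + z.

Lemma measurable_translate (z : R) : measurable_fun setT (translate z).
Proof. by apply: measurable_funD. Qed.

HB.instance Definition _ (z : R) :=
  isMeasurableFun.Build _ _ _ _ (translate z) (measurable_translate z).

(** The pushforward agrees with Lebesgue measure on half-open intervals, and these determine it. *)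
Lemma lebesgue_measure_translate (z : R) (A : set R) : measurable A ->
  pushforward mu (translate z) A = mu A.
Proof.
move=> mA; apply/esym/lebesgue_measure_unique => //= _ [[a b]] _ <-.
rewrite /pushforward /= (_ : _ @^-1` _ = `](a - z), (b - z)]%classic); last first.
  apply/seteqP; split => x /=; rewrite /translate !in_itv/=; lra.
rewrite !lebesgue_measure_itv/= !lte_fin ltrD2r; case: ifP => // _.
by rewrite -!EFinB; congr EFin; ring.
Qed.

Lemma integral_translate (f : R -> \bar R) (z : R) : measurable_fun setT f ->
  (forall x, 0 <= f x)%E -> (\int[mu]_x f (x + z)%R = \int[mu]_x f x)%E.
Proof.
move=> mf f0.
have := @ge0_integral_pushforward _ _ _ _ R _ (measurable_translate z)
  lebesgue_measure setT f measurableT mf (fun y _ => f0 y).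
rewrite preimage_setT => <-.
apply: eq_measure_integral => //= A mA _.
exact: lebesgue_measure_translate.
Qed.

Lemma ae_translate (P : R -> Prop) (z : R) : {ae mu, forall x, P x} ->
  {ae mu, forall x, P (x + z)}.
Proof.
move=> [N [mN N0 PN]]; exists (translate z @^-1` N); split.
- by rewrite -[X in measurable X]setTI; exact: measurable_translate.
- by have := lebesgue_measure_translate z mN; rewrite N0.
- by move=> x /= Px; apply: PN.
Qed.

End translation.

(** * Minkowski's integral inequality *)

Section minkowski.
Context {R : realType}.
Local Notation mu := (@lebesgue_measure R).
Implicit Types (p : \bar R).

(** For finite [r], Jensen with weight [|al|] at each [x], then Tonelli. For p = +oo the null set on
    which [G (z, _)] exceeds [C] varies with [z], so a pointwise argument fails and Tonelli is
    applied to the excess. *)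
Lemma Lp_norm_integral p (al h : R -> R) (G : R * R -> R) (A C : R) :
  (1 <= p)%E -> 0 <= C -> measurable_fun setT al ->
  (\int[mu]_x `|al x|%:E <= A%:E)%E -> measurable_fun setT G ->
  (forall zx, 0 <= G zx) -> (forall z, Lp_norm p (fun x => G (z, x)) <= C%:E)%E ->
  measurable_fun setT h ->
  (forall x, `|h x|%:E <= \int[mu]_z (`|al z| * G (z, x))%:E)%E ->
  (Lp_norm p h <= (A * C)%:E)%E.
Proof.
move=> p1 C0 mal alA mG G0 GC mh hG.
have A0 : 0 <= A.
  by rewrite -lee_fin; apply: le_trans alA; apply: integral_ge0 => x _; rewrite lee_fin.
have mal' : measurable_fun setT (fun x => `|al x|) by exact: measurableT_comp.
have mal1 : measurable_fun setT (fun zx : R * R => `|al zx.1|).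
  by apply: measurableT_comp => //; exact: (measurableT_comp mal).
have mGz z : measurable_fun setT (fun x => G (z, x)) by exact: measurableT_comp.
have mGx x : measurable_fun setT (fun z => G (z, x)) by exact: measurableT_comp.
case: p p1 GC => [r|_ GC|//]; last first.
  (* The excess over [C]: for each [z] it vanishes at almost every [x], so its weighted double
     integral is 0, and for almost every [x] its weighted integral in [z] is 0. *)
  pose H zx := Num.max (G zx - C) 0.
  have H0 zx : 0 <= H zx by rewrite le_max lexx orbT.
  have mH : measurable_fun setT H.
    by apply: measurable_maxr => //; exact: measurable_funB.
  pose K zx := (`|al zx.1| * H zx)%:E.
  have mK : measurable_fun setT K by apply/measurable_EFinP; exact: measurable_funM.
  have K0 zx : (0 <= K zx)%E by rewrite lee_fin mulr_ge0.
  have : (\int[mu]_x \int[mu]_z K (z, x) = 0)%E.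
    rewrite -(@fubini_tonelli _ _ _ _ _ lebesgue_measure lebesgue_measure K mK K0).
    rewrite -[RHS](@integral0 _ _ _ lebesgue_measure setT); apply: eq_integral => z _.
    rewrite -[RHS](@integral0 _ _ _ lebesgue_measure setT); apply: ge0_ae_eq_integral => //.
      exact: measurableT_comp.
    have /Lp_normy_le := GC z; apply: filterS => x; rewrite lee_fin => GzxC _.
    rewrite /K /= /H max_r ?mulr0// subr_le0.
    by rewrite ger0_norm in GzxC.
  move=> K1.
  have mK1 : measurable_fun setT (fun x => \int[mu]_z K (z, x))%E.
    exact: (@measurable_fun_fubini_tonelli_G _ _ _ _ R lebesgue_measure K).
  have K10 x : (0 <= \int[mu]_z K (z, x))%E by exact: integral_ge0.
  have : ae_eq mu setT (fun x => \int[mu]_z K (z, x))%E (cst 0%E).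
    apply/(@ae_eq_integral_abs _ _ _ lebesgue_measure _ measurableT) => //.
    by rewrite -[RHS]K1; apply: eq_integral => x _; rewrite gee0_abs.
  move=> K2; apply/Lp_normy_le; apply: filterS K2 => x /(_ I) Kx.
  apply: le_trans (hG x) _.
  apply: (@le_trans _ _ (\int[mu]_z (C%:E * `|al z|%:E + K (z, x)))%E).
    apply: ge0_le_integral => //.
    - by move=> z _; rewrite lee_fin; apply: mulr_ge0 => //; exact: G0.
    - by apply/measurable_EFinP; apply: measurable_funM => //; exact: mGx.
    - apply: emeasurable_funD; last exact: measurableT_comp.
      by apply/measurable_EFinP; exact: measurable_funM.
    - move=> z _; rewrite -EFinM -EFinD lee_fin [C * _]mulrC -mulrDr.
      by rewrite ler_wpM2l//= /H -lerBlDl le_max lexx.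
  rewrite ge0_integralD//; last 3 first.
  - by move=> z _; rewrite -EFinM lee_fin mulr_ge0.
  - by apply/measurable_EFinP; exact: measurable_funM.
  - exact: measurableT_comp.
  rewrite Kx adde0 ge0_integralZl//; last exact/measurable_EFinP.
  by rewrite EFinM muleC lee_wpmul2r.
rewrite lee_fin => r1 GC.
have r0 : 0 < r by exact: lt_le_trans r1.
apply/Lp_norm_fin_le => //; first exact: mulr_ge0.
have nny (x : \bar R) : (0 <= x)%E -> x \in `[0%E, +oo%E].
  by move=> x0; rewrite in_itv/= x0 leey.
pose K zx := (`|al zx.1| * G zx `^ r)%:E.
have mK : measurable_fun setT K.
  apply/measurable_EFinP; apply: measurable_funM => //.
  exact/(measurableT_comp (measurable_powR r)).
have K0 zx : (0 <= K zx)%E by rewrite lee_fin mulr_ge0// powR_ge0.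
have mK1 : measurable_fun setT (fun x => \int[mu]_z K (z, x))%E.
  exact: (@measurable_fun_fubini_tonelli_G _ _ _ _ R lebesgue_measure K).
apply: (@le_trans _ _ (\int[mu]_x ((A `^ (r - 1))%:E * \int[mu]_z K (z, x)))%E).
  apply: ge0_le_integral => //.
  - exact: measurable_normr_powR.
  - exact: measurable_funeM.
  - move=> x _; rewrite -poweR_EFin.
    apply: (@le_trans _ _ ((\int[mu]_z (`|al z| * G (z, x))%:E) `^ r)%E).
      apply: gt0_ler_poweR; [exact: ltW|exact: nny| |exact: hG].
      apply: nny; apply: integral_ge0 => z _; rewrite lee_fin.
      by apply: mulr_ge0 => //; exact: G0.
    apply: (@jensen_powR _ _ _ lebesgue_measure (fun z => `|al z|)) => //.
    exact: mGx.
rewrite ge0_integralZl//; last 2 first.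
- by move=> x _; exact: integral_ge0.
- by rewrite lee_fin powR_ge0.
rewrite -(@fubini_tonelli _ _ _ _ _ lebesgue_measure lebesgue_measure K mK K0).
(* [r - 1] powers of the mass come from Jensen, the last one from integrating in [z]. *)
rewrite -[(A * C) `^ r](_ : A `^ (r - 1) * (A * C `^ r) = _); last first.
  by rewrite mulrA [_ * A]mulrC mulr_powRB1// powRM.
rewrite EFinM lee_wpmul2l// ?lee_fin ?powR_ge0//.
apply: (@le_trans _ _ (\int[mu]_z (`|al z|%:E * (C `^ r)%:E))%E); last first.
  rewrite ge0_integralZr// ?lee_fin ?powR_ge0//; last exact/measurable_EFinP.
  by rewrite EFinM lee_wpmul2r// lee_fin powR_ge0.
apply: ge0_le_integral; first exact: measurableT.
- by move=> z _; exact: integral_ge0.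
- exact: (@measurable_fun_fubini_tonelli_F _ _ _ _ R lebesgue_measure K).
- by apply/measurable_EFinP; exact: measurable_funM.
move=> z _; rewrite /K /=; under eq_integral do rewrite EFinM.
rewrite ge0_integralZl//.
- rewrite lee_wpmul2l//.
  under eq_integral do rewrite -[G _]ger0_norm ?G0//.
  exact: (proj1 (Lp_norm_fin_le (fun x => G (z, x)) r0 C0) (GC z)).
- by apply/measurable_EFinP; apply: (measurableT_comp (measurable_powR r)); exact: mGz.
- by move=> x _; rewrite lee_fin powR_ge0.
Qed.
End minkowski.

(** * Convergence of normally summable series in L^p *)

Section riesz_fischer.
Context {R : realType}.
Local Notation mu := (@lebesgue_measure R).
Variables (p : \bar R) (f : nat -> R -> R) (c : nat -> R) (S : R).
Hypotheses (p1 : (1 <= p)%E) (mf : forall k, measurable_fun setT (f k)).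
Hypothesis fc : forall k, (Lp_norm p (f k) <= (c k)%:E)%E.
Hypothesis cS : forall n, \sum_(0 <= k < n) c k <= S.

(* Unit intervals reduce every exponent to the summability of L^1 norms. *)
Lemma ae_cvg_series : {ae mu, forall x, cvgn (series (f ^~ x))}.
Proof.
pose g k x := `|f k x|%:E.
have mg k : measurable_fun setT (g k).
  by apply/measurable_EFinP; exact: measurableT_comp.
have g0 k x : (0 <= g k x)%E by rewrite lee_fin.
pose h x := (\sum_(0 <= k <oo) g k x)%E.
have mh : measurable_fun setT h by apply: ge0_emeasurable_sum => // k x _ _; exact: g0.
have h0 x : (0 <= h x)%E by apply: nneseries_ge0 => k _ _; exact: g0.
have hS (a : R) : (\int[mu]_(x in `[a, (a + 1)%R]) h x <= S%:E)%E.
  rewrite integral_nneseries//; last by move=> k; apply: measurable_funTS; exact: mg.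
  apply: lime_le.
    by apply: is_cvg_nneseries => k _ _; exact: integral_ge0.
  apply: nearW => n; apply: (@le_trans _ _ (\sum_(0 <= k < n) (c k)%:E)%E).
    apply: lee_sum => k _; apply: le_trans (fc k).
    exact: integral_norm_le_Lp_norm.
  by rewrite sumEFin lee_fin.
have haefin (a : R) : {ae mu, forall x, `[a, a + 1]%classic x -> h x \is a fin_num}.
  apply: (@integrable_ae _ _ _ lebesgue_measure) => //.
  apply/integrableP; split; first exact: measurable_funTS.
  under eq_integral do rewrite gee0_abs//.
  by apply: le_lt_trans (hS a) _; rewrite ltry.
(* The unit intervals with integer end points cover the line; integers are enumerated through
   [unpickle] to intersect countably many a.e. statements. *)
have : {ae mu, forall x, forall n : nat, forall z : int, unpickle n = Some z ->
    `[z%:~R, z%:~R + 1]%classic x -> h x \is a fin_num}.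
  apply/ae_foralln => n; case: (unpickle n) => [z|]; last exact: aeW.
  by apply: filterS (haefin z%:~R) => x H z' [<-].
apply: filterS => x Hx.
have {Hx}hx : h x \is a fin_num.
  apply: (Hx (pickle (Num.floor x)) (Num.floor x)); first by rewrite pickleK.
  rewrite /= in_itv/= floor_le_tmp/=.
  by rewrite ltW// -[1]/(1%:~R) -intrD floorD1_gt.
apply: normed_cvg; apply: nondecreasing_is_cvgn.
  apply/nondecreasing_seqP => n.
  by rewrite /normed_series_of seriesSr lerDl; exact: normr_ge0.
exists (fine (h x)) => _ [n _ <-]; rewrite -lee_fin fineK// -sumEFin.
by apply: nneseries_lim_ge => k _ _; exact: g0.
Qed.

(** Fatou on the tails: bounds on the finite sums from [n] to [m] become a bound on the
    remainder. *)
Lemma riesz_fischer : exists2 F : R -> R, measurable_fun setT F &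
  forall n (e : R), 0 <= e ->
    (forall m, (n <= m)%N -> \sum_(n <= k < m) c k <= e) ->
    (Lp_norm p (fun x => F x - \sum_(0 <= k < n) f k x)%R <= e%:E)%E.
Proof.
pose s n x := \sum_(0 <= k < n) f k x.
have ms n : measurable_fun setT (s n) by exact: measurable_sum.
(* An upper limit is measurable on the whole line and equals the sum wherever the series converges;
   [fine] makes it real-valued elsewhere. *)
pose F x := fine (limn_esup (fun n => (s n x)%:E)).
have mF : measurable_fun setT F.
  apply: (measurableT_comp (fine_measurable measurableT)).
  by apply: measurable_fun_limn_esup => n; exact/measurable_EFinP.
have sF : {ae mu, forall x, s n x @[n --> \oo] --> F x}.
  apply: filterS ae_cvg_series => x cx.
  have : (s n x)%:E @[n --> \oo] --> (limn (series (f ^~ x)))%:E.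
    by apply/cvg_EFin; [exact: nearW|exact: cx].
  move=> /cvg_limn_einf_sup [_ E].
  by rewrite /F E /=; exact: cx.
exists F => // n e e0 ce.
apply: (@Lp_norm_fatou _ p (fun m x => s (m + n)%N x - s n x)) => //.
- by move=> m; apply: measurable_funB; exact: ms.
- by apply: measurable_funB => //; exact: ms.
- apply: filterS sF => x sFx; apply: cvgB; last exact: cvg_cst.
  by rewrite (cvg_shiftn n (s ^~ x)).
- move=> m; have -> : (fun x => s (m + n)%N x - s n x) =
      (fun x => \sum_(0 <= k < m) f (k + n)%N x).
    apply/funext => x; rewrite /s [X in X - _](big_cat_nat _ (leq_addl _ _))//=.
    by rewrite addrAC subrr add0r -[n in LHS]add0n big_addn addnK.
  apply: le_trans (Lp_norm_sum _ p1 _ (fun k => fc (k + n)%N)) _ => //.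
  rewrite lee_fin; apply: le_trans (ce (m + n)%N (leq_addl _ _)).
  by rewrite -[n in leRHS]add0n big_addn addnK.
Qed.
End riesz_fischer.

(** * Smooth functions, flat functions and a smooth step *)

Section smooth.
Context {R : realType}.
Implicit Types f g h : R -> R.

Definition smooth f := forall n x, derivable (derive1n n f) x 1.

Lemma is_derive_derive1 f (df : R -> R) : (forall x, is_derive x (1 : R) f (df x)) ->
  derive1 f = df.
Proof. by move=> H; apply/funext => x; rewrite derive1E; have [_ ->] := H x. Qed.

Lemma derivable_is_derive f x : derivable f x 1 -> is_derive x (1 : R) f (derive1 f x).
Proof. by move=> df; rewrite derive1E; split. Qed.

(** A coinduction principle: a class of functions whose derivatives stay in the class is smooth,
    with no formula for the n-th derivative. *)
Lemma smooth_class (C : (R -> R) -> Prop) :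
  (forall f, C f -> exists2 g, C g & forall x, is_derive x (1 : R) f (g x)) ->
  forall f, C f -> smooth f.
Proof.
move=> HC f Cf n x; suff /HC[g _ Hg] : C (derive1n n f) by have [] := Hg x.
elim: n {x} => // n /HC[g Cg Hg].
by rewrite derive1nS (is_derive_derive1 Hg).
Qed.

Lemma smooth_is_derive f x : smooth f -> is_derive x (1 : R) f (derive1 f x).
Proof. by move=> /(_ 0%N x) df; exact: derivable_is_derive. Qed.

Lemma smooth_derive1 f : smooth f -> smooth (derive1 f).
Proof. by move=> sf n x; rewrite -derive1Sn; exact: sf. Qed.

Lemma smooth_continuous f : smooth f -> continuous f.
Proof.
move=> sf x; apply: differentiable_continuous; apply/derivable1_diffP.
exact: (sf 0%N).
Qed.

Lemma smooth_primitive h f : (forall x, is_derive x (1 : R) h (f x)) -> smooth f -> smooth h.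
Proof.
move=> hf sf [|n] x; first by have [] := hf x.
by rewrite derive1Sn (is_derive_derive1 hf); exact: sf.
Qed.

Lemma smooth_lin (a b : R) f g : smooth f -> smooth g ->
  smooth (fun x => a * f x + b * g x).
Proof.
move=> sf sg.
apply: (@smooth_class (fun h => exists f g, [/\ smooth f, smooth g &
   h = fun x => a * f x + b * g x])); last by exists f, g.
move=> _ [u [v [su sv ->]]].
exists (fun x => a * derive1 u x + b * derive1 v x).
  by exists (derive1 u), (derive1 v); split; [exact: smooth_derive1|exact: smooth_derive1|].
move=> x; have du := smooth_is_derive x su; have dv := smooth_is_derive x sv.
exact: (@is_deriveD _ _ _ (a \*: u) (b \*: v)).
Qed.

(** By Leibniz the derivative of a product is a sum of two products, so stability under
    differentiation needs the sums as well. *)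
Inductive product_span : (R -> R) -> Prop :=
| product_span_mul f g : smooth f -> smooth g -> product_span (fun x => f x * g x)
| product_span_add f g : product_span f -> product_span g ->
    product_span (fun x => f x + g x).

Lemma smoothM f g : smooth f -> smooth g -> smooth (fun x => f x * g x).
Proof.
move=> sf sg; apply: (@smooth_class product_span); last exact: product_span_mul.
move=> h; elim=> [u v su sv|u v _ [u' Cu' du] _ [v' Cv' dv]].
- exists (fun x => u x * derive1 v x + derive1 u x * v x).
    apply: product_span_add; apply: product_span_mul; [exact: su| | |exact: sv];
      exact: smooth_derive1.
  move=> x; have du := smooth_is_derive x su; have dv := smooth_is_derive x sv.
  apply: (is_derive_eq (is_deriveM du dv)).
  by rewrite /GRing.scale/= [v x * _]mulrC.
- exists (fun x => u' x + v' x); first exact: product_span_add.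
  by move=> x; exact: is_deriveD.
Qed.

Lemma is_derive_affine f (a b : R) x (d : R) : is_derive (a * x + b) (1 : R) f d ->
  is_derive x (1 : R) (fun y => f (a * y + b)) (a * d).
Proof.
move=> df; have daff : is_derive x (1 : R) (fun y => a * y + b) a.
  apply: (is_derive_eq (is_deriveD (is_deriveZ a (is_derive_id x (1 : R))) (is_derive_cst b x (1 : R)))).
  by rewrite addr0 /GRing.scale/= mulr1.
have := @is_derive1_comp _ f (fun y => a * y + b) x _ _ df daff.
by rewrite mulrC.
Qed.

Lemma smooth_affine f (a b : R) : smooth f -> smooth (fun x => f (a * x + b)).
Proof.
move=> sf; apply: (@smooth_class (fun h => exists2 f, smooth f & exists c,
   h = fun x => c * f (a * x + b))); last first.
  by exists f => //; exists 1; apply/funext => x; rewrite mul1r.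
move=> _ [u su [c ->]]; exists (fun x => c * a * derive1 u (a * x + b)).
  by exists (derive1 u); [exact: smooth_derive1|exists (c * a)].
move=> x; rewrite -mulrA.
apply: is_deriveZ; apply: is_derive_affine; exact: smooth_is_derive.
Qed.

End smooth.

Section bump.
Context {R : realType}.

(* [x^-k exp(-1/x)] on the positive half-line, extended by [0]. *)
Definition flat_exp (k : nat) (x : R) : R :=
  if 0 < x then x^-1 ^+ k * expR (- x^-1) else 0.

(** From [y^(k+1) / (k+1)! <= expR y] at [y = x^-1]. The linear factor [x] is what yields continuity
    at 0. *)
Lemma flat_exp_bound k x : 0 < x -> `|flat_exp k x| <= (k.+1)`!%:R * x.
Proof.
move=> x0; have xi0 : 0 < x^-1 by rewrite invr_gt0.
have xi0' := ltW xi0.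
rewrite /flat_exp x0 ger0_norm; last by rewrite mulr_ge0 ?exprn_ge0 ?expR_ge0.
rewrite expRN ler_pdivrMr ?expR_gt0//.
have := expR_ge1Dxn k (ltW xi0).
move=> H; apply: (@le_trans _ _ ((k.+1)`!%:R * x * (x^-1 ^+ k.+1 / (k.+1)`!%:R))).
  rewrite le_eqVlt; apply/orP; left; apply/eqP; rewrite exprS.
  by field; rewrite ?gt_eqF// pnatr_eq0 -lt0n fact_gt0.
rewrite ler_wpM2l//; first by rewrite mulr_ge0// ltW.
by apply: le_trans H; rewrite lerDr.
Qed.

Lemma flat_exp_cvg0 k : {for 0, continuous (flat_exp k)}.
Proof.
have f0 : flat_exp k 0 = 0 by rewrite /flat_exp ltxx.
apply/cvgrPdist_le => e e0; near=> x; rewrite f0 sub0r normrN.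
have [x0|x0] := ltP 0 x; last by rewrite /flat_exp ltNge x0/= normr0 ltW.
apply: le_trans (flat_exp_bound k x0) _.
rewrite mulrC -ler_pdivlMr ?ltr0n ?fact_gt0//.
rewrite -[x]ger0_norm ?ltW//; near: x.
have e1 : 0 < e / (k.+1)`!%:R by rewrite divr_gt0// ltr0n fact_gt0.
exists (e / (k.+1)`!%:R) => // y; by rewrite /ball_ /= sub0r normrN.
Unshelve. all: by end_near. Qed.

Lemma is_derive_flat_exp k x :
  is_derive x (1 : R) (flat_exp k) (- k%:R * flat_exp k.+1 x + flat_exp k.+2 x).
Proof.
have [x0|x0|->] := ltgtP x 0.
- rewrite /flat_exp ltNge (ltW x0)/= mulr0 addr0.
  apply: (@near_eq_is_derive _ _ _ (cst 0)); rewrite ?oner_neq0//.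
  near=> y; rewrite ifF//; apply/negbTE; rewrite -leNgt ltW//; near: y.
  exact: lt_nbhsl.
- have xn0 : x != 0 by rewrite gt_eqF.
  apply: (@near_eq_is_derive R R R (fun y : R => y^-1 ^+ k * expR (- y^-1))).
  + near=> y; rewrite /flat_exp ifT//; near: y; exact: lt_nbhsr.
  + have dV := @is_deriveV R id x 1 1 xn0 (is_derive_id x (1 : R)).
    have dX := is_deriveX k dV.
    have dE := @is_derive1_comp R expR (fun y => - y^-1) x _ _ (is_derive_expR (- x^-1)) (is_deriveN dV).
    have -> : (fun y : R => y^-1 ^+ k * expR (- y^-1)) =
        (fun y : R => y^-1) ^+ k * (fun y => expR (- y^-1)).
      by apply/funext => y; rewrite !fctE.
    apply: (is_derive_eq (is_deriveM dX dE)).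
    rewrite /flat_exp x0 !fctE /GRing.scale /= -exprVn.
    move: (expR (- x^-1)) (x^-1) => e y {dV dX dE}.
    case: k => [|k]; first by rewrite mulr0n !expr0; ring.
    by rewrite /= !(exprS y); move: (k.+1%:R) (y ^+ k) => a b; ring.
(* At 0 the difference quotient of [flat_exp k] is [flat_exp k.+1], which is continuous there with
   value 0: Caratheodory's form of differentiability. *)
- rewrite /flat_exp ltxx mulr0 addr0 -/(flat_exp _).
  apply/is_derive1_caratheodory; exists (flat_exp k.+1); split.
  + move=> z; rewrite /flat_exp ltxx !subr0; case: ifPn => [z0|]; last by rewrite mul0r.
    rewrite exprS; move: (_ ^+ k) (expR _) => a b.
    by field; rewrite gt_eqF.
  + exact: flat_exp_cvg0.
  + by rewrite /flat_exp ltxx.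
Unshelve. all: by end_near. Qed.

Inductive flat_span : (R -> R) -> Prop :=
| flat_span_exp k : flat_span (flat_exp k)
| flat_span_lin (a b : R) f g : flat_span f -> flat_span g ->
    flat_span (fun x => a * f x + b * g x).

Lemma smooth_flat_exp k : smooth (flat_exp k).
Proof.
apply: (@smooth_class _ flat_span); last exact: flat_span_exp.
move=> h; elim=> [j|a b u v _ [u' Cu' du] _ [v' Cv' dv]].
- exists (fun x => - j%:R * flat_exp j.+1 x + 1 * flat_exp j.+2 x).
    by apply: flat_span_lin; exact: flat_span_exp.
  by move=> x; rewrite mul1r; exact: is_derive_flat_exp.
- exists (fun x => a * u' x + b * v' x); first exact: flat_span_lin.
  by move=> x; exact: (@is_deriveD _ _ _ (a \*: u) (b \*: v)).
Qed.

(** Positive exactly on the open unit interval; the second argument is written so as to match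
    [smooth_affine]. *)
Definition bump (x : R) := flat_exp 0 x * flat_exp 0 (- 1 * x + 1).

Lemma smooth_bump : smooth bump.
Proof. by apply: smoothM; [|apply: smooth_affine]; exact: smooth_flat_exp. Qed.

Lemma flat_exp_ge0 k x : 0 <= flat_exp k x.
Proof.
rewrite /flat_exp; case: ifP => // x0.
by rewrite mulr_ge0 ?expR_ge0// exprn_ge0// invr_ge0 ltW.
Qed.

Lemma bump_ge0 x : 0 <= bump x.
Proof. by rewrite mulr_ge0// flat_exp_ge0. Qed.

Lemma bump_gt0 x : 0 < x < 1 -> 0 < bump x.
Proof.
move=> /andP[x0 x1]; rewrite /bump /flat_exp x0 ifT; last by lra.
by rewrite !expr0 !mul1r mulr_gt0 ?expR_gt0.
Qed.

Lemma bump_eq0 x : ~~ (0 < x < 1) -> bump x = 0.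
Proof.
rewrite negb_and -!leNgt /bump /flat_exp => /orP[x0|x1].
  by rewrite ltNge x0/= mul0r.
by rewrite [X in _ * X]ifF ?mulr0//; apply/negbTE; rewrite -leNgt; lra.
Qed.

(** The primitive of [bump], divided by its total integral [P 1]. Its derivative is at most
    [(P 1)^-1] because [bump <= 1]. *)
Lemma ex_smooth_step : exists H : R -> R, [/\ smooth H,
  forall x, x <= 0 -> H x = 0, forall x, 1 <= x -> H x = 1,
  forall x, 0 <= H x <= 1 &
  exists2 B : R, 0 < B & forall x, 0 <= derive1 H x <= B].
Proof.
have cb := smooth_continuous smooth_bump.
have mb : measurable_fun setT bump by exact: continuous_measurable_fun.
have ib (A : set R) : measurable A ->
    (@lebesgue_measure R).-integrable A (EFin \o bump).
  move=> mA; apply: (@integrableS _ _ _ _ setT) => //.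
  have : (@lebesgue_measure R).-integrable `[0, 1] (EFin \o bump).
    apply: continuous_compact_integrable; first exact: segment_compact.
    exact: continuous_subspaceT.
  move=> /(proj1 (@integrable_mkcond _ _ R lebesgue_measure _ (EFin \o bump) (measurable_itv `[0, 1]))).
  apply: (@eq_integrable _ _ _ lebesgue_measure setT measurableT) => x _.
  rewrite restrict_EFin/=; congr EFin; rewrite patchE; case: ifPn => //.
  rewrite notin_setE/= in_itv/= => /negP x01; rewrite bump_eq0//.
  by apply: contra x01; lra.
pose P x := Rintegral (@lebesgue_measure R) `]-oo, x] bump.
have dP x : is_derive x (1 : R) P (bump x).
  have [dP <-] := @continuous_FTC1 R bump -oo%O x (x + 1) (ltac:(by rewrite ltrDl))
    (ib _ (measurable_itv _)) (ltNyr _) (cb x).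
  exact: derivable_is_derive.
have cP : continuous P by apply: smooth_continuous; exact: (smooth_primitive dP smooth_bump).
have Pmvt x y : x < y -> exists2 z, x < z < y & P y - P x = bump z * (y - x).
  move=> xy; have [z + E] := @MVT R P bump x y xy (fun z _ => dP z) (continuous_subspaceT cP).
  by rewrite in_itv/= => zxy; exists z.
have P0 x : x <= 0 -> P x = 0.
  move=> x0; rewrite /P /Rintegral (eq_integral (cst 0%E)) ?integral0// => y.
  rewrite inE/= in_itv/= => yx; rewrite bump_eq0//; apply/negP; lra.
have P1 x : 1 <= x -> P x = P 1.
  rewrite le_eqVlt => /predU1P[<-//|x1]; have [z zx] := Pmvt _ _ x1.
  by rewrite bump_eq0 ?mul0r; [move/subr0_eq|apply/negP; lra].
have Pmon x y : x <= y -> P x <= P y.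
  rewrite le_eqVlt => /predU1P[->//|xy]; have [z zx E] := Pmvt _ _ xy.
  by rewrite -subr_ge0 E mulr_ge0 ?bump_ge0// subr_ge0 ltW.
have c0 : 0 < P 1.
  have [z z01] := Pmvt _ _ (@ltr01 R).
  by rewrite (P0 0)// !subr0 mulr1 => ->; exact: bump_gt0.
have sP := smooth_primitive dP smooth_bump.
have ci0 : 0 < (P 1)^-1 by rewrite invr_gt0.
(* The zero summand gives [H] the shape of [smooth_lin]. *)
pose H x := (P 1)^-1 * P x + 0 * P x.
have HE x : H x = (P 1)^-1 * P x by rewrite /H mul0r addr0.
have dH x : derive1 H x = (P 1)^-1 * bump x.
  rewrite (_ : H = (P 1)^-1 \*: P); last by apply/funext => y; rewrite HE.
  by have [_ E] := is_deriveZ (P 1)^-1 (dP x); rewrite derive1E E.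
exists H; split.
- exact: smooth_lin.
- by move=> x x0; rewrite HE (P0 x)// mulr0.
- by move=> x x1; rewrite HE (P1 x)// mulVf// gt_eqF.
- move=> x; rewrite HE; apply/andP; split.
    apply: mulr_ge0; first exact: ltW.
    rewrite -(P0 (Num.min x 0)) ?ge_min ?lexx ?orbT//.
    by apply: Pmon; rewrite ge_min lexx.
  rewrite mulrC ler_pdivrMr// mul1r.
  by have [x1|/ltW/P1 ->//] := leP x 1; exact: Pmon.
- exists (P 1)^-1 => // x; rewrite dH; apply/andP; split.
    by apply: mulr_ge0; [exact: ltW|exact: bump_ge0].
  rewrite ler_piMr//; first exact: ltW.
  have [x01|/bump_eq0 ->//] := boolP (0 < x < 1).
  rewrite /bump /flat_exp !expr0 !mul1r.
  have e1 (y : R) : 0 < y -> expR (- y^-1) <= 1.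
    by move=> y0; rewrite -[leRHS]expR0 ler_expR oppr_le0 invr_ge0 ltW.
  rewrite !ifT; [|lra|lra]; rewrite mulr_ile1 ?expR_ge0 ?e1//; lra.
Qed.

End bump.

(** * Local integrability of L^p functions and pairing with test functions *)

Section local_integrability.
Context {R : realType}.
Local Notation mu := (@lebesgue_measure R).

Lemma integral_norm_itv_le_Lp_norm p (f : R -> R) (a : R) n : (1 <= p)%E ->
  measurable_fun setT f ->
  (\int[mu]_(x in `[a, (a + n%:R)%R]) `|f x|%:E <= n%:R%:E * Lp_norm p f)%E.
Proof.
move=> p1 mf.
have mnf : measurable_fun setT (fun x => `|f x|%:E).
  by apply/measurable_EFinP; exact: measurableT_comp.
elim: n => [|n IH].
  by rewrite addr0 set_itv1 integral_set1 mul0e.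
have sub : `[a, a + n.+1%:R] `<=`
    `[a, a + n%:R] `|` `](a + n%:R), (a + n.+1%:R)]%classic.
  move=> x /=; rewrite !in_itv/= => /andP[-> ->]/=.
  by have [_|_] := leP x (a + n%:R); [left|right].
apply: (@le_trans _ _ (\int[mu]_(x in `[a, (a + n%:R)%R] `|`
    `](a + n%:R)%R, (a + n.+1%:R)%R]) `|f x|%:E)%E).
  apply: ge0_subset_integral => //; first exact: measurableU.
  exact: measurable_funTS.
rewrite ge0_integral_setU//; last 2 first.
- exact: measurable_funTS.
- apply/disj_setPS => x /= []; rewrite !in_itv/= => /andP[_ +] /andP[+ _].
  by rewrite leNgt => /negP.
rewrite -natr1 EFinD ge0_muleDl ?lee_fin// mul1e; apply: leeD => //.
apply: le_trans (integral_norm_le_Lp_norm (a + n%:R) p1 mf).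
apply: ge0_subset_integral => //; first exact: measurable_funTS.
by move=> x /=; rewrite !in_itv/= -addrA => /andP[/ltW -> ->].
Qed.

(** Pairing with a bounded function of bounded support is continuous on L^p, and [k] does not depend
    on [f]. Closedness of the weak derivative and the exchange of integrals both use this
    uniformity. *)
Lemma integral_norm_mul_le_Lp_norm p (phi : R -> R) (M B : R) : (1 <= p)%E ->
  measurable_fun setT phi ->
  (forall x, `|phi x| <= B) -> (forall x, M < `|x| -> phi x = 0) ->
  exists2 k : R, 0 <= k & forall f : R -> R, measurable_fun setT f ->
    (\int[mu]_x `|(f x * phi x)%:E| <= k%:E * Lp_norm p f)%E.
Proof.
move=> p1 mphi phiB phiM; have B0 : 0 <= B by exact: le_trans (phiB 0).
pose n := (Num.truncn (M + M)).+1.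
exists (B * n%:R) => [|f mf]; first by rewrite mulr_ge0.
have mnf : measurable_fun setT (fun x => `|f x|%:E).
  by apply/measurable_EFinP; exact: measurableT_comp.
have sub : `[- M, M] `<=` `[- M, - M + n%:R]%classic.
  move=> x /=; rewrite !in_itv/= => /andP[-> xM]/=.
  by apply: le_trans xM _; rewrite -lerBlDl opprK; apply/ltW; exact: truncnS_gt.
apply: (@le_trans _ _ (\int[mu]_(x in `[(- M)%R, (- M + n%:R)%R]) (B%:E * `|f x|%:E))%E).
  rewrite [leRHS]integral_mkcond; apply: ge0_le_integral => //.
  - by apply: measurableT_comp => //; apply/measurable_EFinP; exact: measurable_funM.
  - by apply/(measurable_restrictT _ _).1 => //; apply: measurable_funTS; exact: measurable_funeM.
  - move=> x _; rewrite patchE; case: ifPn => [_|].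
      by rewrite -EFinM abse_EFin lee_fin normrM mulrC ler_wpM2r.
    move=> xn; rewrite phiM ?mulr0 ?abse0//.
    rewrite ltNge; apply: contra xn; rewrite ler_norml => xM.
    by rewrite inE; apply: sub; rewrite /= in_itv.
rewrite ge0_integralZl//; last by apply: measurable_funTS.
rewrite EFinM -muleA lee_wpmul2l ?lee_fin//.
exact: integral_norm_itv_le_Lp_norm.
Qed.

Lemma Lp_integrable_itv p (f : R -> R) (a b : R) : (1 <= p)%E ->
  measurable_fun setT f -> (Lp_norm p f < +oo)%E ->
  mu.-integrable `[a, b] (EFin \o f).
Proof.
move=> p1 mf foo.
have mnf : measurable_fun setT (fun x => `|f x|%:E).
  by apply/measurable_EFinP; exact: measurableT_comp.
apply/integrableP; split; first by apply/measurable_EFinP; exact: measurable_funTS.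
have := @integral_norm_itv_le_Lp_norm p f a (Num.truncn (b - a)).+1 p1 mf.
move=> /le_lt_trans => /(_ _ (lte_mul_pinfty _ _ foo)) H.
apply: le_lt_trans (H _ _); rewrite ?lee_fin//.
apply: ge0_subset_integral => //; first exact: measurable_funTS.
move=> x /=; rewrite !in_itv/= => /andP[-> xb]/=.
apply: le_trans xb _; rewrite -lerBlDl; apply/ltW; exact: truncnS_gt.
Qed.

Lemma Lp_integrableM p (f phi : R -> R) (M B : R) : (1 <= p)%E ->
  measurable_fun setT f -> (Lp_norm p f < +oo)%E -> measurable_fun setT phi ->
  (forall x, `|phi x| <= B) -> (forall x, M < `|x| -> phi x = 0) ->
  mu.-integrable setT (EFin \o (fun x => f x * phi x)).
Proof.
move=> p1 mf foo mphi phiB phiM.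
have [k k0 H] := integral_norm_mul_le_Lp_norm p1 mphi phiB phiM.
apply/integrableP; split; first by apply/measurable_EFinP; exact: measurable_funM.
by apply: le_lt_trans (H _ mf) _; exact: lte_mul_pinfty.
Qed.

Lemma Lp_locally_integrable p (f : R -> R) : (1 <= p)%E ->
  measurable_fun setT f -> (Lp_norm p f < +oo)%E -> locally_integrable setT f.
Proof.
move=> p1 mf foo; split=> //; first exact: openT.
move=> K _ cK; have [M [_ HM]] := compact_bounded cK.
have := Lp_integrable_itv (- (M + 1)) (M + 1) p1 mf foo.
move=> /integrableP[_]; apply: le_lt_trans; apply: ge0_subset_integral => //.
- exact: compact_measurable.
- apply/measurable_EFinP; apply: measurableT_comp => //; exact: measurable_funTS.
- by move=> x Kx /=; rewrite in_itv/= -ler_norml; apply: HM => //; rewrite ltrDl.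
Qed.

Lemma continuous_support_bounded (f : R -> R) (M : R) : continuous f ->
  (forall x, M < `|x| -> f x = 0) -> exists2 B, 0 < B & forall x, `|f x| <= B.
Proof.
move=> cf fM.
have : compact (f @` `[(- M), M]).
  by apply: continuous_compact; [exact: continuous_subspaceT|exact: segment_compact].
move=> /compact_bounded[C [_ HC]]; exists (`|C| + 1); first by rewrite ltr_wpDl.
move=> x; have [xM|Mx] := leP `|x| M; last by rewrite fM// normr0 addr_ge0.
apply: HC; first by rewrite (le_lt_trans (ler_norm _))// ltrDl.
by exists x => //=; rewrite in_itv/= -ler_norml.
Qed.

Lemma test_function_smooth (phi : R -> R) : test_function phi -> smooth phi.
Proof. by case. Qed.

Lemma test_function_bounds (phi : R -> R) : test_function phi ->
  exists M B : R, [/\ continuous phi, continuous (derive1 phi),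
    forall x, `|phi x| <= B, forall x, `|derive1 phi x| <= B &
    forall x, M < `|x| -> phi x = 0 /\ derive1 phi x = 0].
Proof.
move=> [sphi [M phiM]].
have c1 := smooth_continuous sphi; have c2 := smooth_continuous (smooth_derive1 sphi).
have dM x : M < `|x| -> derive1 phi x = 0.
  move=> Mx; have : is_derive x (1 : R) phi 0.
    apply: (@near_eq_is_derive R R R (cst 0)).
    near=> y; rewrite phiM//; near: y.
    by apply: (cvgr_gt `|x|) => //; apply: cvg_norm; exact: cvg_id.
  by rewrite derive1E => -[_ ->].
have [B1 B10 H1] := continuous_support_bounded c1 phiM.
have [B2 B20 H2] := continuous_support_bounded c2 dM.
exists M, (B1 + B2); split=> // x.
- by rewrite (le_trans (H1 x))// lerDl ltW.
- by rewrite (le_trans (H2 x))// lerDr ltW.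
- by move=> Mx; rewrite phiM// dM.
Unshelve. all: by end_near. Qed.

End local_integrability.

(** * Smooth approximations of point evaluation and of the indicator of an interval *)

Section weak_ftc.
Context {R : realType}.
Local Notation mu := (@lebesgue_measure R).
Variables (H : R -> R) (B : R).
Hypotheses (sH : smooth H) (H0 : forall x, x <= 0 -> H x = 0)
  (H1 : forall x, 1 <= x -> H x = 1) (H01 : forall x, 0 <= H x <= 1)
  (B0 : 0 < B) (dHB : forall x, 0 <= derive1 H x <= B).
Local Notation h := (derive1 H).

Lemma step_derive0 x : ~~ (0 <= x <= 1) -> h x = 0.
Proof.
rewrite negb_and -!ltNge => /orP[x0|x1].
  have : is_derive x (1 : R) H 0.
    apply: (@near_eq_is_derive R R R (cst 0)); near=> y.
    by rewrite H0// ltW//; near: y; exact: lt_nbhsl.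
  by rewrite derive1E => -[_ ->].
have : is_derive x (1 : R) H 0.
  apply: (@near_eq_is_derive R R R (cst 1)); near=> y.
  by rewrite H1// ltW//; near: y; exact: lt_nbhsr.
by rewrite derive1E => -[_ ->].
Unshelve. all: by end_near. Qed.

Lemma step_affine_derive (k a x : R) :
  is_derive x (1 : R) (fun y => H (k * y + - (k * a))) (k * h (k * x + - (k * a))).
Proof. by apply: is_derive_affine; exact: smooth_is_derive. Qed.

(* An approximate identity concentrated on [a, a + 1/k]. *)
Definition kernel_at (k a x : R) := k * h (k * x + - (k * a)).

Lemma kernel_at_continuous k a : continuous (kernel_at k a).
Proof.
have -> : kernel_at k a =
    (fun x => k * h (k * x + - (k * a)) + 0 * h (k * x + - (k * a))).
  by apply/funext => x; rewrite mul0r addr0.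
apply: smooth_continuous.
by apply: smooth_lin; apply: smooth_affine; exact: smooth_derive1.
Qed.

Lemma kernel_at_bound k a x : 0 < k -> 0 <= kernel_at k a x <= k * B.
Proof.
move=> k0; have /andP[h0 hB] := dHB (k * x + - (k * a)).
by rewrite mulr_ge0 ?(ltW k0)//= ler_wpM2l// ltW.
Qed.

Lemma kernel_at_out (k a x : R) : 0 < k -> ~~ (a <= x <= a + k^-1) -> kernel_at k a x = 0.
Proof.
move=> k0 xa; rewrite /kernel_at step_derive0 ?mulr0//; apply: contra xa.
rewrite -mulrN -mulrDr => /andP[+].
rewrite pmulr_rge0// subr_ge0 => -> /=.
by rewrite -ler_pdivlMl// mulr1 lerBlDl.
Qed.

Lemma integral_kernel_at (k a : R) : 0 < k ->
  (\int[mu]_(x in `[a, (a + k^-1)%R]) (kernel_at k a x)%:E = 1)%E.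
Proof.
move=> k0; have ki0 : 0 < k^-1 by rewrite invr_gt0.
pose F x := H (k * x + - (k * a)).
have cF : continuous F.
  by apply: smooth_continuous; exact: smooth_affine.
rewrite (@continuous_FTC2 R _ F).
- rewrite /F subrr mulrDr mulfV ?gt_eqF// addrAC subrr add0r.
  by rewrite (H0 (lexx 0)) (H1 (lexx 1)) sube0.
- by rewrite ltrDl.
- by apply: continuous_subspaceT; exact: kernel_at_continuous.
- split.
  + by move=> x _; have [] := step_affine_derive k a x.
  + by apply: cvg_at_right_filter; exact: cF.
  + by apply: cvg_at_left_filter; exact: cF.
- move=> x _; rewrite derive1E; by have [_ ->] := step_affine_derive k a x.
Qed.

(** The kernel has integral 1 and height at most [k * B], so the error at [a] is at most [k * B]
    times the integral of [|u - u a|] over a small ball, that is [4 * B] times its average, which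
    tends to 0 at a Lebesgue point. *)
Lemma kernel_at_cvg (u : R -> R) (a : R) : locally_integrable setT u ->
  lebesgue_pt u a ->
  Rintegral mu setT (fun x => u x * kernel_at n.+1%:R a x) @[n --> \oo] --> u a.
Proof.
move=> [mu_ _ lu] lua.
have iu (x r : R) : mu.-integrable `[x, r] (EFin \o u).
  apply/integrableP; split; first by apply/measurable_EFinP; exact: measurable_funTS.
  by apply: lu => //; exact: segment_compact.
have k0 (n : nat) : 0 < n.+1%:R :> R by [].
(* Twice the width of the kernel, so that its closed support lies in the open ball; that ball has
   measure [4 / n.+1%:R], hence the factor 4. *)
pose r n : R := 2 / n.+1%:R.
have r0 n : 0 < r n by rewrite divr_gt0.
have bound n : (`|Rintegral mu setT (fun x => u x * kernel_at n.+1%:R a x) - u a|%:E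
    <= (4 * B)%:E * davg u a (r n))%E.
  set k : R := n.+1%:R.
  have ikx : mu.-integrable `[a, a + k^-1] (EFin \o kernel_at k a).
    apply: continuous_compact_integrable; first exact: segment_compact.
    by apply: continuous_subspaceT; exact: kernel_at_continuous.
  have mk : measurable_fun setT (kernel_at k a).
    by apply: continuous_measurable_fun; exact: kernel_at_continuous.
  have iuk : mu.-integrable `[a, a + k^-1] (EFin \o (fun x => u x * kernel_at k a x)).
    apply: (@integrableMl _ _ _ lebesgue_measure _ _ (EFin \o u)) => //.
    + exact: measurable_funTS.
    + exists (k * B); split; rewrite ?num_real// => z kz x _.
      have /andP[p q] := kernel_at_bound a x (k0 n).
      by rewrite /= ger0_norm// (le_trans q)// ltW.
  have -> : Rintegral mu setT (fun x => u x * kernel_at k a x) =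
      Rintegral mu `[a, a + k^-1] (fun x => u x * kernel_at k a x).
    rewrite [RHS]Rintegral_mkcond; apply: eq_Rintegral => x _.
    rewrite patchE; case: ifPn => //; rewrite notin_setE/= in_itv/= => /negP xa.
    by rewrite kernel_at_out// mulr0.
  have -> : u a = Rintegral mu `[a, a + k^-1] (fun x => u a * kernel_at k a x).
    rewrite RintegralZl//.
    by rewrite /Rintegral integral_kernel_at// mulr1.
  have iuak : mu.-integrable `[a, a + k^-1] (EFin \o (fun x => u a * kernel_at k a x)).
    have := @integrableZl _ _ _ lebesgue_measure _ (measurable_itv _) (u a) _ ikx.
    by apply: eq_integrable.
  rewrite -RintegralB//.
  have iD : mu.-integrable `[a, a + k^-1]
      (EFin \o (fun x => u x * kernel_at k a x - u a * kernel_at k a x)).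
    by apply: (@integrableB _ _ _ lebesgue_measure _ _ _ _ iuk iuak).
  rewrite EFin_normr_Rintegral//.
  apply: le_trans (le_abse_integral _ _ _) _ => //.
    by case/integrableP : iD.
  have muB : mu (ball a (r n)) = (4 / k)%:E.
    rewrite lebesgue_measure_ball ?ltW// /r -/k -mulr_natr; congr EFin; ring.
  have mball : measurable (ball a (r n)) by exact: measurable_ball.
  have mu1 : measurable_fun setT (fun x => `|(u x - u a)%:E|)%E.
    apply: measurableT_comp => //; apply/measurable_EFinP.
    exact: measurable_funB.
  apply: (@le_trans _ _ (\int[mu]_(x in ball a (r n)) ((k * B)%:E * `|(u x - u a)%:E|))%E).
    apply: (@le_trans _ _ (\int[mu]_(x in `[a, (a + k^-1)%R]) ((k * B)%:E * `|(u x - u a)%:E|))%E).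
      apply: ge0_le_integral => //.
      + by apply: measurableT_comp => //; case/integrableP : iD.
      + by apply: measurable_funTS; exact: measurable_funeM.
      + move=> x _; rewrite /= -mulrBl normrM mulrC lee_fin ler_wpM2r//.
        by have /andP[p q] := kernel_at_bound a x (k0 n); rewrite ger0_norm.
    apply: ge0_subset_integral => //.
    + by apply: measurable_funTS; exact: measurable_funeM.
    + by move=> x _; rewrite mule_ge0// lee_fin mulr_ge0// ltW.
    + move=> x /=; rewrite in_itv/= => /andP[ax xk].
      rewrite /ball/= distrC ger0_norm ?subr_ge0// ltrBlDl.
      by apply: le_lt_trans xk _; rewrite ltrD2l /r ltr_pMl ?invr_gt0// ltr1n.
  rewrite ge0_integralZl//; last 2 first.
  + exact: measurable_funTS.
  + by rewrite lee_fin mulr_ge0// ltW.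
  rewrite /davg /iavg muB inver gt_eqF ?divr_gt0// muleA -EFinM.
  have -> : 4 * B * (4 / k)^-1 = k * B by field; rewrite gt_eqF.
  exact: lexx.
have rc : r n @[n --> \oo] --> 0.
  rewrite -(mulr0 2); apply: cvgMr; exact: cvg_harmonic.
have dc : davg u a (r n) @[n --> \oo] --> 0%E.
  by apply: ((cvge_at_rightP (davg u a) 0 0).1 lua); split.
have dc' : ((4 * B)%:E * davg u a (r n))%E @[n --> \oo] --> 0%E.
  by rewrite -(mule0 (4 * B)%:E); apply: cvgeZl.
apply/cvgrPdist_lt => e e0.
near=> n; rewrite distrC -lte_fin.
apply: le_lt_trans (bound n) _.
near: n.
apply: (dc' [set y | (y < e%:E)%E]); apply: open_nbhs_nbhs; split => /=.
  exact: open_ereal_lt_ereal.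
by rewrite lte_fin.
Unshelve. all: by end_near. Qed.

(** Dominated convergence: the difference of two steepening steps tends pointwise to the indicator
    of []a, b]], half-open because the step vanishes at its left end. *)
Lemma step_difference_cvg (g : R -> R) (a b : R) : a < b ->
  (forall M, mu.-integrable `[- M, M] (EFin \o g)) -> measurable_fun setT g ->
  Rintegral mu setT (fun x => g x *
     (H (n.+1%:R * x + - (n.+1%:R * a)) - H (n.+1%:R * x + - (n.+1%:R * b))))
    @[n --> \oo] --> Rintegral mu `[a, b] g.
Proof.
move=> ab ig mg.
pose phi n x := H (n.+1%:R * x + - (n.+1%:R * a)) - H (n.+1%:R * x + - (n.+1%:R * b)).
(* The [+ 1] leaves room for the transition layer, whose width is at most 1. *)
pose M : R := `|a| + `|b| + 1.
have k0 (n : nat) : 0 < n.+1%:R :> R by [].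
have k1 (n : nat) : 1 <= n.+1%:R :> R by rewrite ler1n.
have Hle (k x c : R) : 0 < k -> x <= c -> H (k * x + - (k * c)) = 0.
  by move=> kp xc; rewrite H0// -mulrN -mulrDr pmulr_rle0// subr_le0.
have Hge (k x c : R) : 0 < k -> k^-1 <= x - c -> H (k * x + - (k * c)) = 1.
  by move=> kp xc; rewrite H1// -mulrN -mulrDr -ler_pdivrMl// mulr1.
have phi1 n x : `|phi n x| <= 1.
  have := H01 (n.+1%:R * x + - (n.+1%:R * a)).
  have := H01 (n.+1%:R * x + - (n.+1%:R * b)).
  by rewrite /phi ler_norml => /andP[? ?] /andP[? ?]; lra.
have phiM n x : M < `|x| -> phi n x = 0.
  move=> Mx; have [x0|x0] := leP x 0.
    rewrite ler0_norm// /M in Mx.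
    have := lerNnormlW (lexx `|a|); have := lerNnormlW (lexx `|b|).
    have := normr_ge0 a; have := normr_ge0 b => ? ? ? ?.
    by rewrite /phi !Hle ?subrr//; lra.
  rewrite gtr0_norm// /M in Mx.
  have ik : n.+1%:R^-1 <= 1 :> R by rewrite invf_le1.
  have := ler_norm a; have := ler_norm b; have := normr_ge0 a; have := normr_ge0 b.
  move=> ? ? ? ?.
  by rewrite /phi !Hge ?subrr//; apply: le_trans ik _; lra.
have mphi n : measurable_fun setT (phi n).
  have : smooth (fun x => 1 * H (n.+1%:R * x + - (n.+1%:R * a)) +
                 (-1) * H (n.+1%:R * x + - (n.+1%:R * b))).
    by apply: smooth_lin; exact: smooth_affine.
  move=> /smooth_continuous/continuous_measurable_fun.
  by congr measurable_fun; apply/funext => x; rewrite mul1r mulN1r.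
pose D := `[- M, M]%classic.
have iab : mu.-integrable `]a, b] (EFin \o g).
  apply: (integrableS _ _ _ (ig M)) => //; apply: subset_itv; rewrite bnd_simp /M.
    by have := lerNnormlW (lexx `|a|); have := normr_ge0 b; lra.
  by have := ler_norm b; have := normr_ge0 a; lra.
have -> : Rintegral mu `[a, b] g = fine (\int[mu]_x (g x * \1_(`]a, b]%classic) x)%:E).
  rewrite -[LHS](@Rintegral_itv_obnd_cbnd _ _ (BRight b))//.
  rewrite Rintegral_mkcond /Rintegral; congr fine; apply: eq_integral => x _.
  by rewrite patch_indic.
have igM : mu.-integrable setT ((abse \o (EFin \o g)) \_ D).
  apply: (proj1 (@integrable_mkcond _ _ R lebesgue_measure D _ (measurable_itv _))).
  by apply: integrable_abse; exact: ig.
apply: fine_cvg; rewrite fineK; last first.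
  move: iab => /(proj1 (@integrable_mkcond _ _ R lebesgue_measure _ _ (measurable_itv _))).
  move=> /(integrable_fin_num measurableT); congr (_ \is a fin_num).
  by apply: eq_integral => x _; rewrite restrict_EFin patch_indic.
have [||||_ _ //] := @dominated_convergence _ _ _ lebesgue_measure setT measurableT
   (fun n x => (g x * phi n x)%:E) (fun x => (g x * \1_(`]a, b]%classic) x)%:E)
   _ _ _ _ igM _.
- by move=> n; apply/measurable_EFinP; apply: measurable_funM => //; exact: mphi.
- by apply/measurable_EFinP; apply: measurable_funM => //; exact: measurable_indic.
- apply: aeW => x _; apply/cvg_EFin; first exact: nearW.
  apply: cvgMr.
  have small (c : R) : c < x -> \forall n \near \oo, n.+1%:R^-1 <= x - c.
    move=> cx; have xc : 0 < x - c by rewrite subr_gt0.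
    exists (Num.truncn (x - c)^-1) => // n /= nn.
    rewrite -[x - c]invrK lef_pV2 ?posrE ?invr_gt0//.
    by apply: le_trans (ltW (truncnS_gt _)) _; rewrite ler_nat.
  rewrite indicE; have [xa|ax] := leP x a.
    rewrite memNset /= ?in_itv/= ?ltNge ?xa//.
    by apply: cvg_near_cst; apply: nearW => n; rewrite /phi !Hle ?subrr//; lra.
  have [xb|bx] := leP x b.
    rewrite mem_set /= ?in_itv/= ?ax//.
    apply: cvg_near_cst; have := small _ ax; apply: filterS => n nx.
    by rewrite /phi (Hge _ _ a)// (Hle _ _ b)// subr0.
  rewrite memNset /= ?in_itv/= ?ax/= ?leNgt ?bx//.
  apply: cvg_near_cst; have := small _ bx; have := small _ ax.
  by apply: filterS2 => n n1 n2; rewrite /phi !Hge// subrr.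
- apply: aeW => x n _; rewrite patchE; case: ifPn => [_|].
    by rewrite abse_EFin /= lee_fin normrM ler_piMr.
  rewrite notin_setE /D/= in_itv/= => /negP xM; rewrite phiM ?mulr0//=.
    by rewrite normr0.
  by rewrite ltNge; apply: contra xM; rewrite ler_norml.
Qed.

End weak_ftc.

(** * The fundamental theorem of calculus for weak derivatives and the sup bound *)

Section sobolev.
Context {R : realType}.
Local Notation mu := (@lebesgue_measure R).
Variables (p : \bar R) (u g : R -> R).
Hypotheses (p1 : (1 <= p)%E) (ug : weak_derivative u g).
Hypotheses (uoo : (Lp_norm p u < +oo)%E) (goo : (Lp_norm p g < +oo)%E).
Let mu_ : measurable_fun setT u := let: conj h _ := ug in h.
Let mg : measurable_fun setT g := let: conj _ (conj h _) := ug in h.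

(** Test the weak derivative against the difference [phi n] of steps at [a] and [b]. Its derivative
    is a difference of approximate identities, so one side tends to [u b - u a] and the other to the
    integral of [g]. *)
Lemma weak_derivative_ftc (a b : R) : lebesgue_pt u a -> lebesgue_pt u b -> a < b ->
  u b - u a = Rintegral mu `[a, b] g.
Proof.
move=> ua ub ab.
have [H [sH H0 H1 H01 [B B0 dHB]]] := @ex_smooth_step R.
have lu := Lp_locally_integrable p1 mu_ uoo.
have ca := kernel_at_cvg sH H0 H1 B0 dHB lu ua.
have cb := kernel_at_cvg sH H0 H1 B0 dHB lu ub.
have cg := step_difference_cvg sH H0 H1 H01 ab (fun M => Lp_integrable_itv (- M) M p1 mg goo) mg.
have k0 (n : nat) : 0 < n.+1%:R :> R by [].
pose phi n x := H (n.+1%:R * x + - (n.+1%:R * a)) - H (n.+1%:R * x + - (n.+1%:R * b)).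
pose M : R := `|a| + `|b| + 1.
have ik n : n.+1%:R^-1 <= 1 :> R by rewrite invf_le1// ler1n.
have out n (c x : R) : `|c| <= `|a| + `|b| -> M < `|x| -> kernel_at H n.+1%:R c x = 0.
  move=> cab Mx; apply: (kernel_at_out H0 H1) => //.
  apply/negP => /andP[cx xc]; move: Mx; apply/negP; rewrite -leNgt.
  have := ik n; have := ler_norm c; have := lerNnormlW (lexx `|c|).
  have := normr_ge0 c; move: (n.+1%:R^-1) xc => r xc ? ? ? ?.
  by rewrite /M ler_norml; lra.
have abE : `|a| <= `|a| + `|b| /\ `|b| <= `|a| + `|b| by rewrite lerDl lerDr !normr_ge0.
have iuk n (c : R) : `|c| <= `|a| + `|b| ->
    mu.-integrable setT (EFin \o (fun x => u x * kernel_at H n.+1%:R c x)).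
  move=> cab; apply: (@Lp_integrableM _ p _ _ M (n.+1%:R * B)) => //.
  - by apply: continuous_measurable_fun; exact: (kernel_at_continuous sH).
  - move=> x; have /andP[h0 hB] := kernel_at_bound dHB c x (k0 n).
    by rewrite ger0_norm.
  - by move=> x; exact: out.
have dphi n x : is_derive x (1 : R) (phi n)
    (kernel_at H n.+1%:R a x - kernel_at H n.+1%:R b x).
  by apply: is_deriveB; apply: step_affine_derive.
have tphi n : test_function (phi n).
  split.
    have -> : phi n = (fun x => 1 * H (n.+1%:R * x + - (n.+1%:R * a)) +
                 (-1) * H (n.+1%:R * x + - (n.+1%:R * b))).
      by apply/funext => x; rewrite mul1r mulN1r.
    by apply: smooth_lin; exact: smooth_affine.
  exists M => x Mx; rewrite /phi.
  have := ik n; have := ler_norm a; have := ler_norm b; have := normr_ge0 a.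
  have := normr_ge0 b; have := lerNnormlW (lexx `|a|); have := lerNnormlW (lexx `|b|).
  have [x0|x0] := leP x 0.
    rewrite ler0_norm// /M in Mx => ? ? ? ? ? ? ?.
    by rewrite !H0 ?subrr// -mulrN -mulrDr pmulr_rle0// subr_le0; lra.
  rewrite gtr0_norm// /M in Mx => ? ? ? ? ? ? ki.
  by rewrite !H1 ?subrr// -mulrN -mulrDr -ler_pdivrMl// mulr1; apply: le_trans ki _; lra.
have eqn n : Rintegral mu setT (fun x => u x * kernel_at H n.+1%:R b x) -
    Rintegral mu setT (fun x => u x * kernel_at H n.+1%:R a x) =
    Rintegral mu setT (fun x => g x * phi n x).
  have [_ [_ /(_ _ (tphi n))]] := ug.
  rewrite (is_derive_derive1 (dphi n)).
  under eq_Rintegral do rewrite mulrBr.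
  rewrite RintegralB//; [|by apply: iuk; case: abE|by apply: iuk; case: abE].
  by move=> E; rewrite -[RHS]opprK -E opprB.
have c1 : (Rintegral mu setT (fun x => u x * kernel_at H n.+1%:R b x) -
    Rintegral mu setT (fun x => u x * kernel_at H n.+1%:R a x)) @[n --> \oo]
    --> u b - u a by exact: cvgB.
have c2 : (Rintegral mu setT (fun x => u x * kernel_at H n.+1%:R b x) -
    Rintegral mu setT (fun x => u x * kernel_at H n.+1%:R a x)) @[n --> \oo]
    --> Rintegral mu `[a, b] g.
  by under eq_cvg do rewrite eqn; exact: cg.
by rewrite -(cvg_lim _ c1)// -(cvg_lim _ c2).
Qed.

Lemma ae_lebesgue_pt : {ae mu, forall x, lebesgue_pt u x}.
Proof. by apply: lebesgue_differentiation; exact: Lp_locally_integrable p1 mu_ uoo. Qed.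

(** At a Lebesgue point [b], bound [|u b|] by [|u a|] plus the integral of [|g|] over [[b, b + 1]],
    then average over [a] in that interval; unit length makes both constants 1. *)
Lemma sobolev_bound : {ae mu, forall x, (`|u x|%:E <= Lp_norm p u + Lp_norm p g)%E}.
Proof.
apply: filterS ae_lebesgue_pt => b lb.
have muI : mu `[b, b + 1] = 1%E.
  by rewrite lebesgue_measure_itv/= lte_fin ltrDl ltr01 -EFinB [b + 1]addrC addrK.
have mau : measurable_fun setT (fun x => `|u x|%:E).
  by apply/measurable_EFinP; exact: measurableT_comp.
set G := (\int[mu]_(x in `[b, (b + 1)%R]) `|g x|%:E)%E.
have GLp : (G <= Lp_norm p g)%E by exact: integral_norm_le_Lp_norm.
have G0 : (0 <= G)%E by apply: integral_ge0 => x _.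
apply: (@le_trans _ _ (\int[mu]_(x in `[b, (b + 1)%R]) (`|u x|%:E + G))%E).
  rewrite -[leLHS]mule1 -muI -integral_cst//.
  apply: ae_ge0_le_integral => //.
  - by move=> x _ /=.
  - by move=> x _; exact: adde_ge0.
  - by apply: emeasurable_funD => //; exact: measurable_funTS.
  apply: filterS ae_lebesgue_pt => a la; rewrite /= in_itv/= => /andP[].
  rewrite le_eqVlt => /predU1P[<- _|ba ab1]; first by rewrite leeDl.
  have E := weak_derivative_ftc lb la ba.
  have -> : u b = u a - Rintegral mu `[b, a] g by rewrite -E; ring.
  apply: (@le_trans _ _ (`|u a| + `|Rintegral mu `[b, a] g|)%:E).
    by rewrite lee_fin ler_normB.
  rewrite EFinD leeD2l//.
  have ig := Lp_integrable_itv b a p1 mg goo.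
  rewrite EFin_normr_Rintegral//.
  apply: le_trans (le_abse_integral _ _ _) _ => //; first by case/integrableP : ig.
  apply: ge0_subset_integral => //.
  - by apply/measurable_EFinP/measurableT_comp => //; exact: measurable_funTS.
  - by move=> x /=; rewrite !in_itv/= => /andP[-> xa]/=; exact: le_trans xa _.
rewrite ge0_integralD//; last exact: measurable_funTS.
rewrite integral_cst//= muI mule1.
by rewrite leeD//; exact: integral_norm_le_Lp_norm.
Qed.

End sobolev.

(** * Local bounds for the nonlinearity *)

Section nonlinearity.
Context {R : realType}.
Implicit Types w : R -> R.

Lemma derivable_continuous (f : R -> R) : (forall x, derivable f x 1) -> continuous f.
Proof.
by move=> df x; apply: differentiable_continuous; apply/derivable1_diffP.
Qed.

Lemma C2_continuous w : C2_real w -> continuous w.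
Proof. by case=> dw _; exact: derivable_continuous. Qed.

Lemma C2_derive1_continuous w : C2_real w -> continuous (derive1 w).
Proof. by case=> _ [dw _]; exact: derivable_continuous. Qed.

Lemma continuous_bounded_itv (f : R -> R) (K : R) : continuous f ->
  exists2 C : R, 0 <= C & forall x, `|x| <= K -> `|f x| <= C.
Proof.
move=> cf; have : compact (f @` `[(- K), K]).
  by apply: continuous_compact; [exact: continuous_subspaceT|exact: segment_compact].
move=> /compact_bounded[C [_ HC]]; exists (`|C| + 1); first by rewrite addr_ge0.
move=> x xK; apply: HC; first by rewrite (le_lt_trans (ler_norm _))// ltrDl.
by exists x => //=; rewrite in_itv/= -ler_norml.
Qed.

Lemma lipschitz_itv (f : R -> R) (K C : R) : (forall x, derivable f x 1) ->
  (forall x, `|x| <= K -> `|derive1 f x| <= C) ->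
  forall x y, `|x| <= K -> `|y| <= K -> `|f x - f y| <= C * `|x - y|.
Proof.
move=> df fC x y.
wlog xy : x y / x <= y.
  move=> H xK yK; have [/H->//|/ltW/H] := leP x y.
  by rewrite distrC [`|x - y|]distrC; apply.
move=> xK yK; have cf := continuous_subspaceT (derivable_continuous df).
have [c + E] := @MVT_segment R f (derive1 f) x y xy (fun z _ => derivable_is_derive (df z)) (cf _).
rewrite in_itv/= => cxy; rewrite distrC E normrM [`|x - y|]distrC ler_wpM2r//.
by apply: fC; move: xK yK; rewrite !ler_norml; lra.
Qed.

Lemma C2_local_bounds w : C2_real w -> forall K : R, exists2 L : R, 0 <= L &
  [/\ forall x, `|x| <= K -> `|derive1 w x| <= L,
      forall x y, `|x| <= K -> `|y| <= K -> `|w x - w y| <= L * `|x - y| &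
      forall x y, `|x| <= K -> `|y| <= K ->
        `|derive1 w x - derive1 w y| <= L * `|x - y|].
Proof.
move=> Cw K; have [dw [dw1 cw2]] := Cw.
have [C1 C10 H1] := continuous_bounded_itv K (C2_derive1_continuous Cw).
have [C2 C20 H2] := continuous_bounded_itv K cw2.
exists (C1 + C2); first exact: addr_ge0.
split=> [x xK|x y xK yK|x y xK yK].
- by apply: le_trans (H1 x xK) _; rewrite lerDl.
- apply: le_trans (lipschitz_itv dw H1 xK yK) _.
  by rewrite ler_wpM2r// lerDl.
- apply: le_trans (lipschitz_itv dw1 H2 xK yK) _.
  by rewrite ler_wpM2r// lerDr.
Qed.

End nonlinearity.

(** * The chain rule for weak derivatives *)

Section chain_rule.
Context {R : realType}.
Local Notation mu := (@lebesgue_measure R).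

(** Continuous functions are dense in L^1 of a bounded interval, and an L^1 error on the derivative
    is a uniform error on the primitive. *)
Lemma primitive_approx (g : R -> R) (a b c0 eps : R) : a < b -> 0 < eps ->
  mu.-integrable `[a, b] (EFin \o g) ->
  exists F G : R -> R, [/\ continuous G,
    forall x, a <= x <= b -> is_derive x (1 : R) F (G x),
    (\int[mu]_(x in `[a, b]) `|(g x - G x)%:E| <= eps%:E)%E &
    forall x, a <= x <= b -> `|c0 + Rintegral mu `[a, x] g - F x| <= eps].
Proof.
move=> ab eps0 ig.
have muab : (mu `[a, b] < +oo)%E by rewrite lebesgue_measure_itv/=; case: ifP; rewrite ?ltry.
have [G_ [cG iG G0]] := approximation_continuous_integrable (measurable_itv _) muab ig.
have [n Gn] : exists n, (\int[mu]_(x in `[a, b]) `|(g x - G_ n x)%:E| <= eps%:E)%E.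
  have : \forall n \near \oo, (\int[mu]_(x in `[a, b]) `|(g x - G_ n x)%:E| < eps%:E)%E.
    apply: (G0 [set y | (y < eps%:E)%E]); apply: open_nbhs_nbhs; split => /=.
      exact: open_ereal_lt_ereal.
    by rewrite lte_fin.
  by move=> [n _ H]; exists n; apply/ltW/H => /=.
pose G := G_ n.
(* Starting at [a - 1] makes [a] an interior point, so that the derivative there is two-sided. *)
pose P x := Rintegral mu `[a - 1, x] G.
have iGs (x y : R) : mu.-integrable `[x, y] (EFin \o G).
  apply: continuous_compact_integrable; first exact: segment_compact.
  by apply: continuous_subspaceT; exact: cG.
have dP x : a <= x -> is_derive x (1 : R) P (G x).
  move=> ax; have [dP <-] := @continuous_FTC1_closed R G (a - 1) x (x + 1)
    (ltac:(by rewrite ltrDl)) (iGs _ _) (ltac:(lra)) (cG n x).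
  exact: derivable_is_derive.
exists (fun x => c0 + (P x - P a)), G; split=> //.
- exact: cG.
- move=> x /andP[/dP dPx _].
  have := is_deriveD (is_derive_cst c0 x (1 : R)) (is_deriveB dPx (is_derive_cst (P a) x (1 : R))).
  by rewrite add0r subr0.
- move=> x /andP[ax xb].
  have -> : P x - P a = Rintegral mu `[a, x] G.
    rewrite /P Rintegral_itvB//; last by rewrite bnd_simp; lra.
    apply: Rintegral_itv_obnd_cbnd.
    by apply: integrableS (iGs a x) => //; apply: subset_itvr; rewrite bnd_simp.
  have igx : mu.-integrable `[a, x] (EFin \o g).
    by apply: integrableS ig => //; apply: subset_itvl; rewrite bnd_simp.
  rewrite opprD addrACA subrr add0r -RintegralB//.
  have iD : mu.-integrable `[a, x] (EFin \o (fun x => g x - G x)).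
    by apply: (@integrableB _ _ _ lebesgue_measure _ _ _ _ igx (iGs a x)).
  rewrite -lee_fin EFin_normr_Rintegral//.
  apply: le_trans (le_abse_integral _ _ _) _ => //; first by case/integrableP : iD.
  apply: le_trans Gn; apply: ge0_subset_integral => //.
    apply: measurableT_comp => //.
    have : mu.-integrable `[a, b] (EFin \o (fun x => g x - G x)).
      by apply: (@integrableB _ _ _ lebesgue_measure _ _ _ _ ig (iGs a b)).
    by case/integrableP.
  by apply: subset_itvl; rewrite bnd_simp.
Qed.

Lemma continuous_bounded_integrable_itv (f : R -> R) (a b C : R) :
  measurable_fun setT f -> (forall x, `|f x| <= C) -> mu.-integrable `[a, b] (EFin \o f).
Proof.
move=> mf fC; apply: measurable_bounded_integrable => //.
- by rewrite /= lebesgue_measure_itv/=; case: ifP; rewrite ?ltry.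
- exact: measurable_funTS.
- exists C; split; rewrite ?num_real// => z Cz x _.
  by rewrite /= (le_trans (fC x))// ltW.
Qed.

(** If [f] were the C^1 function [F], the sum would be the integral of the derivative of
    [w (F x) * phi x], which vanishes at both ends. Passing from [F] to [f] costs a multiple of
    [eps], and [eps] is arbitrary. *)
Lemma chain_rule_itv (w f g phi : R -> R) (a b K B : R) : C2_real w -> a < b ->
  measurable_fun setT f -> measurable_fun setT g -> (forall x, `|f x| <= K) ->
  mu.-integrable `[a, b] (EFin \o g) ->
  {ae mu, forall x, a <= x <= b -> f x = f a + Rintegral mu `[a, x] g} ->
  smooth phi -> phi a = 0 -> phi b = 0 ->
  (forall x, `|phi x| <= B) -> (forall x, `|derive1 phi x| <= B) ->
  Rintegral mu `[a, b] (fun x => w (f x) * derive1 phi x) +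
  Rintegral mu `[a, b] (fun x => derive1 w (f x) * g x * phi x) = 0.
Proof.
move=> Cw ab mf mg fK ig fE sphi phia phib phiB dphiB.
have B0 : 0 <= B by exact: le_trans (phiB 0).
(* [F] stays within [eps <= 1] of [f] almost everywhere, so radius [K + 1] serves both. *)
have [L L0 [w1L wL w1lip]] := C2_local_bounds Cw (K + 1).
have cw := C2_continuous Cw; have cw1 := C2_derive1_continuous Cw.
have cphi := smooth_continuous sphi.
have cdphi := smooth_continuous (smooth_derive1 sphi).
have [mphi mdphi] : measurable_fun setT phi /\ measurable_fun setT (derive1 phi).
  by split; exact: continuous_measurable_fun.
have mwf : measurable_fun setT (fun x => w (f x)).
  by apply: (measurableT_comp _ mf); exact: continuous_measurable_fun.
have mw1f : measurable_fun setT (fun x => derive1 w (f x)).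
  by apply: (measurableT_comp _ mf); exact: continuous_measurable_fun.
have [C C0 wC] := continuous_bounded_itv (K + 1) cw.
have fK1 x : `|f x| <= K + 1 by rewrite (le_trans (fK x))// lerDl.
have i1 : mu.-integrable `[a, b] (EFin \o (fun x => w (f x) * derive1 phi x)).
  apply: (@continuous_bounded_integrable_itv _ _ _ (C * B)).
    exact: measurable_funM.
  by move=> x; rewrite normrM ler_pM//; exact: wC.
have i2 : mu.-integrable `[a, b] (EFin \o (fun x => derive1 w (f x) * g x * phi x)).
  have := @integrableMl _ _ _ lebesgue_measure _ (measurable_itv `[a, b]) (EFin \o g)
    (fun x => derive1 w (f x) * phi x) ig.
  move=> H; apply: eq_integrable (H _ _) => //.
  - by move=> x _ /=; rewrite -EFinM; congr EFin; ring.
  - by apply: measurable_funTS; exact: measurable_funM.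
  - exists (L * B); split; rewrite ?num_real// => z zLB x _ /=.
    by rewrite normrM (le_trans _ (ltW zLB))// ler_pM//; exact: w1L.
rewrite -RintegralD//.
pose Z x := w (f x) * derive1 phi x + derive1 w (f x) * g x * phi x.
rewrite -[X in X = _]/(Rintegral mu `[a, b] Z).
have iZ : mu.-integrable `[a, b] (EFin \o Z) by exact: (@integrableD _ _ _ lebesgue_measure _ _ _ _ i1 i2).
have ing : mu.-integrable `[a, b] (EFin \o (fun x => `|g x|)) by exact: integrable_norm.
pose Ig := Rintegral mu `[a, b] (fun x => `|g x|).
have Ig0 : 0 <= Ig by apply: Rintegral_ge0.
have muab : mu `[a, b] = (b - a)%:E by rewrite lebesgue_measure_itv/= lte_fin ab.
suff bnd (eps : R) : 0 < eps -> eps <= 1 ->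
    `|Rintegral mu `[a, b] Z| <= eps * (L * B * (b - a + Ig + 1)).
  apply/eqP; rewrite -normr_le0; apply/ler_addgt0Pr => e e0; rewrite add0r.
  pose S := L * B * (b - a + Ig + 1) + 1.
  have S0 : 0 < S.
    have ba0 : 0 <= b - a by rewrite subr_ge0 ltW.
    by rewrite /S ltr_wpDl// mulr_ge0 ?(mulr_ge0 L0 B0)// addr_ge0// addr_ge0.
  have e'0 : 0 < Num.min 1 (e / S) by rewrite lt_min ltr01 divr_gt0.
  apply: le_trans (bnd _ e'0 _) _; first by rewrite ge_min lexx.
  apply: (@le_trans _ _ (Num.min 1 (e / S) * S)).
    by apply: ler_wpM2l; [exact: ltW|rewrite lerDl].
  by rewrite -ler_pdivlMr// ge_min lexx orbT.
move=> eps0 eps1.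
have [F [G [cG dF gG FE]]] := primitive_approx (f a) ab eps0 ig.
pose Q x := w (F x) * phi x.
pose Zn x := w (F x) * derive1 phi x + derive1 w (F x) * G x * phi x.
have cF x : a <= x <= b -> {for x, continuous F}.
  move=> /dF dFx; apply: differentiable_continuous; apply/derivable1_diffP.
  by have [] := dFx.
have cwF x : a <= x <= b -> {for x, continuous (fun x => w (F x))}.
  by move=> /cF cFx; apply: (continuous_comp cFx); exact: cw.
have cw1F x : a <= x <= b -> {for x, continuous (fun x => derive1 w (F x))}.
  by move=> /cF cFx; apply: (continuous_comp cFx); exact: cw1.
have cZn : {within `[a, b], continuous Zn}.
  apply: continuous_in_subspaceT => x; rewrite inE/= in_itv/= => xab.
  apply: cvgD; apply: cvgM.
  - exact: cwF.
  - exact: cdphi.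
  - by apply: cvgM; [exact: cw1F|exact: cG].
  - exact: cphi.
have dQ x : a <= x <= b -> is_derive x (1 : R) Q (Zn x).
  move=> xab; have dFx := dF _ xab.
  have dwF := is_derive1_comp (derivable_is_derive (proj1 Cw (F x))) dFx.
  apply: (is_derive_eq (is_deriveM dwF (smooth_is_derive x sphi))).
  by rewrite /Zn /GRing.scale /=; ring.
have cQ x : a <= x <= b -> {for x, continuous Q}.
  move=> /dQ dQx; apply: differentiable_continuous; apply/derivable1_diffP.
  by have [] := dQx.
have iZn : mu.-integrable `[a, b] (EFin \o Zn).
  by apply: continuous_compact_integrable => //; exact: segment_compact.
have Zn0 : Rintegral mu `[a, b] Zn = 0.
  rewrite /Rintegral (@continuous_FTC2 R _ Q)//.
  - by rewrite /Q phia phib !mulr0 subee.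
  - split.
    + move=> x; rewrite in_itv/= => /andP[/ltW ax /ltW xb].
      by have [] := dQ x; rewrite ?ax.
    + by apply: cvg_at_right_filter; apply: cQ; rewrite lexx ltW.
    + by apply: cvg_at_left_filter; apply: cQ; rewrite lexx ltW.
  - move=> x; rewrite in_itv/= => /andP[/ltW ax /ltW xb].
    by rewrite derive1E; have [|_ ->] := dQ x; rewrite ?ax.
have -> : Rintegral mu `[a, b] Z = Rintegral mu `[a, b] (fun x => Z x - Zn x).
  by rewrite RintegralB// Zn0 subr0.
have iD : mu.-integrable `[a, b] (EFin \o (fun x => Z x - Zn x)).
  exact: (@integrableB _ _ _ lebesgue_measure _ _ _ _ iZ iZn).
have iGi : mu.-integrable `[a, b] (EFin \o G).
  apply: continuous_compact_integrable; first exact: segment_compact.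
  by apply: continuous_subspaceT; exact: cG.
have igG : mu.-integrable `[a, b] (EFin \o (fun x => g x - G x)).
  exact: (@integrableB _ _ _ lebesgue_measure _ _ _ _ ig iGi).
rewrite -lee_fin EFin_normr_Rintegral//.
apply: le_trans (le_abse_integral _ _ _) _ => //; first by case/integrableP : iD.
have mag : measurable_fun `[a, b] (fun x => `|g x|%:E).
  by apply/measurable_EFinP; apply: measurable_funTS; exact: measurableT_comp.
have magG : measurable_fun `[a, b] (fun x => `|(g x - G x)%:E|)%E.
  by apply: measurableT_comp => //; case/integrableP : igG.
have LB0 : 0 <= L * B by rewrite mulr_ge0.
have eLB0 : 0 <= eps * (L * B) by rewrite mulr_ge0// ltW.
apply: (@le_trans _ _ (\int[mu]_(x in `[a, b]) ((eps * (L * B))%:E +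
    ((eps * (L * B))%:E * `|g x|%:E + (L * B)%:E * `|(g x - G x)%:E|)))%E).
  apply: ae_ge0_le_integral => //.
  - by apply: measurableT_comp => //; case/integrableP : iD.
  - move=> x _; rewrite !adde_ge0// ?mule_ge0// lee_fin//.
  - apply: emeasurable_funD => //; apply: emeasurable_funD; exact: measurable_funeM.
  apply: filterS fE => x fxE; rewrite /= in_itv/= => xab.
  have fF : `|f x - F x| <= eps by rewrite fxE//; exact: FE.
  have FK : `|F x| <= K + 1.
    have := fK x; move: fF; rewrite !ler_norml; lra.
  (* Replace [f] by [F] in [w], then in its derivative, then [g] by [G]. The first two errors carry
     a factor [eps] pointwise (the second also [|g|]); the last is small only in L^1. *)
  have e1 : Z x - Zn x = (w (f x) - w (F x)) * derive1 phi x +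
     (derive1 w (f x) - derive1 w (F x)) * g x * phi x +
     derive1 w (F x) * (g x - G x) * phi x by rewrite /Z /Zn; ring.
  rewrite -!EFinM -!EFinD lee_fin e1.
  have h1 : `|w (f x) - w (F x)| <= L * eps.
    by apply: le_trans (wL _ _ (fK1 x) FK) _; rewrite ler_wpM2l.
  have h2 : `|derive1 w (f x) - derive1 w (F x)| <= L * eps.
    by apply: le_trans (w1lip _ _ (fK1 x) FK) _; rewrite ler_wpM2l.
  apply: le_trans (ler_normD _ _) _; rewrite addrA; apply: lerD.
    apply: le_trans (ler_normD _ _) _; apply: lerD.
      by rewrite normrM mulrA [eps * L]mulrC ler_pM.
    rewrite !normrM mulrAC ler_wpM2r//.
    by rewrite mulrA [eps * L]mulrC ler_pM.
  by rewrite !normrM mulrAC ler_wpM2r// ler_pM// w1L.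
rewrite ge0_integralD//; last 2 first.
- by move=> x _; rewrite adde_ge0// mule_ge0.
- by apply: emeasurable_funD; exact: measurable_funeM.
rewrite integral_cst// ge0_integralD//;
  try exact: measurable_funeM; try by move=> x _; rewrite mule_ge0.
rewrite !ge0_integralZl//= muab.
have -> : (\int[mu]_(x in `[a, b]) `|g x|%:E = Ig%:E)%E.
  by rewrite /Ig /Rintegral fineK//; apply: integrable_fin_num.
apply: (@le_trans _ _ ((eps * (L * B))%:E * (b - a)%:E +
   ((eps * (L * B))%:E * Ig%:E + (L * B)%:E * eps%:E))%E).
  by rewrite leeD2l// leeD2l// lee_wpmul2l.
by rewrite -!EFinM -!EFinD lee_fin le_eqVlt; apply/orP; left; apply/eqP; ring.
Qed.
End chain_rule.

Section weak_chain_rule.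
Context {R : realType}.
Local Notation mu := (@lebesgue_measure R).

Lemma ae_exists_itv (P : R -> Prop) (a b : R) : a < b ->
  {ae mu, forall x, P x} -> exists2 x, a < x < b & P x.
Proof.
move=> ab [N [mN N0 PN]]; apply: contrapT => nP.
have : `]a, b[ `<=` N.
  move=> x; rewrite /= in_itv/= => xab; apply: PN => /= Px.
  by apply: nP; exists x.
move=> /(@le_measure _ _ _ lebesgue_measure).
rewrite !inE => /(_ (measurable_itv _) mN); rewrite [X in (_ <= X)%E]N0.
by rewrite /= lebesgue_measure_itv/= lte_fin ab -EFinB lee_fin subr_le0 leNgt ab.
Qed.

Lemma Rintegral_supp (f : R -> R) (a b : R) :
  (forall x, ~~ (a <= x <= b) -> f x = 0) ->
  Rintegral mu setT f = Rintegral mu `[a, b] f.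
Proof.
move=> f0; rewrite [RHS]Rintegral_mkcond; apply: eq_Rintegral => x _.
rewrite patchE; case: ifPn => //; rewrite notin_setE/= in_itv/= => /negP.
exact: f0.
Qed.

Lemma weak_derivative_comp p (w f g : R -> R) (K : R) : (1 <= p)%E -> C2_real w ->
  weak_derivative f g -> (Lp_norm p f < +oo)%E -> (Lp_norm p g < +oo)%E ->
  (forall x, `|f x| <= K) ->
  weak_derivative (fun x => w (f x)) (fun x => derive1 w (f x) * g x).
Proof.
move=> p1 Cw fg foo goo fK; have [mf [mg _]] := fg.
have cw := C2_continuous Cw; have cw1 := C2_derive1_continuous Cw.
split; first by apply: (measurableT_comp _ mf); exact: continuous_measurable_fun.
split.
  apply: measurable_funM => //.
  by apply: (measurableT_comp _ mf); exact: continuous_measurable_fun.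
move=> phi tphi; have [M [B [cphi cdphi phiB dphiB phi0]]] := test_function_bounds tphi.
(* The left end lies outside the support of [phi] and is taken to be a Lebesgue point, so that [f]
   is a primitive of [g] based at [a]. *)
have [a a1 la] := ae_exists_itv (ltac:(lra) : - `|M| - 1 < - `|M|) (ae_lebesgue_pt p1 fg foo).
pose b := `|M| + 1.
have M0 := normr_ge0 M.
have ab : a < b by rewrite /b; lra.
have out x : ~~ (a <= x <= b) -> phi x = 0 /\ derive1 phi x = 0.
  move=> xab; apply: phi0; rewrite ltNge; apply: contra xab.
  by have := ler_norm M; rewrite ler_norml /b; lra.
have pa : phi a = 0 by apply: (proj1 (phi0 a _)); have := ler_norm M; rewrite [`|a|]ltr0_norm; lra.
have pb : phi b = 0.
  by apply: (proj1 (phi0 b _)); have := ler_norm M; rewrite [`|b|]ger0_norm /b; lra.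
rewrite (@Rintegral_supp _ a b); last by move=> x /out[_ ->]; rewrite mulr0.
rewrite [in RHS](@Rintegral_supp _ a b); last by move=> x /out[-> _]; rewrite mulr0.
apply/eqP; rewrite -addr_eq0; apply/eqP.
apply: (chain_rule_itv Cw ab mf mg fK) => //.
- exact: Lp_integrable_itv p1 mg goo.
- apply: filterS (ae_lebesgue_pt p1 fg foo) => x lx /andP[].
  rewrite le_eqVlt => /predU1P[<- _|ax _]; first by rewrite set_itv1 Rintegral_set1 addr0.
  by rewrite -(weak_derivative_ftc p1 fg foo goo la lx ax) subrKC.
- exact: test_function_smooth.
Qed.

End weak_chain_rule.

(** * Translates and linear combinations of weak derivatives *)

Section weak_derivative_algebra.
Context {R : realType}.
Local Notation mu := (@lebesgue_measure R).

Lemma Rintegral_translate (f : R -> R) (z : R) : measurable_fun setT f ->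
  Rintegral mu setT (fun x => f (x + z)) = Rintegral mu setT f.
Proof.
move=> mf; have mEf : measurable_fun setT (EFin \o f) by exact/measurable_EFinP.
rewrite /Rintegral; congr fine; rewrite integralE [RHS]integralE; congr (_ - _)%E.
  rewrite -(@integral_translate _ ((EFin \o f)^\+)%E z)//.
    by apply: eq_integral => x _; rewrite !funeposE.
  exact: measurable_funepos.
rewrite -(@integral_translate _ ((EFin \o f)^\-)%E z)//.
  by apply: eq_integral => x _; rewrite !funenegE.
exact: measurable_funeneg.
Qed.

(** Tonelli for the positive and negative parts separately, so that slices with infinite integral
    are covered too. *)
Lemma measurable_Rintegral (F : R * R -> R) : measurable_fun setT F ->
  measurable_fun setT (fun x => Rintegral mu setT (fun z => F (z, x))).
Proof.
move=> mF; have mEF : measurable_fun setT (EFin \o F) by exact/measurable_EFinP.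
apply: (measurableT_comp (fine_measurable measurableT)).
rewrite (_ : (fun x => _) = (fun x => \int[mu]_z ((EFin \o F)^\+ (z, x)) -
    \int[mu]_z ((EFin \o F)^\- (z, x)))%E); last first.
  apply/funext => x; rewrite integralE; congr (_ - _)%E.
    by apply: eq_integral => z _; rewrite !funeposE.
  by apply: eq_integral => z _; rewrite !funenegE.
apply: emeasurable_funB.
  apply: (@measurable_fun_fubini_tonelli_G _ _ _ _ R lebesgue_measure ((EFin \o F)^\+)%E) => //.
  exact: measurable_funepos.
apply: (@measurable_fun_fubini_tonelli_G _ _ _ _ R lebesgue_measure ((EFin \o F)^\-)%E) => //.
exact: measurable_funeneg.
Qed.

Lemma measurable_shift (f : R -> R) (z : R) : measurable_fun setT f ->
  measurable_fun setT (fun x : R => f (x + z)).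
Proof. by move=> mf; apply: (measurableT_comp mf); exact: measurable_translate. Qed.

Lemma measurable_shift2 (f : R -> R) : measurable_fun setT f ->
  measurable_fun setT (fun zx : R * R => f (zx.2 + zx.1)).
Proof. by move=> mf; apply: (measurableT_comp mf); exact: measurable_funD. Qed.

Lemma Lp_norm_translate p (f : R -> R) (z : R) : (1 <= p)%E -> measurable_fun setT f ->
  (Lp_norm p (fun x => f (x + z)%R) <= Lp_norm p f)%E.
Proof.
move=> p1 mf; case: p p1 => [r r1|_|//]; last first.
  apply/Lp_normy_le; apply: (@ae_translate _ (fun x => (`|f x|%:E <= Lp_norm +oo f)%E)).
  exact/Lp_normy_le.
have r0 : 0 < r by rewrite lee_fin in r1; exact: lt_le_trans r1.
have := Lp_norm_ge0 r%:E f; case E : (Lp_norm r%:E f) => [C||]// C0; last by rewrite leey.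
rewrite lee_fin in C0; apply/Lp_norm_fin_le => //.
rewrite (@integral_translate _ (fun x => (`|f x| `^ r)%:E))//.
- by apply/Lp_norm_fin_le => //; rewrite E.
- exact: measurable_normr_powR.
Qed.

Lemma weak_derivative_translate (u g : R -> R) (z : R) :
  weak_derivative u g -> weak_derivative (fun x => u (x + z)) (fun x => g (x + z)).
Proof.
move=> [mu_ [mg ug]]; split; first exact: measurable_shift.
split; first exact: measurable_shift.
move=> phi tphi; have [M [B [cphi cdphi _ _ _]]] := test_function_bounds tphi.
pose psi x := phi (1 * x + - z).
have psiE x : psi (x + z) = phi x by rewrite /psi mul1r addrK.
have dpsi x : derive1 psi x = derive1 phi (1 * x + - z).
  rewrite derive1E; have sphi := test_function_smooth tphi.
  have [_ ->] := is_derive_affine (smooth_is_derive (1 * x + - z) sphi).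
  exact: mul1r.
have dpsiE x : derive1 psi (x + z) = derive1 phi x by rewrite dpsi mul1r addrK.
have tpsi : test_function psi.
  have [sphi [M' HM]] := tphi; split; first exact: smooth_affine.
  exists (M' + `|z|) => x Mx; apply: HM; rewrite mul1r.
  by rewrite -ltrBrDr in Mx; apply: lt_le_trans Mx _; exact: lerB_dist.
have spsi := test_function_smooth tpsi.
have [mpsi mdpsi] : measurable_fun setT psi /\ measurable_fun setT (derive1 psi).
  split; apply: continuous_measurable_fun; apply: smooth_continuous; first exact: spsi.
  exact: smooth_derive1.
under eq_Rintegral do rewrite -dpsiE.
under [in RHS]eq_Rintegral do rewrite -psiE.
rewrite (@Rintegral_translate (fun x => u x * derive1 psi x)); last exact: measurable_funM.
rewrite (@Rintegral_translate (fun x => g x * psi x)); last exact: measurable_funM.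
exact: ug.
Qed.

(** Finite norms make every pairing with a test function integrable, which the additivity of
    [Rintegral] relies on. *)
Lemma weak_derivative_lin p (a b : R) (u g v h : R -> R) : (1 <= p)%E ->
  weak_derivative u g -> weak_derivative v h ->
  (Lp_norm p u < +oo)%E -> (Lp_norm p g < +oo)%E ->
  (Lp_norm p v < +oo)%E -> (Lp_norm p h < +oo)%E ->
  weak_derivative (fun x => a * u x + b * v x) (fun x => a * g x + b * h x).
Proof.
move=> p1 [mu_ [mg ug]] [mv [mh vh]] uoo goo voo hoo.
split; first by apply: measurable_funD; exact: measurable_funM.
split; first by apply: measurable_funD; exact: measurable_funM.
move=> phi tphi; have [M [B [cphi cdphi phiB dphiB phi0]]] := test_function_bounds tphi.
have [mphi mdphi] : measurable_fun setT phi /\ measurable_fun setT (derive1 phi).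
  by split; exact: continuous_measurable_fun.
have split2 (f1 f2 psi : R -> R) :
    mu.-integrable setT (EFin \o (fun x => f1 x * psi x)) ->
    mu.-integrable setT (EFin \o (fun x => f2 x * psi x)) ->
    Rintegral mu setT (fun x => (a * f1 x + b * f2 x) * psi x) =
    a * Rintegral mu setT (fun x => f1 x * psi x) +
    b * Rintegral mu setT (fun x => f2 x * psi x).
  move=> i1 i2; under eq_Rintegral do rewrite mulrDl -!mulrA.
  rewrite RintegralD//; first by rewrite !RintegralZl.
  - exact: (@integrableZl _ _ _ lebesgue_measure _ measurableT a _ i1).
  - exact: (@integrableZl _ _ _ lebesgue_measure _ measurableT b _ i2).
have i f : measurable_fun setT f -> (Lp_norm p f < +oo)%E ->
    mu.-integrable setT (EFin \o (fun x => f x * phi x)).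
  by move=> mf foo; apply: (Lp_integrableM p1 mf foo mphi phiB) => x /phi0[].
have i' f : measurable_fun setT f -> (Lp_norm p f < +oo)%E ->
    mu.-integrable setT (EFin \o (fun x => f x * derive1 phi x)).
  by move=> mf foo; apply: (Lp_integrableM p1 mf foo mdphi dphiB) => x /phi0[].
rewrite split2; [|exact: i'|exact: i']; rewrite split2; [|exact: i|exact: i].
by rewrite ug// vh//; ring.
Qed.

Lemma weak_derivative_ae (u v g : R -> R) : measurable_fun setT v ->
  ae_eq mu setT u v -> weak_derivative u g -> weak_derivative v g.
Proof.
move=> mv uv [mu_ [mg ug]]; split=> //; split=> // phi tphi; rewrite -ug//.
have [M [B [_ cdphi _ _ _]]] := test_function_bounds tphi.
have mdphi : measurable_fun setT (derive1 phi) by exact: continuous_measurable_fun.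
rewrite /Rintegral; congr fine; apply: ae_eq_integral => //.
- by apply/measurable_EFinP; exact: measurable_funM.
- by apply/measurable_EFinP; exact: measurable_funM.
- by apply: filterS uv => x uvx _; rewrite uvx.
Qed.

End weak_derivative_algebra.

(** * Superpositions weighted by an integrable kernel *)

Section superposition.
Context {R : realType}.
Local Notation mu := (@lebesgue_measure R).
Variable al : R -> R.
Hypothesis ial : mu.-integrable setT (EFin \o al).

Lemma kernel_measurable : measurable_fun setT al.
Proof. by case/integrableP : ial => /measurable_EFinP. Qed.
Let mal := kernel_measurable.

Definition kernel_mass : R := fine (\int[mu]_x `|al x|%:E).

Lemma kernel_massE : (\int[mu]_x `|al x|%:E = kernel_mass%:E)%E.
Proof.
rewrite /kernel_mass fineK// ge0_fin_numE; first by case/integrableP : ial.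
by apply: integral_ge0 => x _; rewrite lee_fin.
Qed.

Lemma kernel_mass_ge0 : 0 <= kernel_mass.
Proof. by rewrite -lee_fin -kernel_massE; apply: integral_ge0 => x _; rewrite lee_fin. Qed.

Section swap.
Variables (F : R * R -> R) (phi : R -> R) (k : R).
Hypotheses (mF : measurable_fun setT F) (mphi : measurable_fun setT phi).
Hypothesis Fk : forall z, (\int[mu]_x `|(F (z, x) * phi x)%:E| <= k%:E)%E.

Let mFz z : measurable_fun setT (fun x => F (z, x)).
Proof. exact: measurableT_comp. Qed.
Let k0 : 0 <= k.
Proof. by rewrite -lee_fin; apply: le_trans (Fk 0); apply: integral_ge0 => x _. Qed.

Lemma superposition_slice_integrable z :
  mu.-integrable setT (EFin \o (fun x => F (z, x) * phi x)).
Proof.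
apply/integrableP; split; last by apply: le_lt_trans (Fk z) _; rewrite ltry.
by apply/measurable_EFinP; apply: measurable_funM => //; exact: mFz.
Qed.

Let h (zx : R * R) : \bar R := (al zx.1 * (F zx * phi zx.2))%:E.

Let mh : measurable_fun setT h.
Proof.
apply/measurable_EFinP; apply: measurable_funM; first exact: (measurableT_comp mal).
by apply: measurable_funM => //; exact: (measurableT_comp mphi).
Qed.

Let slice z : (\int[mu]_x h (z, x) =
  (al z * Rintegral mu setT (fun x => F (z, x) * phi x))%:E)%E.
Proof.
have iz := superposition_slice_integrable z.
rewrite /h/=; under eq_integral do rewrite EFinM.
rewrite integralZl// [RHS]EFinM; congr (_ * _)%E.
by rewrite /Rintegral fineK//; exact: (integrable_fin_num _ iz).
Qed.

Let ih : (mu \x mu)%E.-integrable setT h.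
Proof.
apply/(@integrable12ltyP _ _ _ _ _ lebesgue_measure lebesgue_measure) => //.
apply: (@le_lt_trans _ _ (\int[mu]_z (`|al z|%:E * k%:E))%E).
  apply: ge0_le_integral => //.
  - by move=> z _; exact: integral_ge0.
  - apply: (@measurable_fun_fubini_tonelli_F _ _ _ _ R lebesgue_measure (abse \o h)).
      exact: measurableT_comp.
    by move=> zx; rewrite lee_fin.
  - by apply/measurable_EFinP; apply: measurable_funM => //; exact: measurableT_comp.
  move=> z _; rewrite /h/=.
  under eq_integral do rewrite normrM EFinM.
  rewrite ge0_integralZl//; last first.
    apply/measurable_EFinP; apply: measurableT_comp => //.
    by apply: measurable_funM => //; exact: mFz.
  by rewrite lee_wpmul2l//; exact: Fk.
rewrite ge0_integralZr//; last by apply/measurable_EFinP; exact: measurableT_comp.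
by rewrite kernel_massE -EFinM ltry.
Qed.

(** Fubini for [h (z, x) = al z * F (z, x) * phi x], integrable on the plane because [Fk] bounds the
    integral in [x] uniformly in [z] and [al] is integrable. *)
Lemma superposition_swap :
  Rintegral mu setT (fun x => Rintegral mu setT (fun z => al z * F (z, x)) * phi x) =
  Rintegral mu setT (fun z => al z * Rintegral mu setT (fun x => F (z, x) * phi x)).
Proof.
rewrite /Rintegral; congr fine.
transitivity (\int[mu]_z \int[mu]_x h (z, x))%E; last first.
  by apply: eq_integral => z _; exact: slice.
rewrite (@Fubini _ _ _ _ _ lebesgue_measure lebesgue_measure h ih).
apply: ae_eq_integral => //.
- apply/measurable_EFinP; apply: measurable_funM => //.
  apply: (@measurable_Rintegral _ (fun zx => al zx.1 * F zx)).
  by apply: measurable_funM => //; exact: (measurableT_comp mal).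
- exact: (measurable_fubini_G ih).
have := @ae_integrable2 _ _ _ _ _ lebesgue_measure lebesgue_measure h ih.
apply: filterS => x ix _; rewrite /h/=.
(* Fubini makes the slice integrable only with the factor [phi x]; it can be divided out where
   nonzero, and both sides vanish elsewhere. *)
have [phix0|phix0] := eqVneq (phi x) 0.
  rewrite phix0 mulr0; under eq_integral do rewrite !mulr0.
  by rewrite integral0.
have iF : mu.-integrable setT (EFin \o (fun z => al z * F (z, x))).
  have := @integrableZl _ _ _ lebesgue_measure _ measurableT (phi x)^-1 _ ix.
  apply: eq_integrable => // z _ /=; rewrite -EFinM; congr EFin.
  by rewrite /=; field.
rewrite [RHS](_ : _ = \int[mu]_z ((al z * F (z, x))%:E * (phi x)%:E))%E; last first.
  by apply: eq_integral => z _; rewrite mulrA EFinM.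
rewrite integralZr// EFinM; congr (_ * _)%E.
by rewrite /Rintegral fineK//; exact: (integrable_fin_num _ iF).
Qed.

Lemma superposition_integrable :
  mu.-integrable setT (EFin \o (fun z => al z * Rintegral mu setT (fun x => F (z, x) * phi x))).
Proof.
have := @integrable_fubini_F _ _ _ _ _ lebesgue_measure lebesgue_measure h ih.
by apply: eq_integrable => // z _ /=; exact: slice.
Qed.

End swap.

Lemma Lp_norm_superposition p (F : R * R -> R) (C : R) : (1 <= p)%E -> 0 <= C ->
  measurable_fun setT F -> (forall z, Lp_norm p (fun x => F (z, x)) <= C%:E)%E ->
  (Lp_norm p (fun x => Rintegral mu setT (fun z => al z * F (z, x))%R)
    <= (kernel_mass * C)%:E)%E.
Proof.
move=> p1 C0 mF FC.
have maF : measurable_fun setT (fun zx : R * R => al zx.1 * F zx).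
  by apply: measurable_funM => //; exact: (measurableT_comp mal).
apply: (@Lp_norm_integral _ p al _ (fun zx => `|F zx|)) => //.
- by rewrite kernel_massE.
- exact: measurableT_comp.
- move=> z; apply: le_trans (FC z); apply: Lp_norm_le => //.
  + by apply: measurableT_comp => //; exact: (measurableT_comp mF).
  + exact: (measurableT_comp mF).
  + by apply: aeW => x; rewrite normr_id.
- exact: (@measurable_Rintegral _ (fun zx => al zx.1 * F zx)).
- move=> x; have mx : measurable_fun setT (fun z => (al z * F (z, x))%:E).
    by apply/measurable_EFinP; apply: measurable_funM => //; exact: (measurableT_comp mF).
  have := @le_abse_integral _ _ _ lebesgue_measure setT _ measurableT mx.
  under [in X in _ -> (_ <= X)%E]eq_integral do rewrite -normrM.
  apply: le_trans; rewrite /Rintegral.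
  (* [fine] sends infinite values to 0, so the inequality persists where the integral diverges. *)
  by case: (\int[mu]_z _)%E => [r||]/=; rewrite ?normr0 ?leey.
Qed.

(** Differentiation under the integral sign in weak form: exchange the integrals, use the weak
    identity for each [z], and exchange back. *)
Lemma weak_derivative_superposition p (F G : R * R -> R) (C : R) : (1 <= p)%E -> 0 <= C ->
  measurable_fun setT F -> measurable_fun setT G ->
  (forall z, Lp_norm p (fun x => F (z, x)) <= C%:E)%E ->
  (forall z, Lp_norm p (fun x => G (z, x)) <= C%:E)%E ->
  (forall z, weak_derivative (fun x => F (z, x)) (fun x => G (z, x))) ->
  weak_derivative (fun x => Rintegral mu setT (fun z => al z * F (z, x)))
                  (fun x => Rintegral mu setT (fun z => al z * G (z, x))).
Proof.
move=> p1 C0 mF mG FC GC FG.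
have meas (E : R * R -> R) : measurable_fun setT E ->
    measurable_fun setT (fun x => Rintegral mu setT (fun z => al z * E (z, x))).
  move=> mE; apply: (@measurable_Rintegral _ (fun zx => al zx.1 * E zx)).
  by apply: measurable_funM => //; exact: (measurableT_comp mal).
split; first exact: meas.
split; first exact: meas.
move=> phi tphi; have [M [B [cphi cdphi phiB dphiB phi0]]] := test_function_bounds tphi.
have [mphi mdphi] : measurable_fun setT phi /\ measurable_fun setT (derive1 phi).
  by split; exact: continuous_measurable_fun.
have [k1 k10 H1] := integral_norm_mul_le_Lp_norm p1 mdphi dphiB (fun x Mx => proj2 (phi0 x Mx)).
have [k2 k20 H2] := integral_norm_mul_le_Lp_norm p1 mphi phiB (fun x Mx => proj1 (phi0 x Mx)).
have Fk z : (\int[mu]_x `|(F (z, x) * derive1 phi x)%:E| <= (k1 * C)%:E)%E.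
  apply: le_trans (H1 _ _) _; first exact: (measurableT_comp mF).
  by rewrite EFinM lee_wpmul2l.
have Gk z : (\int[mu]_x `|(G (z, x) * phi x)%:E| <= (k2 * C)%:E)%E.
  apply: le_trans (H2 _ _) _; first exact: (measurableT_comp mG).
  by rewrite EFinM lee_wpmul2l.
rewrite (superposition_swap mF mdphi Fk) (superposition_swap mG mphi Gk).
rewrite -mulN1r -RintegralZl//; last exact: (superposition_integrable mG mphi Gk).
apply: eq_Rintegral => z _; have [_ [_ ->]] := FG z; last by [].
by rewrite mulN1r mulrN.
Qed.

End superposition.

(** * The nonlocal operator on bounded functions *)

Section nonlocal_operator.
Context {R : realType}.
Local Notation mu := (@lebesgue_measure R).
Variables (p : \bar R) (al w : R -> R).
Hypotheses (p1 : (1 <= p)%E) (ial : mu.-integrable setT (EFin \o al)).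
Hypotheses (Cw : C2_real w) (w0 : w 0 = 0).
Let mal := kernel_measurable ial.
Let cw := C2_continuous Cw.
Let cw1 := C2_derive1_continuous Cw.
Let mw : measurable_fun setT w := continuous_measurable_fun cw.
Let mw1 : measurable_fun setT (derive1 w) := continuous_measurable_fun cw1.

Lemma nl_opE (u : R -> R) x : measurable_fun setT u ->
  nl_op al w u x = Rintegral mu setT (fun z => al z * w (u (x + z) - u x)).
Proof.
move=> mu_; rewrite /nl_op.
rewrite -(@Rintegral_translate _ (fun y => al (y - x) * w (u y - u x)) x).
  by apply: eq_Rintegral => z _; rewrite addrK [z + x]addrC.
apply: measurable_funM; first exact: measurable_shift.
by apply: (measurableT_comp mw); exact: measurable_funB.
Qed.

(** Allows a function to be replaced by a version that is bounded everywhere. *)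
Lemma nl_op_ae (u v : R -> R) : measurable_fun setT u -> measurable_fun setT v ->
  ae_eq mu setT u v -> ae_eq mu setT (nl_op al w u) (nl_op al w v).
Proof.
move=> mu_ mv uv; apply: filterS (uv) => x uvx _.
rewrite /nl_op /Rintegral; congr fine; apply: ae_eq_integral => //.
- apply/measurable_EFinP; apply: measurable_funM; first exact: measurable_shift.
  by apply: (measurableT_comp mw); exact: measurable_funB.
- apply/measurable_EFinP; apply: measurable_funM; first exact: measurable_shift.
  by apply: (measurableT_comp mw); exact: measurable_funB.
- by apply: filterS uv => y uvy _; rewrite uvx// uvy.
Qed.

Lemma measurable_nl_op (u : R -> R) : measurable_fun setT u -> measurable_fun setT (nl_op al w u).
Proof.
move=> mu_.
rewrite (_ : nl_op al w u = (fun x => Rintegral mu setT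
    (fun z => al z * w (u (x + z) - u x)))); last by apply/funext => x; exact: nl_opE.
apply: (@measurable_Rintegral _ (fun zx => al zx.1 * w (u (zx.2 + zx.1) - u zx.2))).
apply: measurable_funM; first exact: (measurableT_comp mal).
apply: (measurableT_comp mw); apply: measurable_funB; first exact: measurable_shift2.
exact: (measurableT_comp mu_).
Qed.

Lemma Lp_norm_le_scale (c : R) (f g : R -> R) : 0 <= c -> measurable_fun setT f ->
  measurable_fun setT g -> (forall x, `|f x| <= c * `|g x|) ->
  (Lp_norm p f <= c%:E * Lp_norm p g)%E.
Proof.
move=> c0 mf mg fg.
apply: (@le_trans _ _ (Lp_norm p (fun x => c * g x)%R)).
  apply: Lp_norm_le => //; first exact: measurable_funM.
  by apply: aeW => x; rewrite normrM ger0_norm.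
by apply: le_trans (Lp_normZ_le c p1 mg) _; rewrite ger0_norm.
Qed.

Lemma Lp_normB (f g : R -> R) : measurable_fun setT f -> measurable_fun setT g ->
  (Lp_norm p (fun x => f x - g x)%R <= Lp_norm p f + Lp_norm p g)%E.
Proof.
move=> mf mg; rewrite -(Lp_normN p g); apply: (Lp_normD p1 mf).
exact: measurableT_comp.
Qed.

Definition increment (f : R -> R) (z x : R) := f (x + z) - f x.

Lemma measurable_increment (f : R -> R) z : measurable_fun setT f ->
  measurable_fun setT (increment f z).
Proof. by move=> mf; apply: measurable_funB => //; exact: measurable_shift. Qed.

Lemma measurable_increment2 (f : R -> R) : measurable_fun setT f ->
  measurable_fun setT (fun zx : R * R => increment f zx.1 zx.2).
Proof.
move=> mf; apply: measurable_funB; first exact: measurable_shift2.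
exact: (measurableT_comp mf).
Qed.

Lemma Lp_norm_increment (f : R -> R) z : measurable_fun setT f ->
  (Lp_norm p (increment f z) <= Lp_norm p f + Lp_norm p f)%E.
Proof.
move=> mf; apply: le_trans (Lp_normB _ mf) _; first exact: measurable_shift.
by apply: leeD => //; exact: Lp_norm_translate.
Qed.

Lemma weak_derivativeB u g v h : weak_derivative u g -> weak_derivative v h ->
  (Lp_norm p u < +oo)%E -> (Lp_norm p g < +oo)%E ->
  (Lp_norm p v < +oo)%E -> (Lp_norm p h < +oo)%E ->
  weak_derivative (fun x => u x - v x) (fun x => g x - h x).
Proof.
move=> ug vh uoo goo voo hoo.
have := weak_derivative_lin 1 (-1) p1 ug vh uoo goo voo hoo.
by congr weak_derivative; apply/funext => x; rewrite mul1r mulN1r.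
Qed.

Lemma weak_derivative_increment u g z : weak_derivative u g ->
  (Lp_norm p u < +oo)%E -> (Lp_norm p g < +oo)%E ->
  weak_derivative (increment u z) (increment g z).
Proof.
move=> ug uoo goo; have [mu_ [mg _]] := ug.
apply: weak_derivativeB => //; first exact: weak_derivative_translate.
- exact: le_lt_trans (Lp_norm_translate _ _ _) uoo.
- exact: le_lt_trans (Lp_norm_translate _ _ _) goo.
Qed.

Section lipschitz.
Variables (M L m e e' G : R) (u v gu gv : R -> R).
Hypotheses (L0 : 0 <= L) (w1L : forall x, `|x| <= M + M -> `|derive1 w x| <= L)
  (wL : forall x y, `|x| <= M + M -> `|y| <= M + M -> `|w x - w y| <= L * `|x - y|)
  (w1lip : forall x y, `|x| <= M + M -> `|y| <= M + M ->
        `|derive1 w x - derive1 w y| <= L * `|x - y|).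
Hypotheses (ugu : weak_derivative u gu) (vgv : weak_derivative v gv).
Hypotheses (uoo : (Lp_norm p u < +oo)%E) (guoo : (Lp_norm p gu < +oo)%E)
  (voo : (Lp_norm p v < +oo)%E).
Hypotheses (uM : forall x, `|u x| <= M) (vM : forall x, `|v x| <= M)
  (uvm : forall x, `|u x - v x| <= m).
Hypotheses (e0 : (Lp_norm p (fun x => u x - v x)%R <= e%:E)%E)
  (e0' : (Lp_norm p (fun x => gu x - gv x)%R <= e'%:E)%E)
  (GG : (Lp_norm p gv <= G%:E)%E).
Let mu_ : measurable_fun setT u := proj1 ugu.
Let mv : measurable_fun setT v := proj1 vgv.
Let mgu : measurable_fun setT gu := proj1 (proj2 ugu).
Let mgv : measurable_fun setT gv := proj1 (proj2 vgv).

Let incM f z x : (forall x, `|f x| <= M) -> `|increment f z x| <= M + M.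
Proof. by move=> fM; apply: le_trans (ler_normB _ _) _; exact: lerD. Qed.

(** Common bound for one translate: [2 L e] for the function; for its derivative [2 L e'] from the
    change of [gu], plus [L * (2 m) * (2 G)] from the change of the coefficient [derive1 w]. *)
Definition nl_op_dist : R := 2 * L * (e + e' + 2 * m * G).

(** The product [(derive1 w (increment u) - derive1 w (increment v)) * increment gv] is controlled
    by a sup bound on the first factor and an L^p bound on the second. This is where the embedding
    into bounded functions matters, hence the separate datum [m]. *)
Lemma nl_op_lipschitz_bounded :
  (W1p_norm p (fun x => nl_op al w u x - nl_op al w v x)%R <=
    (kernel_mass al * nl_op_dist + kernel_mass al * nl_op_dist)%:E)%E.
Proof.
have m0 : 0 <= m by exact: le_trans (uvm 0).
have ee0 : 0 <= e by rewrite -lee_fin; exact: le_trans (Lp_norm_ge0 _ _) e0.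
have ee0' : 0 <= e' by rewrite -lee_fin; exact: le_trans (Lp_norm_ge0 _ _) e0'.
have G0 : 0 <= G by rewrite -lee_fin; exact: le_trans (Lp_norm_ge0 _ _) GG.
have gvoo : (Lp_norm p gv < +oo)%E by apply: le_lt_trans GG _; rewrite ltry.
have m2G0 : 0 <= 2 * m * G by rewrite !mulr_ge0.
have C0 : 0 <= nl_op_dist by rewrite /nl_op_dist !mulr_ge0// !addr_ge0.
pose F (zx : R * R) := w (increment u zx.1 zx.2) - w (increment v zx.1 zx.2).
pose H (zx : R * R) := derive1 w (increment u zx.1 zx.2) * increment gu zx.1 zx.2 -
   derive1 w (increment v zx.1 zx.2) * increment gv zx.1 zx.2.
have mF : measurable_fun setT F.
  by apply: measurable_funB; apply: (measurableT_comp mw); exact: measurable_increment2.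
have mH : measurable_fun setT H.
  by apply: measurable_funB; apply: measurable_funM; try exact: measurable_increment2;
    apply: (measurableT_comp mw1); exact: measurable_increment2.
have mFz z : measurable_fun setT (fun x => F (z, x)) by exact: (measurableT_comp mF).
have mHz z : measurable_fun setT (fun x => H (z, x)) by exact: (measurableT_comp mH).
have muv : measurable_fun setT (fun x => u x - v x) by exact: measurable_funB.
have mguv : measurable_fun setT (fun x => gu x - gv x) by exact: measurable_funB.
have FC z : (Lp_norm p (fun x => F (z, x)) <= nl_op_dist%:E)%E.
  apply: (@le_trans _ _ (L%:E * Lp_norm p (increment (fun x => u x - v x)%R z))%E).
    apply: Lp_norm_le_scale => //; first exact: measurable_increment.
    move=> x; apply: le_trans (wL (incM _ _ uM) (incM _ _ vM)) _.
    by rewrite ler_wpM2l// le_eqVlt; apply/orP; left; apply/eqP; congr `|_|; rewrite /increment /=; ring.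
  apply: (@le_trans _ _ (L%:E * (e + e)%:E)%E).
    rewrite lee_wpmul2l ?lee_fin//; apply: le_trans (Lp_norm_increment z muv) _.
    by rewrite EFinD leeD.
  rewrite -EFinM lee_fin /nl_op_dist.
  have : 0 <= L * (e' + 2 * m * G) by rewrite mulr_ge0// addr_ge0.
  lra.
have HC z : (Lp_norm p (fun x => H (z, x)) <= nl_op_dist%:E)%E.
  (* Change the derivative first, keeping the coefficient at [u]; then change the coefficient,
     keeping [gv]. *)
  pose H1 x := derive1 w (increment u z x) * increment (fun x => gu x - gv x) z x.
  pose H2 x := (derive1 w (increment u z x) - derive1 w (increment v z x)) * increment gv z x.
  have HE : (fun x => H (z, x)) = (fun x => H1 x + H2 x).
    by apply/funext => x; rewrite /H /H1 /H2 /increment /=; ring.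
  have mH1 : measurable_fun setT H1.
    apply: measurable_funM; last exact: measurable_increment.
    by apply: (measurableT_comp mw1); exact: measurable_increment.
  have mH2 : measurable_fun setT H2.
    apply: measurable_funM; last exact: measurable_increment.
    by apply: measurable_funB; apply: (measurableT_comp mw1); exact: measurable_increment.
  rewrite HE; apply: le_trans (Lp_normD p1 mH1 mH2) _.
  have b1 : (Lp_norm p H1 <= (L * (e' + e'))%:E)%E.
    apply: (@le_trans _ _ (L%:E * Lp_norm p (increment (fun x => gu x - gv x)%R z))%E).
      apply: Lp_norm_le_scale => //; first exact: measurable_increment.
      by move=> x; rewrite normrM ler_wpM2r//; apply: w1L; exact: incM.
    rewrite EFinM lee_wpmul2l ?lee_fin//; apply: le_trans (Lp_norm_increment z mguv) _.
    by rewrite EFinD leeD.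
  have b2 : (Lp_norm p H2 <= (L * (m + m) * (G + G))%:E)%E.
    apply: (@le_trans _ _ ((L * (m + m))%:E * Lp_norm p (increment gv z))%E).
      apply: Lp_norm_le_scale => //; first by rewrite mulr_ge0// addr_ge0.
        exact: measurable_increment.
      move=> x; rewrite normrM ler_wpM2r//.
      apply: le_trans (w1lip (incM _ _ uM) (incM _ _ vM)) _; rewrite ler_wpM2l//.
      have -> : increment u z x - increment v z x =
        (u (x + z) - v (x + z)) - (u x - v x) by rewrite /increment; ring.
      by apply: le_trans (ler_normB _ _) _; exact: lerD.
    rewrite [leRHS]EFinM lee_wpmul2l ?lee_fin ?mulr_ge0 ?addr_ge0//.
    by apply: le_trans (Lp_norm_increment z mgv) _; rewrite EFinD leeD.
  apply: le_trans (leeD b1 b2) _; rewrite -EFinD lee_fin /nl_op_dist.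
  have : 0 <= L * e by rewrite mulr_ge0.
  lra.
have fin2 (f : R -> R) z : measurable_fun setT f -> (Lp_norm p f < +oo)%E ->
    (Lp_norm p (increment f z) < +oo)%E.
  by move=> mf foo; apply: le_lt_trans (Lp_norm_increment z mf) _; exact: lte_add_pinfty.
have fin1 (f : R -> R) z : (forall x, `|f x| <= M) -> measurable_fun setT f -> (Lp_norm p f < +oo)%E ->
    (Lp_norm p (fun x => w (increment f z x))%R < +oo)%E.
  move=> fM mf foo; apply: (@le_lt_trans _ _ (L%:E * Lp_norm p (increment f z))%E).
    apply: Lp_norm_le_scale => //.
    + by apply: (measurableT_comp mw); exact: measurable_increment.
    + exact: measurable_increment.
    (* [w 0 = 0] turns the Lipschitz bound into [|w s| <= L |s|], which keeps the composition in
       L^p. *)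
    + move=> x; rewrite -[w _]subr0 -w0 -[X in _ <= L * `|X|]subr0.
      by apply: wL; [exact: incM|rewrite normr0 (le_trans _ (incM 0 0 uM))].
  by apply: lte_mul_pinfty; rewrite ?lee_fin//; exact: fin2.
have fin3 (f g : R -> R) z : (forall x, `|f x| <= M) -> measurable_fun setT f ->
    measurable_fun setT g -> (Lp_norm p g < +oo)%E ->
    (Lp_norm p (fun x => derive1 w (increment f z x) * increment g z x)%R < +oo)%E.
  move=> fM mf mg goo; apply: (@le_lt_trans _ _ (L%:E * Lp_norm p (increment g z))%E).
    apply: Lp_norm_le_scale => //.
    + apply: measurable_funM; last exact: measurable_increment.
      by apply: (measurableT_comp mw1); exact: measurable_increment.
    + exact: measurable_increment.
    + by move=> x; rewrite normrM ler_wpM2r//; apply: w1L; exact: incM.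
  by apply: lte_mul_pinfty; rewrite ?lee_fin//; exact: fin2.
have FH z : weak_derivative (fun x => F (z, x)) (fun x => H (z, x)).
  have du := weak_derivative_increment z ugu uoo guoo.
  have dv := weak_derivative_increment z vgv voo gvoo.
  apply: weak_derivativeB; try by [exact: fin1|exact: fin3].
  - by apply: (weak_derivative_comp p1 Cw du (K := M + M)); [exact: fin2|exact: fin2|move=> x; exact: incM].
  - by apply: (weak_derivative_comp p1 Cw dv (K := M + M)); [exact: fin2|exact: fin2|move=> x; exact: incM].
have KE : (fun x => nl_op al w u x - nl_op al w v x) =
    (fun x => Rintegral mu setT (fun z => al z * F (z, x))).
  apply/funext => x; rewrite !nl_opE//.
  have [C1 C10 wC] := continuous_bounded_itv (M + M) cw.
  have iw (f : R -> R) : (forall x, `|f x| <= M) -> measurable_fun setT f ->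
      mu.-integrable setT (EFin \o (fun z => al z * w (f (x + z) - f x))).
    move=> fM mf.
    apply: (@integrableMl _ _ _ lebesgue_measure _ measurableT (EFin \o al)) => //.
      apply: (measurableT_comp mw); apply: measurable_funB => //.
      by under eq_fun do rewrite addrC; exact: measurable_shift.
    exists C1; split; rewrite ?num_real// => y C1y z _ /=.
    by apply: le_trans (ltW C1y); apply: wC; exact: incM.
  rewrite -RintegralB; [|by []|exact: iw|exact: iw].
  by apply: eq_Rintegral => z _; rewrite /F -mulrBr.
rewrite KE.
apply: (@le_trans _ _ (Lp_norm p (fun x => Rintegral mu setT (fun z => al z * F (z, x))%R) +
   Lp_norm p (fun x => Rintegral mu setT (fun z => al z * H (z, x))%R))%E).
  apply: ereal_inf_lbound; exists (fun x => Rintegral mu setT (fun z => al z * H (z, x))) => //.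
  exact: (weak_derivative_superposition ial p1 C0 mF mH FC HC FH).
by rewrite EFinD leeD//; exact: Lp_norm_superposition.
Qed.

End lipschitz.
End nonlocal_operator.

(** * The Sobolev seminorm and its completeness *)

Section sobolev_seminorm.
Context {R : realType}.
Local Notation mu := (@lebesgue_measure R).
Variable p : \bar R.
Hypothesis p1 : (1 <= p)%E.

Lemma weak_derivative0 : weak_derivative (fun=> 0 : R) (fun=> 0).
Proof.
split=> //; split=> // phi _; rewrite /Rintegral.
by do 2![under eq_integral do rewrite mul0r; rewrite integral0]; rewrite oppr0.
Qed.

(** Both sides of the weak identity are L^p-continuous for a fixed test function, so the graph of
    weak differentiation is closed. *)
Lemma weak_derivative_closed (u g : R -> R) :
  measurable_fun setT u -> measurable_fun setT g ->
  (forall e : R, 0 < e -> exists v h : R -> R, [/\ weak_derivative v h,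
    (Lp_norm p v < +oo)%E, (Lp_norm p h < +oo)%E,
    (Lp_norm p (fun x => u x - v x)%R <= e%:E)%E &
    (Lp_norm p (fun x => g x - h x)%R <= e%:E)%E]) ->
  weak_derivative u g.
Proof.
move=> mu_ mg H; split=> //; split=> // phi tphi.
have [M [B [cphi cdphi phiB dphiB phi0]]] := test_function_bounds tphi.
have [mphi mdphi] : measurable_fun setT phi /\ measurable_fun setT (derive1 phi).
  by split; exact: continuous_measurable_fun.
have close (psi : R -> R) : measurable_fun setT psi -> (forall x, `|psi x| <= B) ->
    (forall x, M < `|x| -> psi x = 0) -> exists2 k, 0 <= k &
    forall (f f' : R -> R) (e : R), measurable_fun setT f -> measurable_fun setT f' ->
      (Lp_norm p f' < +oo)%E -> (Lp_norm p (fun x => f x - f' x)%R <= e%:E)%E ->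
      `|Rintegral mu setT (fun x => f x * psi x) - Rintegral mu setT (fun x => f' x * psi x)|
        <= k * e.
  move=> mpsi psiB psi0.
  have [k k0 Hk] := integral_norm_mul_le_Lp_norm p1 mpsi psiB psi0.
  exists k => // f f' e mf mf' f'oo ff'.
  have mff' : measurable_fun setT (fun x => f x - f' x) by exact: measurable_funB.
  have ff'oo : (Lp_norm p (fun x => f x - f' x)%R < +oo)%E by apply: le_lt_trans ff' _; exact: ltry.
  have i1 := Lp_integrableM p1 mff' ff'oo mpsi psiB psi0.
  have i2 := Lp_integrableM p1 mf' f'oo mpsi psiB psi0.
  have -> : Rintegral mu setT (fun x => f x * psi x) =
     Rintegral mu setT (fun x => (f x - f' x) * psi x) + Rintegral mu setT (fun x => f' x * psi x).
    rewrite -RintegralD//; apply: eq_Rintegral => x _; ring.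
  rewrite addrK; apply: (le_trans (le_normr_Rintegral _ i1)) => //.
  rewrite -lee_fin /Rintegral fineK; last first.
    rewrite ge0_fin_numE ?integral_ge0//; apply: le_lt_trans (Hk _ mff') _.
    exact: lte_mul_pinfty.
  by apply: le_trans (Hk _ mff') _; rewrite EFinM lee_wpmul2l.
have [k k0 Hk] := close _ mphi phiB (fun x Mx => proj1 (phi0 x Mx)).
have [k' k0' Hk'] := close _ mdphi dphiB (fun x Mx => proj2 (phi0 x Mx)).
apply/eqP; rewrite -subr_eq0 opprK -normr_le0; apply/ler_addgt0Pr => e e0; rewrite add0r.
have d0 : 0 < e / (k + k' + 1) by rewrite divr_gt0//; lra.
have [v [h [[mv [mh vh]] voo hoo uv gh]]] := H _ d0.
have h1 := Hk _ _ _ mg mh hoo gh; have h2 := Hk' _ _ _ mu_ mv voo uv.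
rewrite (vh _ tphi) opprK in h2.
set A := Rintegral _ _ _ in h2 *; set C := Rintegral _ _ _ in h1 *.
set E := Rintegral _ _ _ in h1 h2.
have -> : A + C = (A + E) + (C - E) by ring.
apply: le_trans (ler_normD _ _) _; apply: le_trans (lerD h2 h1) _.
move: d0 {A C E h1 h2 uv gh}; set d := e / _ => d0.
have : e = (k + k' + 1) * d by rewrite /d mulrCA divff ?mulr1//; lra.
by rewrite !mulrDl mul1r; lra.
Qed.

(** [fine] sends +oo to 0, so this number is informative only together with [in_W1p]. *)
Definition W1p_seminorm (u : R -> R) : R := fine (W1p_norm p u).
Local Notation N := W1p_seminorm.

Lemma W1p_norm_ge0 u : (0 <= W1p_norm p u)%E.
Proof.
by apply: le_ereal_inf_tmp => _ [g _ <-]; rewrite adde_ge0// Lp_norm_ge0.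
Qed.

Lemma W1p_normE u : in_W1p p u -> W1p_norm p u = (N u)%:E.
Proof. by move=> Du; rewrite fineK// ge0_fin_numE ?W1p_norm_ge0. Qed.

Lemma W1p_seminorm_ge0 u : 0 <= N u.
Proof. by rewrite fine_ge0 ?W1p_norm_ge0. Qed.

Lemma W1p_norm_le u g (a b : R) : weak_derivative u g ->
  (Lp_norm p u <= a%:E)%E -> (Lp_norm p g <= b%:E)%E -> (W1p_norm p u <= (a + b)%:E)%E.
Proof.
move=> ug ua gb; rewrite EFinD; apply: le_trans (leeD ua gb).
by apply: ereal_inf_lbound; exists g.
Qed.

Lemma in_W1p_le u (c : R) : (W1p_norm p u <= c%:E)%E -> in_W1p p u /\ N u <= c.
Proof.
move=> uc; have Du : in_W1p p u by apply: le_lt_trans uc _; exact: ltry.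
by split=> //; rewrite -lee_fin -W1p_normE.
Qed.

Lemma in_W1p_approx u (e : R) : in_W1p p u -> 0 < e -> exists g (a b : R),
  [/\ weak_derivative u g, Lp_norm p u = a%:E, Lp_norm p g = b%:E &
   [/\ 0 <= a, 0 <= b & a + b <= N u + e]].
Proof.
move=> Du e0; have : ereal_inf [set (Lp_norm p u + Lp_norm p g)%E | g in weak_derivative u]
    \is a fin_num by rewrite ge0_fin_numE ?W1p_norm_ge0.
move=> /(lb_ereal_inf_adherent e0) [_ [g ug <-]].
rewrite -[ereal_inf _]/(W1p_norm p u) W1p_normE// => H.
have := Lp_norm_ge0 p u; have := Lp_norm_ge0 p g; move: H.
case ua : (Lp_norm p u) => [a| |]; case gb : (Lp_norm p g) => [b| |]//; rewrite -?EFinD ?lte_fin ?lee_fin => H b0 a0 //.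
by exists g, a, b; split=> //; split=> //; exact: ltW.
Qed.

Lemma in_W1p_measurable u : in_W1p p u -> measurable_fun setT u.
Proof. by move=> /in_W1p_approx -/(_ 1 ltr01)[g [a [b [[]]]]]. Qed.

Lemma W1p_seminorm_lin (a b : R) (u v : R -> R) : in_W1p p u -> in_W1p p v ->
  in_W1p p (fun x => a * u x + b * v x) /\
  N (fun x => a * u x + b * v x) <= `|a| * N u + `|b| * N v.
Proof.
move=> Du Dv.
have H (e : R) : 0 < e ->
    (W1p_norm p (fun x => a * u x + b * v x)%R <= (`|a| * N u + `|b| * N v + e)%:E)%E.
  move=> e0; have d0 : 0 < e / (`|a| + `|b| + 1).
    by rewrite divr_gt0// ltr_wpDl// addr_ge0.
  have [g [a1 [b1 [ug ua gb [a10 b10 ab1]]]]] := in_W1p_approx Du d0.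
  have [h [a2 [b2 [vh va hb [a20 b20 ab2]]]]] := in_W1p_approx Dv d0.
  have [mg mh] := (proj1 (proj2 ug), proj1 (proj2 vh)).
  have [mu_ mv] := (proj1 ug, proj1 vh).
  have bound (f f' : R -> R) c c' : measurable_fun setT f -> measurable_fun setT f' ->
      Lp_norm p f = c%:E -> Lp_norm p f' = c'%:E ->
      (Lp_norm p (fun x => a * f x + b * f' x)%R <= (`|a| * c + `|b| * c')%:E)%E.
    move=> mf mf' fc fc'; apply: le_trans (Lp_normD p1 _ _) _; try exact: measurable_funM.
    rewrite EFinD leeD//; apply: le_trans (Lp_normZ_le _ p1 _) _ => //.
      by rewrite fc.
    by rewrite fc'.
  have W : weak_derivative (fun x => a * u x + b * v x) (fun x => a * g x + b * h x).
    by apply: (weak_derivative_lin _ _ p1 ug vh); rewrite ?ua ?gb ?va ?hb ltry.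
  apply: le_trans (W1p_norm_le W (bound _ _ _ _ _ _ ua va) (bound _ _ _ _ _ _ gb hb)) _ => //.
  rewrite lee_fin.
  have eE : e = `|a| * (e / (`|a| + `|b| + 1)) + `|b| * (e / (`|a| + `|b| + 1)) + (e / (`|a| + `|b| + 1)).
    have := normr_ge0 a; have := normr_ge0 b => b0 a0; field; lra.
  have := ler_wpM2l (normr_ge0 a) ab1; have := ler_wpM2l (normr_ge0 b) ab2.
  rewrite !mulrDr; move: d0 eE; set d := e / _; lra.
have [D1 _] := in_W1p_le (H 1 ltr01); split=> //.
by apply/ler_addgt0Pr => e /H /in_W1p_le[].
Qed.

Lemma W1p_seminormD u v : in_W1p p u -> in_W1p p v ->
  in_W1p p (fun x => u x + v x) /\ N (fun x => u x + v x) <= N u + N v.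
Proof.
move=> Du Dv; have := W1p_seminorm_lin 1 1 Du Dv; rewrite normr1 !mul1r.
by under eq_fun do rewrite !mul1r.
Qed.

Lemma W1p_seminormZ_le (a : R) u : in_W1p p u ->
  in_W1p p (fun x => a * u x) /\ N (fun x => a * u x) <= `|a| * N u.
Proof.
move=> Du; have := W1p_seminorm_lin a 0 Du Du; rewrite normr0 !mul0r addr0.
by under eq_fun do rewrite !mul0r addr0.
Qed.

(** The reverse inequality comes from scaling back by [a^-1]. *)
Lemma W1p_seminormZ (a : R) u : in_W1p p u -> N (fun x => a * u x) = `|a| * N u.
Proof.
move=> Du; have [Da Na] := W1p_seminormZ_le a Du; apply/eqP; rewrite eq_le Na/=.
have [->|a0] := eqVneq a 0; first by rewrite normr0 mul0r W1p_seminorm_ge0.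
have [_] := W1p_seminormZ_le a^-1 Da; under eq_fun do rewrite mulKf//.
by rewrite normfV -ler_pdivrMl ?invr_gt0 ?normr_gt0// invrK.
Qed.

Lemma in_W1p0 : in_W1p p (fun=> 0).
Proof.
suff : (W1p_norm p (fun=> 0%R) <= (0 + 0)%:E)%E by move=> /in_W1p_le[].
apply: (@W1p_norm_le _ (fun=> 0)); rewrite ?Lp_norm0//; exact: weak_derivative0.
Qed.

Lemma weak_derivative_sum (d h : nat -> R -> R) :
  (forall k, weak_derivative (d k) (h k)) ->
  (forall k, Lp_norm p (d k) < +oo)%E -> (forall k, Lp_norm p (h k) < +oo)%E ->
  forall n, [/\ weak_derivative (fun x => \sum_(0 <= k < n) d k x)
                   (fun x => \sum_(0 <= k < n) h k x),
    (Lp_norm p (fun x => \sum_(0 <= k < n) d k x)%R < +oo)%E &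
    (Lp_norm p (fun x => \sum_(0 <= k < n) h k x)%R < +oo)%E].
Proof.
move=> dh doo hoo.
have md k : measurable_fun setT (d k) := proj1 (dh k).
have mh k : measurable_fun setT (h k) := proj1 (proj2 (dh k)).
have fin (f : nat -> R -> R) n : (forall k, measurable_fun setT (f k)) ->
    (forall k, Lp_norm p (f k) < +oo)%E ->
    (Lp_norm p (fun x => \sum_(0 <= k < n) f k x)%R < +oo)%E.
  move=> mf foo; apply: le_lt_trans (_ : ((\sum_(0 <= k < n) fine (Lp_norm p (f k)))%:E < +oo)%E); last exact: ltry.
  apply: Lp_norm_sum => // k; rewrite fineK// ge0_fin_numE ?Lp_norm_ge0//.
move=> n; split; [|exact: fin|exact: fin].
elim: n => [|n IH].
  under eq_fun do rewrite big_nil; under [X in weak_derivative _ X]eq_fun do rewrite big_nil.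
  exact: weak_derivative0.
have := weak_derivative_lin 1 1 p1 IH (dh n) (fin _ n md doo) (fin _ n mh hoo) (doo n) (hoo n).
by congr weak_derivative; apply/funext => x; rewrite big_nat_recr//= !mul1r.
Qed.

End sobolev_seminorm.

Section sobolev_complete.
Context {R : realType}.
Local Notation mu := (@lebesgue_measure R).
Variable p : \bar R.
Hypothesis p1 : (1 <= p)%E.
Local Notation N := (W1p_seminorm p).

Lemma sum_half_le n m : (n <= m)%N ->
  \sum_(n <= k < m) (2^-1 : R) ^+ k <= 2 * 2^-1 ^+ n.
Proof.
move=> nm; suff -> : \sum_(n <= k < m) (2^-1 : R) ^+ k = 2 * 2^-1 ^+ n - 2 * 2^-1 ^+ m.
  by rewrite gerBl mulr_ge0// exprn_ge0.
elim: m nm => [|m IH]; first by rewrite leqn0 => /eqP->; rewrite big_geq// subrr.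
rewrite leq_eqVlt => /predU1P[->|nm]; first by rewrite big_geq// subrr.
by rewrite big_nat_recr//= IH// exprS; field.
Qed.

Lemma half_expr_lt (e : R) : 0 < e -> exists n, 2^-1 ^+ n < e.
Proof.
move=> e0; have : (2^-1 : R) ^+ n @[n --> \oo] --> 0.
  by apply: cvg_expr; rewrite ger0_norm ?invr_ge0//; lra.
move=> /cvgr0Pnorm_lt/(_ _ e0)[n _ /(_ n (leqnn n))] H; exists n.
by apply: le_lt_trans H; exact: ler_norm.
Qed.

Lemma W1p_seminormB u v : in_W1p p u -> in_W1p p v ->
  in_W1p p (fun x => u x - v x) /\ N (fun x => u x - v x) <= N u + N v.
Proof.
move=> Du Dv; have := W1p_seminorm_lin p1 1 (-1) Du Dv; rewrite normrN1 normr1 !mul1r.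
by under eq_fun do rewrite mul1r mulN1r.
Qed.

Lemma W1p_seminorm_distC u v : in_W1p p u -> in_W1p p v ->
  N (fun x => u x - v x) = N (fun x => v x - u x).
Proof.
move=> Du Dv; have [D _] := W1p_seminormB Du Dv.
have := W1p_seminormZ p1 (-1) D; rewrite normrN1 mul1r => <-.
by under eq_fun do rewrite mulN1r opprB.
Qed.

(* A subsequence whose increments have summable norms converges, as do their
   weak derivatives. *)
Lemma W1p_complete (f : nat -> R -> R) : (forall n, in_W1p p (f n)) ->
  (forall e : R, 0 < e -> exists n0, forall m n, (n0 <= m)%N -> (n0 <= n)%N ->
     N (fun x => f m x - f n x) <= e) ->
  exists2 l, in_W1p p l & forall e : R, 0 < e -> exists n0, forall n, (n0 <= n)%N ->
     N (fun x => f n x - l x) <= e.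
Proof.
move=> Df cf; pose q k := (2^-1 : R) ^+ k.
have q0 k : 0 < q k by rewrite exprn_gt0// invr_gt0.
(* Half of [q k] is left for the excess of a near-optimal derivative of the k-th increment. *)
have /choice[r Hr] k := cf (q k / 2) (divr_gt0 (q0 k) (ltr0Sn R 1)).
(* Partial sums make the indices nondecreasing while staying above [r k]. *)
pose s k := (\sum_(i < k.+1) r i)%N.
have rs k : (r k <= s k)%N by rewrite /s big_ord_recr/= leq_addl.
have ss k : (s k <= s k.+1)%N by rewrite /s [leqRHS]big_ord_recr/= leq_addr.
pose d k x := f (s k.+1) x - f (s k) x.
have Dd k : in_W1p p (d k) by apply: (proj1 (W1p_seminormB _ _)).
have Nd k : N (d k) <= q k / 2 by apply: Hr => //; exact: leq_trans (ss k).
have /choice[h Hh] k : exists h : R -> R, [/\ weak_derivative (d k) h,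
    (Lp_norm p (d k) <= (q k)%:E)%E & (Lp_norm p h <= (q k)%:E)%E].
  have [h [a [b [dh da hb [a0 b0 ab]]]]] := in_W1p_approx (Dd k) (divr_gt0 (q0 k) (ltr0Sn R 1)).
  by exists h; split=> //; rewrite ?da ?hb lee_fin; move: (Nd k) ab; lra.
have doo k : (Lp_norm p (d k) < +oo)%E by case: (Hh k) => _ + _; move/le_lt_trans; apply; exact: ltry.
have hoo k : (Lp_norm p (h k) < +oo)%E by case: (Hh k) => _ _; move/le_lt_trans; apply; exact: ltry.
have dh k : weak_derivative (d k) (h k) by case: (Hh k).
have qS n : \sum_(0 <= k < n) q k <= 2 by have := sum_half_le (leq0n n); rewrite expr0 mulr1.
have [Fd mFd HFd] := riesz_fischer p1 (fun k => proj1 (dh k)) (fun k => let: And3 _ a _ := Hh k in a) qS.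
have [Fh mFh HFh] := riesz_fischer p1 (fun k => proj1 (proj2 (dh k))) (fun k => let: And3 _ _ a := Hh k in a) qS.
have q2 n : 0 <= 2 * q n by rewrite mulr_ge0// ltW.
have {}HFd n := HFd n _ (q2 n) (fun m => @sum_half_le n m).
have {}HFh n := HFh n _ (q2 n) (fun m => @sum_half_le n m).
have S := weak_derivative_sum p1 dh doo hoo.
have FW : weak_derivative Fd Fh.
  (* The two limits are found independently; closedness of the graph is what links them. *)
  apply: (weak_derivative_closed p1) => // e e0.
  have [n qn] := half_expr_lt (divr_gt0 e0 (ltr0Sn R 1)).
  have [Sw Sd Sh] := S n.
  exists (fun x => \sum_(0 <= k < n) d k x), (fun x => \sum_(0 <= k < n) h k x).
  split=> //; first by apply: le_trans (HFd n) _; rewrite lee_fin; move: qn; rewrite -/(q n); lra.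
  by apply: le_trans (HFh n) _; rewrite lee_fin; move: qn; rewrite -/(q n); lra.
have Fdoo : (Lp_norm p Fd < +oo)%E.
  by have := HFd 0; under eq_fun do rewrite big_nil subr0; move/le_lt_trans; apply; exact: ltry.
have Fhoo : (Lp_norm p Fh < +oo)%E.
  by have := HFh 0; under eq_fun do rewrite big_nil subr0; move/le_lt_trans; apply; exact: ltry.
have DF : in_W1p p Fd.
  apply: (@le_lt_trans _ _ (Lp_norm p Fd + Lp_norm p Fh)%E); last exact: lte_add_pinfty.
  by apply: ereal_inf_lbound; exists Fh.
have SE n x : \sum_(0 <= k < n) d k x = f (s n) x - f (s 0%N) x.
  by rewrite (telescope_sumr (fun k => f (s k) x)).
have FS n : N (fun x => Fd x - (f (s n) x - f (s 0%N) x)) <= 2 * q n + 2 * q n.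
  have [Sw Sd Sh] := S n.
  have W := weak_derivativeB p1 FW Sw Fdoo Fhoo Sd Sh.
  have [_] := in_W1p_le (W1p_norm_le W (HFd n) (HFh n)).
  by under eq_fun do rewrite SE.
have [Dl _] := W1p_seminormD p1 (Df (s 0%N)) DF.
exists (fun x => f (s 0%N) x + Fd x) => // e e0.
(* Dividing by 5: the tail costs [4 * q n], the passage from [f m] to [f (s n)] at most
   [q n / 2]. *)
have [n qn] := half_expr_lt (divr_gt0 e0 (ltr0Sn R 4)); rewrite -/(q n) in qn.
exists (r n) => m rm.
have -> : (fun x => f m x - (f (s 0%N) x + Fd x)) =
    (fun x => (f m x - f (s n) x) - (Fd x - (f (s n) x - f (s 0%N) x))).
  by apply/funext => x; ring.
have [D1 _] := W1p_seminormB (Df m) (Df (s n)).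
have [D2 _] := W1p_seminormB (Df (s n)) (Df (s 0%N)).
have [D3 _] := W1p_seminormB DF D2.
have [_ h1] := W1p_seminormB D1 D3.
by move: h1 (FS n) (Hr n _ _ rm (rs n)) (q0 n) qn; lra.
Qed.

Lemma W1p_complete_seminorm : complete_seminorm (in_W1p p : (R -> R) -> Prop) N.
Proof.
split.
- exact: (in_W1p0 p1).
- by move=> u v Du Dv; have [] := W1p_seminormD p1 Du Dv.
- by move=> a u Du; have [] := W1p_seminormZ_le p1 a Du.
- by move=> u _; exact: W1p_seminorm_ge0.
- by move=> u v Du Dv; have [] := W1p_seminormD p1 Du Dv.
- by move=> a u Du; exact: W1p_seminormZ.
- exact: W1p_complete.
Qed.

Lemma W1p_norm_ae (u v : R -> R) : measurable_fun setT u -> measurable_fun setT v -> aeq u v ->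
  W1p_norm p u = W1p_norm p v.
Proof.
move=> mu_ mv uv; have vu : aeq v u by exact: ae_eq_sym.
have H (f g : R -> R) : measurable_fun setT f -> measurable_fun setT g -> aeq f g ->
    (W1p_norm p f <= W1p_norm p g)%E.
  move=> mf mg fg; apply: le_ereal_inf_tmp => _ [h gh <-].
  rewrite -(eq_Lp_norm p1 mf mg fg); apply: ereal_inf_lbound; exists h => //.
  exact: weak_derivative_ae (ae_eq_sym fg) gh.
by apply/eqP; rewrite eq_le !H.
Qed.

(** Null elements of the seminorm are the functions vanishing a.e.: the bridge between the abstract
    ODE theory and the [aeq] clauses of the Cauchy problem. *)
Lemma W1p_seminorm_aeq (u v : R -> R) : in_W1p p u -> in_W1p p v ->
  N (fun x => u x - v x) = 0 <-> aeq u v.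
Proof.
move=> Du Dv; have [D _] := W1p_seminormB Du Dv; split.
  move=> N0; have L0 : Lp_norm p (fun x => u x - v x) = 0%E.
    apply/eqP; rewrite eq_le Lp_norm_ge0 andbT; apply/lee_addgt0Pr => e e0.
    have [g [a [b [_ -> _ [_ b0 ab]]]]] := in_W1p_approx D e0.
    by rewrite add0e lee_fin; move: ab; rewrite N0; lra.
  have := Lp_norm_eq0 p1 (in_W1p_measurable D) L0.
  by apply: filterS => x /(_ I) /eqP; rewrite subr_eq0 => /eqP.
move=> uv; have mD := in_W1p_measurable D.
rewrite /W1p_seminorm (@W1p_norm_ae _ (fun=> 0))//; last first.
  by apply: filterS uv => x /(_ I) /= -> _; rewrite subrr.
have := csn_norm0 W1p_complete_seminorm; exact.
Qed.

(** The strict inequality pays for a near-optimal derivative in the Sobolev bound. *)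
Lemma W1p_ae_bound (u : R -> R) (M : R) : in_W1p p u -> N u < M ->
  {ae mu, forall x, `|u x| <= M}.
Proof.
move=> Du uM; have e0 : 0 < M - N u by rewrite subr_gt0.
have [g [a [b [ug ua gb [_ _ ab]]]]] := in_W1p_approx Du e0.
have := sobolev_bound p1 ug; rewrite ua gb => /(_ (ltry _) (ltry _)).
by apply: filterS => x; rewrite -EFinD lee_fin => /le_trans; apply; move: ab; lra.
Qed.

End sobolev_complete.

(** * Local Lipschitz continuity of the nonlocal operator in the Sobolev norm *)

Section nonlocal_operator_lipschitz.
Context {R : realType}.
Local Notation mu := (@lebesgue_measure R).
Variables (p : \bar R) (al w : R -> R).
Hypotheses (p1 : (1 <= p)%E) (ial : mu.-integrable setT (EFin \o al)).
Hypotheses (Cw : C2_real w) (w0 : w 0 = 0).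
Local Notation N := (W1p_seminorm p).
Local Notation K := (nl_op al w).

(** Cutting off on a null set turns bounds valid a.e. into bounds valid everywhere. *)
Lemma ae_bounded_version (f : R -> R) (P : set R) : measurable P ->
  measurable_fun setT f -> mu (~` P) = 0%E ->
  measurable_fun setT (fun x => f x * \1_P x) /\ aeq f (fun x => f x * \1_P x).
Proof.
move=> mP mf P0; split; first exact: measurable_funM.
exists (~` P); split=> //=; first exact: measurableC.
move=> x /= H Px; apply: H => _.
by rewrite indicE mem_set// mulr1.
Qed.

(** The slack [d] absorbs the near-optimal derivative of [u - v] and the strict inequality in the
    sup bound; it is sent to 0 afterwards. *)
Lemma nl_op_lipschitz_le (M : R) : exists2 L : R, 0 <= L &
  forall u v, in_W1p p u -> in_W1p p v -> N u <= M -> N v <= M ->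
    forall d : R, 0 < d ->
    (W1p_norm p (fun x => K u x - K v x)%R <= (L * (N (fun x => u x - v x) + d))%:E)%E.
Proof.
have [L L0 [w1L wL w1lip]] := C2_local_bounds Cw ((`|M| + 1) + (`|M| + 1)).
have ka0 := kernel_mass_ge0 ial.
have M0 := normr_ge0 M.
(* [nl_op_dist] with [e + e'] and [m] at most [n + d] and [G = |M| + 1], doubled for the function
   and its derivative. *)
exists (kernel_mass al * (4 * L * (1 + 2 * (`|M| + 1)))).
  by rewrite !mulr_ge0// ?addr_ge0// ?mulr_ge0//; lra.
move=> u v Du Dv uM vM d d0; set B := `|M| + 1 in w1L wL w1lip *.
have [D _] := W1p_seminormB p1 Du Dv; set n := N _.
have n0 : 0 <= n := W1p_seminorm_ge0 _ _.
have MM := ler_norm M.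
have uB : N u < B by rewrite /B; lra.
have vB : N v < B by rewrite /B; lra.
have B0 : 0 <= B by rewrite /B; lra.
have := W1p_ae_bound p1 D (_ : n < n + d); rewrite ltrDl => /(_ d0) bd.
have := W1p_ae_bound p1 Du uB; have := W1p_ae_bound p1 Dv vB => bv bu.
have [A [mA A0 HA]] : {ae mu, forall x, [/\ `|u x| <= B, `|v x| <= B & `|u x - v x| <= n + d]}.
  by apply: filterS3 bu bv bd.
pose P := ~` A; have mP : measurable P by exact: measurableC.
have P0 : mu (~` P) = 0%E by rewrite /P setCK.
have HP x : P x -> [/\ `|u x| <= B, `|v x| <= B & `|u x - v x| <= n + d].
  by move=> Px; apply: contrapT => H; apply: Px; exact: HA.
have [gv [av [bv' [vgv va vb [av0 bv0 vab]]]]] := in_W1p_approx Dv ltr01.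
have [gd [ad [bd' [dgd da db [ad0 bd0 dab]]]]] := in_W1p_approx D d0.
have [mu_ us] := ae_bounded_version mP (in_W1p_measurable Du) P0.
have [mv vs] := ae_bounded_version mP (in_W1p_measurable Dv) P0.
set u' := (fun x => u x * _) in mu_ us; set v' := (fun x => v x * _) in mv vs.
have mKu := measurable_nl_op ial Cw (in_W1p_measurable Du).
have mKv := measurable_nl_op ial Cw (in_W1p_measurable Dv).
have mKu' := measurable_nl_op ial Cw mu_.
have mKv' := measurable_nl_op ial Cw mv.
have Ku := nl_op_ae ial Cw (in_W1p_measurable Du) mu_ us.
have Kv := nl_op_ae ial Cw (in_W1p_measurable Dv) mv vs.
rewrite (@W1p_norm_ae _ _ p1 _ (fun x => K u' x - K v' x)); first last.
- by apply: filterS2 Ku Kv => x + + _ => -> // ->.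
- exact: measurable_funB.
- exact: measurable_funB.
(* The derivative of [u] is defined from those of [v] and [u - v], so that [gu - gv] is exactly the
   near-optimal [gd]; independent choices would leave this difference uncontrolled. *)
pose gu x := gv x + gd x.
have ugu : weak_derivative u gu.
  have := weak_derivative_lin 1 1 p1 vgv dgd; rewrite va vb da db.
  move=> /(_ (ltry _) (ltry _) (ltry _) (ltry _)).
  by congr weak_derivative; apply/funext => x; rewrite /gu; ring.
have u'gu := weak_derivative_ae mu_ us ugu.
have v'gv := weak_derivative_ae mv vs vgv.
have := @nl_op_lipschitz_bounded _ p al w p1 ial Cw w0 B L (n + d) ad bd' B u' v' gu gv
  L0 w1L wL w1lip u'gu v'gv.
have v'oo : (Lp_norm p v' < +oo)%E.
  by rewrite -(eq_Lp_norm p1 (in_W1p_measurable Dv) mv vs) va ltry.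
have guoo : (Lp_norm p gu < +oo)%E.
  apply: le_lt_trans (Lp_normD p1 (proj1 (proj2 vgv)) (proj1 (proj2 dgd))) _.
  by rewrite vb db -EFinD ltry.
have u'oo : (Lp_norm p u' < +oo)%E.
  rewrite -(eq_Lp_norm p1 (in_W1p_measurable Du) mu_ us).
  have [g [a [b [_ -> _ _]]]] := in_W1p_approx Du ltr01; exact: ltry.
have ind (f : R -> R) (c : R) x : 0 <= c -> (P x -> `|f x| <= c) -> `|f x * \1_P x| <= c.
  move=> c0 H; rewrite indicE; case: (boolP (x \in P)) => [/set_mem/H|_].
    by rewrite mulr1.
  by rewrite mulr0 normr0.
move=> /(_ u'oo guoo v'oo).
have u'B x : `|u' x| <= B by apply: ind => // /HP[].
have v'B x : `|v' x| <= B by apply: ind => // /HP[].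
have uv'B x : `|u' x - v' x| <= n + d.
  rewrite /u' /v' -mulrBl; apply: (ind (fun x => u x - v x)); last by move=> /HP[].
  by rewrite addr_ge0// ltW.
move=> /(_ u'B v'B uv'B).
have E1 : (Lp_norm p (fun x => u' x - v' x)%R <= ad%:E)%E.
  rewrite -da (eq_Lp_norm p1 (in_W1p_measurable D) (measurable_funB mu_ mv))//.
  by apply: filterS2 us vs => x + + _ => -> // ->.
have E2 : (Lp_norm p (fun x => gu x - gv x)%R <= bd'%:E)%E.
  by rewrite -db; under eq_fun do rewrite /gu addrAC subrr add0r.
have E3 : (Lp_norm p gv <= B%:E)%E by rewrite vb lee_fin; move: vab vM; rewrite /B; lra.
move=> /(_ E1 E2 E3)/le_trans; apply; rewrite lee_fin -mulrA -mulrDr ler_wpM2l// /nl_op_dist.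
have : 0 <= L * (n + d - (ad + bd')) by rewrite mulr_ge0//; move: dab; rewrite -/n; lra.
rewrite -/n; lra.
Qed.

Lemma nl_op0 : K (fun=> 0) = fun=> 0.
Proof.
apply/funext => x; rewrite /nl_op /Rintegral.
by under eq_integral do rewrite subrr w0 mulr0; rewrite integral0.
Qed.

(** Compare with the zero function, which the operator fixes. *)
Lemma in_W1p_nl_op u : in_W1p p u -> in_W1p p (K u).
Proof.
move=> Du; have [L L0 /(_ u (fun=> 0) Du (in_W1p0 p1))] := nl_op_lipschitz_le (N u).
rewrite nl_op0 [N (fun=> 0)](csn_norm0 (W1p_complete_seminorm p1)).
move=> /(_ (lexx _) (W1p_seminorm_ge0 _ _) 1 ltr01)/in_W1p_le[].
by under eq_fun do rewrite subr0.
Qed.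

Lemma nl_op_locally_lipschitz : locally_lipschitz (in_W1p p : (R -> R) -> Prop) N K.
Proof.
move=> M; have [L L0 H] := nl_op_lipschitz_le M; exists L => // u v Du Dv uM vM.
apply/ler_addgt0Pr => e e0; have d0 : 0 < e / (L + 1) by rewrite divr_gt0//; lra.
have [_] := in_W1p_le (H _ _ Du Dv uM vM _ d0).
move=> /le_trans; apply; rewrite mulrDr lerD2l mulrCA ler_piMr ?ltW//.
by rewrite ltr_pdivrMr; lra.
Qed.

End nonlocal_operator_lipschitz.

(** * Products of seminormed spaces and the first-order system *)

Section product_seminorm.
Context {R : realType} {V W : lmodType R}.
Variables (D1 : V -> Prop) (N1 : V -> R) (D2 : W -> Prop) (N2 : W -> R).
Hypotheses (c1 : complete_seminorm D1 N1) (c2 : complete_seminorm D2 N2).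

Lemma complete_seminorm_prod :
  complete_seminorm (fun z : V * W => D1 z.1 /\ D2 z.2) (fun z => N1 z.1 + N2 z.2).
Proof.
split.
- by split; [exact: (csn_zero c1)|exact: (csn_zero c2)].
- by move=> u v [? ?] [? ?]; split; [exact: (csn_add c1)|exact: (csn_add c2)].
- by move=> a u [? ?]; split; [exact: (csn_scale c1)|exact: (csn_scale c2)].
- by move=> u [? ?]; rewrite addr_ge0 ?(csn_ge0 c1) ?(csn_ge0 c2).
- by move=> u v [? ?] [? ?]; rewrite addrACA lerD ?(csn_ler c1) ?(csn_ler c2).
- by move=> a u [? ?]; rewrite (csn_norm c1)// (csn_norm c2)// mulrDr.
move=> f Df cf.
have [l1 Dl1 H1] : exists2 l, D1 l & forall e : R, 0 < e -> exists n0, forall n,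
    (n0 <= n)%N -> N1 ((f n).1 - l) <= e.
  apply: (csn_complete c1) => [n|e /cf[n0 Hn]]; first by case: (Df n).
  exists n0 => m n hm hn; apply: le_trans (Hn m n hm hn) => /=.
  by rewrite lerDl (csn_ge0 c2)//; apply: (csn_sub c2); [case: (Df m)|case: (Df n)].
have [l2 Dl2 H2] : exists2 l, D2 l & forall e : R, 0 < e -> exists n0, forall n,
    (n0 <= n)%N -> N2 ((f n).2 - l) <= e.
  apply: (csn_complete c2) => [n|e /cf[n0 Hn]]; first by case: (Df n).
  exists n0 => m n hm hn; apply: le_trans (Hn m n hm hn) => /=.
  by rewrite lerDr (csn_ge0 c1)//; apply: (csn_sub c1); [case: (Df m)|case: (Df n)].
exists (l1, l2) => // e e0; have e20 : 0 < e / 2 by rewrite divr_gt0.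
have [n1 K1] := H1 _ e20; have [n2 K2] := H2 _ e20.
exists (maxn n1 n2) => n; rewrite geq_max => /andP[h1 h2].
by have := K1 _ h1; have := K2 _ h2 => /=; lra.
Qed.

End product_seminorm.

Section first_order_system.
Context {R : realType}.
Local Notation mu := (@lebesgue_measure R).
Variables (p : \bar R) (al w : R -> R).
Hypotheses (p1 : (1 <= p)%E) (ial : mu.-integrable setT (EFin \o al)).
Hypotheses (Cw : C2_real w) (w0 : w 0 = 0).
Local Notation N := (W1p_seminorm p).
Local Notation K := (nl_op al w).
Local Notation state := ((R -> R) * (R -> R))%type.

Definition state_dom (z : state) := in_W1p p z.1 /\ in_W1p p z.2.
Definition state_norm (z : state) : R := N z.1 + N z.2.
Definition wave_field (z : state) : state := (z.2, K z.1).

Let cs1 := W1p_complete_seminorm p1.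
Lemma state_complete_seminorm : complete_seminorm state_dom state_norm.
Proof. exact: (complete_seminorm_prod cs1 cs1). Qed.
Let cs := state_complete_seminorm.
Local Notation solution := (solution state_dom state_norm wave_field).

Lemma wave_field_dom z : state_dom z -> state_dom (wave_field z).
Proof. by move=> [D1 D2]; split=> //; exact: in_W1p_nl_op. Qed.

Lemma wave_field_lipschitz : locally_lipschitz state_dom state_norm wave_field.
Proof.
move=> M; have [L L0 HL] := nl_op_locally_lipschitz p1 ial Cw w0 M.
exists (L + 1) => [|u v [Du1 Du2] [Dv1 Dv2] uM vM]; first lra.
have n0 f : 0 <= N f := W1p_seminorm_ge0 _ _.
have := HL u.1 v.1 Du1 Dv1; rewrite /state_norm /= in uM vM *.
move=> /(_ ltac:(have := n0 u.2; lra) ltac:(have := n0 v.2; lra)).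
have := n0 (u.1 - v.1); have := mulr_ge0 L0 (n0 (u.2 - v.2)); lra.
Qed.

Definition differential (T : R) (u v : R -> R -> R) := forall t, 0 <= t <= T ->
  forall e : R, 0 < e -> exists2 d : R, 0 < d & forall s, 0 <= s <= T -> `|s - t| < d ->
  N (u s - u t - (s - t) *: v t) <= e * `|s - t|.

Lemma X_derivP T u v : (forall t, 0 <= t <= T -> in_W1p p (u t)) ->
  (forall t, 0 <= t <= T -> in_W1p p (v t)) -> X_deriv p T u v <-> differential T u v.
Proof.
move=> Du Dv.
have D s t : 0 <= s <= T -> 0 <= t <= T -> in_W1p p (u s - u t - (s - t) *: v t).
  move=> sT tT; apply: (csn_sub cs1); last by apply: (csn_scale cs1); exact: Dv.
  by apply: (csn_sub cs1); exact: Du.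
have qE s t : s != t -> (fun x => (u s x - u t x) / (s - t) - v t x) =
    (s - t)^-1 *: (u s - u t - (s - t) *: v t).
  move=> st; apply/funext => x; rewrite !fctE /= /GRing.scale /= mulrBr mulKf ?subr_eq0//.
  by rewrite mulrC.
split=> H t tT e e0.
  have [d [d0 Hd]] := H t tT e e0; exists d => // s sT sd.
  have [->|st] := eqVneq s t.
    by rewrite !subrr scale0r subr0 (csn_norm0 cs1) normr0 mulr0.
  have := Hd s sT st sd; rewrite qE// => /in_W1p_le[_].
  rewrite (csn_norm cs1); last exact: D.
  by rewrite normfV ler_pdivrMl ?normr_gt0 ?subr_eq0// mulrC.
have [d d0 Hd] := H t tT e e0; exists d; split=> // s sT st sd.
have Dq : in_W1p p (fun x => (u s x - u t x) / (s - t) - v t x).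
  by rewrite qE//; apply: (csn_scale cs1); exact: D.
rewrite W1p_normE// lee_fin qE// (csn_norm cs1); last exact: D.
by rewrite normfV ler_pdivrMl ?normr_gt0 ?subr_eq0// mulrC; exact: Hd.
Qed.

Lemma differential_continuous T u v : (forall t, 0 <= t <= T -> in_W1p p (u t)) ->
  (forall t, 0 <= t <= T -> in_W1p p (v t)) -> differential T u v ->
  forall t, 0 <= t <= T -> forall e : R, 0 < e -> exists2 d : R, 0 < d &
  forall s, 0 <= s <= T -> `|s - t| < d -> N (u s - u t) <= e.
Proof.
move=> Du Dv H t tT e e0; have [d d0 Hd] := H t tT 1 ltr01.
have n0 : 0 <= N (v t) := W1p_seminorm_ge0 _ _.
have c0 : 0 < N (v t) + 1 by lra.
exists (Num.min d (e / (N (v t) + 1))) => [|s sT].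
  by rewrite lt_min d0 divr_gt0.
rewrite lt_min ltr_pdivlMr// => /andP[/Hd -/(_ sT)]; rewrite mul1r => H1 H2.
have DB : in_W1p p (u s - u t) by apply: (csn_sub cs1); auto.
have Dz : in_W1p p ((s - t) *: v t) by apply: (csn_scale cs1); auto.
have := csn_leBD cs1 DB Dz; rewrite (csn_norm cs1); last exact: Dv.
by move: H1 H2; lra.
Qed.

(** The second derivative is taken to be [K (U t).1] itself; its continuity in time follows from
    that of the first component, as a solution stays in a ball on which [K] is Lipschitz. *)
Lemma solution_is_solution T U phi psi : 0 <= T -> in_W1p p phi -> in_W1p p psi ->
  solution T U -> state_norm (U 0 - (phi, psi)) = 0 ->
  is_solution p al w phi psi T (fun t => (U t).1).
Proof.
move=> T0 Dphi Dpsi [DU HU] U0.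
have n0 f : 0 <= N f := W1p_seminorm_ge0 _ _.
have D1 t : 0 <= t <= T -> in_W1p p (U t).1 by move=> /DU[].
have D2 t : 0 <= t <= T -> in_W1p p (U t).2 by move=> /DU[].
have DK t : 0 <= t <= T -> in_W1p p (K (U t).1) by move=> /D1; exact: in_W1p_nl_op.
have d1 : differential T (fun t => (U t).1) (fun t => (U t).2).
  move=> t tT e e0; have [d d0 Hd] := HU t tT e e0; exists d => // s sT sd.
  by apply: le_trans (Hd s sT sd); rewrite lerDl.
have d2 : differential T (fun t => (U t).2) (fun t => K (U t).1).
  move=> t tT e e0; have [d d0 Hd] := HU t tT e e0; exists d => // s sT sd.
  by apply: le_trans (Hd s sT sd); rewrite lerDr.
exists (fun t => (U t).2), (fun t => K (U t).1); split.
  by move=> t tT; split; [exact: D1|split; [exact: D2|exact: DK]].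
split; first exact/X_derivP.
split; first exact/X_derivP.
split.
  have [M UM] := solution_bounded cs wave_field_dom T0 (conj DU HU).
  have [L L0 HL] := nl_op_locally_lipschitz p1 ial Cw w0 M.
  have UM1 t : 0 <= t <= T -> N (U t).1 <= M.
    by move=> /UM; apply: le_trans; rewrite lerDl.
  move=> t tT e e0; have e'0 : 0 < e / (L + 1) by rewrite divr_gt0//; lra.
  have [d d0 Hd] := differential_continuous D1 D2 d1 tT e'0.
  exists d; split=> // s sT sd; rewrite W1p_normE ?lee_fin; last first.
    by apply: (csn_sub cs1); exact: DK.
  apply: le_trans (HL _ _ (D1 _ sT) (D1 _ tT) (UM1 _ sT) (UM1 _ tT)) _.
  have := Hd s sT sd; rewrite ler_pdivlMr; last lra.
  by have := n0 ((U s).1 - (U t).1); lra.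
have [T0' z1 z2] : [/\ 0 <= (0 : R) <= T, N ((U 0).1 - phi) = 0 & N ((U 0).2 - psi) = 0].
  have := n0 ((U 0).1 - phi); have := n0 ((U 0).2 - psi).
  by rewrite /state_norm /= in U0; rewrite lexx T0; split=> //; move: U0; lra.
split; first by move=> t _; exact: ae_eq_refl.
by split; apply/(W1p_seminorm_aeq p1) => //; [exact: D1|exact: D2].
Qed.

(** The given [u2] equals [K (u t)] only a.e. and only for t > 0; being at seminorm distance 0, it
    can be exchanged for [K (u t)] without affecting differentiability. *)
Lemma is_solution_solution T u phi psi : 0 < T -> in_W1p p phi -> in_W1p p psi ->
  is_solution p al w phi psi T u ->
  exists U, [/\ solution T U, state_norm (U 0 - (phi, psi)) = 0 & forall t, (U t).1 = u t].
Proof.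
have half (L y e : R) : 0 <= L -> 0 <= y -> y <= e / (2 * (L + 1)) -> L * y <= e / 2.
  by move=> L0 y0; rewrite ler_pdivlMr; lra.
move=> T0 Dphi Dpsi [u1 [u2 [Dall [X1 [X2 [C2 [eq0 [uphi upsi]]]]]]]].
have n0 f : 0 <= N f := W1p_seminorm_ge0 _ _.
have D t : 0 <= t <= T -> in_W1p p (u t) by move=> /Dall[].
have D1 t : 0 <= t <= T -> in_W1p p (u1 t) by move=> /Dall[_ []].
have D2 t : 0 <= t <= T -> in_W1p p (u2 t) by move=> /Dall[_ []].
have DK t : 0 <= t <= T -> in_W1p p (K (u t)) by move=> /D; exact: in_W1p_nl_op.
move/X_derivP: X1 => /(_ D D1) X1; move/X_derivP: X2 => /(_ D1 D2) X2.
have T00 : 0 <= (0 : R) <= T by rewrite lexx ltW.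
(* At t = 0 the equation is a limit of the equation at small positive times, by continuity of [u2]
   and of [K] along [u]. *)
have E0 : N (u2 0 - K (u 0)) = 0.
  have [L L0 HL] := nl_op_locally_lipschitz p1 ial Cw w0 (N (u 0) + 1).
  apply/eqP; rewrite eq_le n0 andbT; apply/ler_addgt0Pr => e e0; rewrite add0r.
  have [d1 [d10 Hd1]] := C2 0 T00 _ (divr_gt0 e0 (ltr0Sn R 1)).
  have e'0 : 0 < Num.min 1 (e / (2 * (L + 1))).
    by rewrite lt_min ltr01 divr_gt0//; lra.
  have [d2 d20 Hd2] := differential_continuous D D1 X1 T00 e'0.
  (* A positive time within [0, T] and strictly inside both moduli of continuity; it exists because
     [T > 0]. *)
  pose s := Num.min T (Num.min (d1 / 2) (d2 / 2)).
  have [s0 sT sd1 sd2] : [/\ 0 < s, s <= T, s <= d1 / 2 & s <= d2 / 2].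
    by rewrite /s !lt_min !ge_min T0 !divr_gt0// !lexx ?orbT.
  have sT' : 0 <= s <= T by rewrite ltW.
  have abs : `|s - 0| = s by rewrite subr0 ger0_norm// ltW.
  have := Hd1 s sT'; rewrite abs => /(_ ltac:(lra))/in_W1p_le[_ H1].
  have := Hd2 s sT'; rewrite abs le_min => /(_ ltac:(lra))/andP[H2 H2'].
  have Es : N (u2 s - K (u s)) = 0.
    by apply/(W1p_seminorm_aeq p1); [exact: D2|exact: DK|apply: eq0; rewrite s0].
  have us1 : N (u s) <= N (u 0) + 1.
    by have := csn_leBD cs1 (D _ sT') (D _ T00); lra.
  have H3 := HL _ _ (D _ sT') (D _ T00) us1 ltac:(lra).
  have t1 := csn_triangle cs1 (D2 _ T00) (D2 _ sT') (DK _ T00).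
  have t2 := csn_triangle cs1 (D2 _ sT') (DK _ sT') (DK _ T00).
  have t3 : N (u2 0 - u2 s) = N (u2 s - u2 0) := csn_distC cs1 (D2 _ T00) (D2 _ sT').
  have H4 : L * N (u s - u 0) <= e / 2.
    exact: half L0 (n0 _) H2'.
  rewrite t3 in t1; apply: le_trans t1 _; rewrite [leRHS]splitr; apply: lerD; first exact: H1.
  by apply: le_trans t2 _; rewrite Es add0r; exact: le_trans H3 H4.
have E t : 0 <= t <= T -> N (u2 t - K (u t)) = 0.
  move=> tT; have [->//|t0] := eqVneq t 0.
  apply/(W1p_seminorm_aeq p1); [exact: D2|exact: DK|apply: eq0].
  by move: tT => /andP[t0' ->]; rewrite andbT lt_neqAle eq_sym t0.
exists (fun t => (u t, u1 t)); split=> //.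
- split=> [t tT|t tT e e0]; first by split; [exact: D|exact: D1].
  have [d1 d10 H1] := X1 t tT _ (divr_gt0 e0 (ltr0Sn R 1)).
  have [d2 d20 H2] := X2 t tT _ (divr_gt0 e0 (ltr0Sn R 1)).
  exists (Num.min d1 d2) => [|s sT]; first by rewrite lt_min d10.
  rewrite lt_min => /andP[/(H1 s sT) h1 /(H2 s sT) h2]; rewrite /state_norm /=.
  have h3 : N (u1 s - u1 t - (s - t) *: K (u t)) <= N (u1 s - u1 t - (s - t) *: u2 t).
    rewrite (_ : u1 s - u1 t - (s - t) *: K (u t) =
      (u1 s - u1 t - (s - t) *: u2 t) + (s - t) *: (u2 t - K (u t))); last first.
      by rewrite scalerBr addrA subrK.
    have Da : in_W1p p (u1 s - u1 t - (s - t) *: u2 t).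
      by do 2?[apply: (csn_sub cs1)]; auto; apply: (csn_scale cs1); auto.
    have Db : in_W1p p (u2 t - K (u t)) by apply: (csn_sub cs1); auto.
    apply: le_trans (csn_ler cs1 Da (csn_scale cs1 _ Db)) _.
    by rewrite (csn_norm cs1)// E// mulr0 addr0.
  by move: h1 h2 h3; set q := `|s - t|; lra.
- rewrite /state_norm /=.
  have /(W1p_seminorm_aeq p1) -> // := uphi; last exact: D.
  have /(W1p_seminorm_aeq p1) -> // := upsi; last exact: D1.
  by rewrite addr0.
Qed.

End first_order_system.

(** * Well-posedness of the Cauchy problem *)

Theorem theorem2p4 (R : realType) (p : \bar R) (alpha w phi psi : R -> R) :
  (1 <= p)%E ->
  (@lebesgue_measure R).-integrable setT (EFin \o alpha) ->
  C2_real w -> w 0 = 0 ->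
  in_W1p p phi -> in_W1p p psi ->
  exists T : R, 0 < T /\ well_posed p alpha w phi psi T.
Proof.
move=> p1 ial Cw w0 Dphi Dpsi.
have cs1 := W1p_complete_seminorm p1; have cs := state_complete_seminorm p1.
have FD z : state_dom p z -> state_dom p (wave_field alpha w z).
  exact: wave_field_dom.
have FL := wave_field_lipschitz p1 ial Cw w0.
have n0 f : 0 <= W1p_seminorm p f := W1p_seminorm_ge0 p f.
(* The [+ 1] makes the same [T] valid for all data at distance less than 1 from the given ones. *)
pose M := W1p_seminorm p phi + W1p_seminorm p psi + 1.
have [T T0 HT] := local_existence cs FD FL M.
have T00 : 0 <= (0 : R) <= T by rewrite lexx ltW.
have Dinit : state_dom p (phi, psi) by [].
exists T; split=> //; split; [|split].
- have [|U [SU U0 _]] := HT (phi, psi) Dinit; first by rewrite /state_norm /M /=; lra.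
  by exists (fun t => (U t).1); exact: (solution_is_solution p1 ial Cw w0 (ltW T0) Dphi Dpsi SU U0).
- move=> u v /(is_solution_solution p1 ial Cw w0 T0 Dphi Dpsi)[U [SU U0 Uu]].
  move=> /(is_solution_solution p1 ial Cw w0 T0 Dphi Dpsi)[W [SW W0 Wv]] t tT.
  have [M' WM'] := solution_bounded cs FD (ltW T0) SW.
  have [C C0 HC] := solution_dist cs FD FL (ltW T0) SU M'.
  have [DU _] := SU; have [DW _] := SW.
  have := HC W SW WM' t tT.
  have : state_norm p (U 0 - W 0) <= 0.
    have := csn_triangle cs (DU _ T00) Dinit (DW _ T00).
    by rewrite U0 (csn_distC cs Dinit (DW _ T00)) W0 addr0.
  move=> h1 h2; have := ler_wpM2l C0 h1; rewrite mulr0 => h3.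
  have := le_trans h2 h3; rewrite /state_norm /= => h4.
  rewrite -Uu -Wv; apply/(W1p_seminorm_aeq p1); [by case: (DU t tT)|by case: (DW t tT)|].
  have := n0 ((U t).1 - (W t).1); have := n0 ((U t).2 - (W t).2).
  by move: h4; lra.
- move=> u /(is_solution_solution p1 ial Cw w0 T0 Dphi Dpsi)[U [SU U0 Uu]] e e0.
  (* [M + 1] is the bound that local existence provides for every perturbed solution, so [C] is
     known before the perturbation. *)
  have [C C0 HC] := solution_dist cs FD FL (ltW T0) SU (M + 1).
  have C10 : 0 < C + 1 by lra.
  (* The 1 keeps the perturbed data within [M]; the quotient turns the Lipschitz estimate into [e],
     also when [C = 0]. *)
  exists (Num.min 1 (e / (C + 1))); split; first by rewrite lt_min ltr01 divr_gt0.
  move=> phi' psi' Dphi' Dpsi'.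
  have [D1 _] := W1p_seminormB p1 Dphi' Dphi; have [D2 _] := W1p_seminormB p1 Dpsi' Dpsi.
  rewrite (W1p_normE D1) (W1p_normE D2) -EFinD lte_fin lt_min ltr_pdivlMr// => /andP[d1 de].
  have Dinit' : state_dom p (phi', psi') by [].
  have dE : W1p_seminorm p (fun x => phi' x - phi x) + W1p_seminorm p (fun x => psi' x - psi x)
      = state_norm p ((phi', psi') - (phi, psi)) by [].
  rewrite {}dE in d1 de.
  have [|W [SW W0 WM]] := HT (phi', psi') Dinit'.
    by have := csn_leBD cs Dinit' Dinit; rewrite /M; move: d1; rewrite /state_norm /=; lra.
  exists (fun t => (W t).1); split.
    exact: (solution_is_solution p1 ial Cw w0 (ltW T0) Dphi' Dpsi' SW W0).
  move=> t tT; have [DU _] := SU; have [DW _] := SW.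
  have [DUt1 DUt2] := DU t tT; have [DWt1 DWt2] := DW t tT.
  have [D _] := W1p_seminormB p1 DWt1 DUt1; rewrite -Uu W1p_normE// lee_fin.
  rewrite (W1p_seminorm_distC p1 DWt1 DUt1).
  have := HC W SW WM t tT.
  have h0 : state_norm p (U 0 - W 0) <= state_norm p ((phi', psi') - (phi, psi)).
    have := csn_triangle cs (DU _ T00) Dinit (DW _ T00); rewrite U0.
    have := csn_triangle cs Dinit Dinit' (DW _ T00).
    rewrite (csn_distC cs Dinit' (DW _ T00)) W0 (csn_distC cs Dinit Dinit'); lra.
  have h1 := ler_wpM2l C0 h0.
  have := n0 ((U t).2 - (W t).2); have := csn_ge0 cs (csn_sub cs Dinit' Dinit).
  have -> : state_norm p (U t - W t) = W1p_seminorm p (fun x => (U t).1 x - (W t).1 x) +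
    W1p_seminorm p ((U t).2 - (W t).2) by [].
  move: h1 de; lra.
Qed.
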